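(* Let $A$ be an augmented dg algebra over a field $k$, and equip the category of right dg $A$-modules with the model structure of the second kind described in the context. Then the homotopy category of this model category is a compactly generated triangulated category, with compact (small) objects being the dg $A$-modules that are homotopy equivalent to retracts of finitely generated twisted $A$-modules.
   Context: $k$ is a field; dg algebras and dg modules are cohomologically $\mathbb Z$-graded, modules are right modules. A Maurer–Cartan element of a dg algebra $E$ is $x\in E^1$ with $dx+x^2=0$; the set of them is $\mathrm{MC}(E)$. A finitely generated twisted $A$-module is a dg $A$-module which, disregarding the differential, is isomorphic as a graded $A$-module to $V\otimes A$ with $V$ a finite-dimensional graded vector space. Every such module has the form $(V\otimes A)^{[x]}$: the graded module $V\otimes A$ with differential $m\mapsto (1\otimes d_A)(m)+xm$ for some $x\in\mathrm{MC}(\operatorname{End}(V)\otimes A)$. Model structure on right dg $A$-modules: a morphism $M\to N$ is a weak equivalence if $\operatorname{Hom}_A((V\otimes A)^{[x]},M)\to\operatorname{Hom}_A((V\otimes A)^{[x]},N)$ is a quasi-isomorphism for every finitely generated twisted $A$-module $(V\otimes A)^{[x]}$; fibrations are the surjections; cofibrations are the maps with the left lifting property with respect to acyclic fibrations. Its homotopy category is denoted $D^{\mathrm{II}}_c(A)$.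
   Formalization: Retracts of finitely generated twisted modules are taken up to homotopy (strict dg retracts make the claim false), and compact objects are described up to isomorphism in the homotopy category, with the literal homotopy-equivalence description stated for cofibrant dg modules. *)

(* Defs.v *)
From HB Require Import structures.
From mathcomp Require Import all_boot all_order all_algebra.

Set Implicit Arguments.
Unset Strict Implicit.
Unset Printing Implicit Defensive.

Import GRing.Theory.
Local Open Scope ring_scope.

(* Morphisms carry an equivalence relation [heq] playing the role of equality:
   this gives localizations, whose morphisms are equivalence classes of words,
   without forming quotient types. *)
Record category := Category {
  ob :> Type;
  hom : ob -> ob -> Type;
  heq : forall X Y, hom X Y -> hom X Y -> Prop;
  idm : forall X, hom X X;
  cmp : forall X Y Z, hom Y Z -> hom X Y -> hom X Z;
  heq_refl : forall X Y (f : hom X Y), heq f f;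
  heq_sym : forall X Y (f g : hom X Y), heq f g -> heq g f;
  heq_trans : forall X Y (f g h : hom X Y), heq f g -> heq g h -> heq f h;
  cmp_heq : forall X Y Z (g g' : hom Y Z) (f f' : hom X Y),
    heq g g' -> heq f f' -> heq (cmp g f) (cmp g' f');
  cmpA : forall X Y Z T (h : hom Z T) (g : hom Y Z) (f : hom X Y),
    heq (cmp h (cmp g f)) (cmp (cmp h g) f);
  cmp1m : forall X Y (f : hom X Y), heq (cmp (idm Y) f) f;
  cmpm1 : forall X Y (f : hom X Y), heq (cmp f (idm X)) f
}.

Arguments idm {_} X.
Notation "f =~ g" := (heq f g) (at level 70, no associativity).
Notation "g \c f" := (cmp g f) (at level 40, left associativity).

Record functor (C D : category) := Functor {
  fob :> C -> D;
  fmap : forall X Y, hom X Y -> hom (fob X) (fob Y);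
  fmap_heq : forall X Y (f g : hom X Y), f =~ g -> fmap f =~ fmap g;
  fmap_id : forall X, fmap (idm X) =~ idm (fob X);
  fmap_cmp : forall X Y Z (g : hom Y Z) (f : hom X Y),
    fmap (g \c f) =~ fmap g \c fmap f
}.

Section CategoryNotions.
Variable C : category.

Definition is_iso (X Y : C) (f : hom X Y) :=
  exists g : hom Y X, g \c f =~ idm X /\ f \c g =~ idm Y.
Definition isomorphic (X Y : C) := exists f : hom X Y, is_iso f.

Definition is_initial (X : C) :=
  forall Y, exists f : hom X Y, forall g : hom X Y, g =~ f.
Definition is_terminal (X : C) :=
  forall Y, exists f : hom Y X, forall g : hom Y X, g =~ f.
Definition is_zero_object (X : C) := is_initial X /\ is_terminal X.

Definition morphism_class := forall X Y : C, hom X Y -> Prop.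

Definition has_LLP (R : morphism_class) : morphism_class := fun X Y i =>
  forall (E B : C) (p : hom E B), R E B p ->
  forall (u : hom X E) (v : hom Y B), p \c u =~ v \c i ->
  exists w : hom Y E, w \c i =~ u /\ p \c w =~ v.

End CategoryNotions.

Definition fully_faithful (C D : category) (F : functor C D) :=
  forall X Y : C,
    (forall f g : hom X Y, fmap F f =~ fmap F g -> f =~ g) /\
    (forall h : hom (F X) (F Y), exists f : hom X Y, fmap F f =~ h).

Definition is_equivalence (C D : category) (F : functor C D) :=
  fully_faithful F /\ forall Y : D, exists X : C, isomorphic (F X) Y.

(* The Gabriel-Zisman localization C[W^-1], presented by generators and
   relations. *)
Section Localization.
Variables (C : category) (W : morphism_class C).

Inductive loc_hom : C -> C -> Type :=
| loc_of X Y (f : hom X Y) : loc_hom X Y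
| loc_inv X Y (w : hom X Y) (_ : W w) : loc_hom Y X
| loc_cmp X Y Z (g : loc_hom Y Z) (f : loc_hom X Y) : loc_hom X Z.

Inductive loc_eq : forall X Y, loc_hom X Y -> loc_hom X Y -> Prop :=
| loc_refl X Y (f : loc_hom X Y) : loc_eq f f
| loc_sym X Y (f g : loc_hom X Y) : loc_eq f g -> loc_eq g f
| loc_trans X Y (f g h : loc_hom X Y) : loc_eq f g -> loc_eq g h -> loc_eq f h
| loc_cmp_eq X Y Z (g g' : loc_hom Y Z) (f f' : loc_hom X Y) :
    loc_eq g g' -> loc_eq f f' -> loc_eq (loc_cmp g f) (loc_cmp g' f')
| loc_cmpA X Y Z T (h : loc_hom Z T) (g : loc_hom Y Z) (f : loc_hom X Y) :
    loc_eq (loc_cmp h (loc_cmp g f)) (loc_cmp (loc_cmp h g) f)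
| loc_cmp1m X Y (f : loc_hom X Y) : loc_eq (loc_cmp (loc_of (idm Y)) f) f
| loc_cmpm1 X Y (f : loc_hom X Y) : loc_eq (loc_cmp f (loc_of (idm X))) f
| loc_of_heq X Y (f g : hom X Y) : f =~ g -> loc_eq (loc_of f) (loc_of g)
| loc_of_cmp X Y Z (g : hom Y Z) (f : hom X Y) :
    loc_eq (loc_of (g \c f)) (loc_cmp (loc_of g) (loc_of f))
| loc_invl X Y (w : hom X Y) (Ww : W w) :
    loc_eq (loc_cmp (loc_inv Ww) (loc_of w)) (loc_of (idm X))
| loc_invr X Y (w : hom X Y) (Ww : W w) :
    loc_eq (loc_cmp (loc_of w) (loc_inv Ww)) (loc_of (idm Y)).

Definition localization : category :=
  Category loc_refl loc_sym loc_trans loc_cmp_eq loc_cmpA loc_cmp1m loc_cmpm1.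

Definition loc_functor : functor C localization :=
  @Functor C localization id loc_of loc_of_heq
    (fun X => loc_refl (loc_of (idm X))) loc_of_cmp.

End Localization.

Section LocalizedFunctor.
Variables (C D : category) (W : morphism_class C) (W' : morphism_class D).
Variable F : functor C D.
Hypothesis FW : forall X Y (f : hom X Y), W f -> W' (fmap F f).

Fixpoint loc_map X Y (f : loc_hom W X Y) : loc_hom W' (F X) (F Y) :=
  match f with
  | loc_of _ _ f => loc_of W' (fmap F f)
  | loc_inv _ _ _ Ww => loc_inv (FW Ww)
  | loc_cmp _ _ _ g f => loc_cmp (loc_map g) (loc_map f)
  end.

Lemma loc_map_eq X Y (f g : loc_hom W X Y) :
  loc_eq f g -> loc_eq (loc_map f) (loc_map g).
Proof.
elim=> {X Y f g} /=.
- by move=> *; exact: loc_refl.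
- by move=> *; exact: loc_sym.
- by move=> X Y f g h _ fg _; exact: loc_trans.
- by move=> *; exact: loc_cmp_eq.
- by move=> *; exact: loc_cmpA.
- move=> X Y f; apply: loc_trans (loc_cmp1m _).
  by apply: loc_cmp_eq (loc_refl _); apply: loc_of_heq; exact: fmap_id.
- move=> X Y f; apply: loc_trans (loc_cmpm1 _).
  by apply: loc_cmp_eq (loc_refl _) _; apply: loc_of_heq; exact: fmap_id.
- by move=> X Y f g fg; apply: loc_of_heq; exact: fmap_heq.
- move=> X Y Z g f; apply: loc_trans (loc_of_cmp _ _ _).
  by apply: loc_of_heq; exact: fmap_cmp.
- move=> X Y w Ww; apply: loc_trans (loc_invl _) _.
  by apply: loc_of_heq; apply: heq_sym; exact: fmap_id.
- move=> X Y w Ww; apply: loc_trans (loc_invr _) _.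
  by apply: loc_of_heq; apply: heq_sym; exact: fmap_id.
Qed.

Definition localized_functor : functor (localization W) (localization W') :=
  @Functor (localization W) (localization W') F loc_map loc_map_eq
    (fun X => loc_of_heq W' (fmap_id F X)) (fun X Y Z g f => loc_refl _).

End LocalizedFunctor.

Record preadditive (C : category) := Preadditive {
  hadd : forall X Y : C, hom X Y -> hom X Y -> hom X Y;
  hzero : forall X Y : C, hom X Y;
  hopp : forall X Y : C, hom X Y -> hom X Y;
  hadd_heq : forall X Y (f f' g g' : hom X Y),
    f =~ f' -> g =~ g' -> hadd f g =~ hadd f' g';
  haddA : forall X Y (f g h : hom X Y), hadd f (hadd g h) =~ hadd (hadd f g) h;
  haddC : forall X Y (f g : hom X Y), hadd f g =~ hadd g f;
  hadd0 : forall X Y (f : hom X Y), hadd (hzero X Y) f =~ f;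
  haddN : forall X Y (f : hom X Y), hadd (hopp f) f =~ hzero X Y;
  cmpDl : forall X Y Z (g g' : hom Y Z) (f : hom X Y),
    hadd g g' \c f =~ hadd (g \c f) (g' \c f);
  cmpDr : forall X Y Z (g : hom Y Z) (f f' : hom X Y),
    g \c hadd f f' =~ hadd (g \c f) (g \c f')
}.

Arguments hzero {C} P X Y : rename.

(* "Small" is measured by one fixed universe: the index types of coproducts and
   those of generating sets have to live in the same one. *)
Definition small := Type.

Section Triangulated.
Variables (C : category) (P : preadditive C).

Definition is_additive :=
  (exists Z : C, is_zero_object Z) /\
  forall X Y : C, exists (S : C) (i1 : hom X S) (i2 : hom Y S)
    (p1 : hom S X) (p2 : hom S Y),
    [/\ p1 \c i1 =~ idm X, p2 \c i2 =~ idm Y,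
        p1 \c i2 =~ hzero P Y X, p2 \c i1 =~ hzero P X Y &
        hadd P (i1 \c p1) (i2 \c p2) =~ idm S].

Definition is_additive_functor (F : functor C C) :=
  forall X Y (f g : hom X Y),
    fmap F (hadd P f g) =~ hadd P (fmap F f) (fmap F g).

Variable Sh : functor C C.

Definition triangle_class :=
  forall X Y Z : C, hom X Y -> hom Y Z -> hom Z (Sh X) -> Prop.

Record is_triangulated (dist : triangle_class) : Prop := IsTriangulated {
  tr_additive : is_additive;
  tr_shift_additive : is_additive_functor Sh;
  tr_shift_equiv : is_equivalence Sh;
  tr_isoclosed : forall X Y Z X' Y' Z'
    (f : hom X Y) (g : hom Y Z) (h : hom Z (Sh X))
    (f' : hom X' Y') (g' : hom Y' Z') (h' : hom Z' (Sh X'))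
    (a : hom X X') (b : hom Y Y') (c : hom Z Z'),
    is_iso a -> is_iso b -> is_iso c ->
    b \c f =~ f' \c a -> c \c g =~ g' \c b -> fmap Sh a \c h =~ h' \c c ->
    dist X Y Z f g h -> dist X' Y' Z' f' g' h';
  tr_id : forall X Z, is_zero_object Z ->
    dist X X Z (idm X) (hzero P X Z) (hzero P Z (Sh X));
  tr_cone : forall X Y (f : hom X Y),
    exists (Z : C) (g : hom Y Z) (h : hom Z (Sh X)), dist X Y Z f g h;
  tr_rotate : forall X Y Z (f : hom X Y) (g : hom Y Z) (h : hom Z (Sh X)),
    dist X Y Z f g h <-> dist Y Z (Sh X) g h (hopp P (fmap Sh f));
  tr_morphism : forall X Y Z X' Y' Z'
    (f : hom X Y) (g : hom Y Z) (h : hom Z (Sh X))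
    (f' : hom X' Y') (g' : hom Y' Z') (h' : hom Z' (Sh X'))
    (a : hom X X') (b : hom Y Y'),
    dist X Y Z f g h -> dist X' Y' Z' f' g' h' -> b \c f =~ f' \c a ->
    exists c : hom Z Z', c \c g =~ g' \c b /\ fmap Sh a \c h =~ h' \c c;
  tr_octahedron : forall X Y Z X' Y' Z'
    (f : hom X Y) (j : hom Y Z') (k : hom Z' (Sh X))
    (g : hom Y Z) (l : hom Z X') (i : hom X' (Sh Y))
    (m : hom Z Y') (n : hom Y' (Sh X)),
    dist X Y Z' f j k -> dist Y Z X' g l i -> dist X Z Y' (g \c f) m n ->
    exists (u : hom Z' Y') (v : hom Y' X'),
      dist Z' Y' X' u v (fmap Sh j \c i) /\
      [/\ k =~ n \c u, l =~ v \c m, u \c j =~ m \c g &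
          i \c v =~ fmap Sh f \c n]
}.

Definition is_coproduct (I : small) (Y : I -> C) (S : C)
    (inj : forall i, hom (Y i) S) :=
  forall (T : C) (f : forall i, hom (Y i) T),
    exists u : hom S T, (forall i, u \c inj i =~ f i) /\
      forall v : hom S T, (forall i, v \c inj i =~ f i) -> v =~ u.

Definition has_small_coproducts :=
  forall (I : small) (Y : I -> C),
    exists (S : C) (inj : forall i, hom (Y i) S), is_coproduct inj.

(* The canonical map from the direct sum of the groups [hom X (Y i)] to
   [hom X S], S the coproduct of the [Y i], is surjective and injective.
   An element of the direct sum is a family [f] on finitely many distinct
   indices [e 0], ..., [e n.-1]. *)
Definition is_compact (X : C) :=
  forall (I : small) (Y : I -> C) (S : C) (inj : forall i, hom (Y i) S),
    is_coproduct inj ->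
    (forall h : hom X S, exists (n : nat) (e : 'I_n -> I)
        (f : forall j, hom X (Y (e j))), injective e /\
        h =~ \big[@hadd _ P X S/hzero P X S]_(j < n) (inj (e j) \c f j)) /\
    (forall (n : nat) (e : 'I_n -> I) (f : forall j, hom X (Y (e j))),
        injective e ->
        \big[@hadd _ P X S/hzero P X S]_(j < n) (inj (e j) \c f j)
          =~ hzero P X S ->
        forall j, f j =~ hzero P X (Y (e j))).

(* A small family of compact objects G i such that Hom(G i, X[n]) = 0 for all i
   and all integers n only if X = 0.  Nonnegative and nonpositive n are treated
   separately, since only the positive shift is part of the data. *)
Definition is_compactly_generated :=
  has_small_coproducts /\
  exists (I : small) (G : I -> C),
    (forall i, is_compact (G i)) /\
    forall X : C,
      (forall i n (f : hom (G i) (iter n Sh X)), f =~ hzero P _ _) ->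
      (forall i n (f : hom (iter n Sh (G i)) X), f =~ hzero P _ _) ->
      is_zero_object X.

End Triangulated.

(* A Z-graded vector space is encoded as the total space V = (+)_i V^i together
   with its homogeneous subspaces V^i; the two last fields say that V is their
   direct sum. *)
Record grading (k : fieldType) (V : lmodType k) := Grading {
  hgs :> int -> V -> Prop;
  hgs0 : forall i, hgs i 0;
  hgsP : forall i (c : k) u v, hgs i u -> hgs i v -> hgs i (c *: u + v);
  hgs_span : forall v, exists (n : nat) (e : 'I_n -> int) (c : 'I_n -> V),
    (forall j, hgs (e j) (c j)) /\ v = \sum_j c j;
  hgs_free : forall (n : nat) (e : 'I_n -> int) (c : 'I_n -> V),
    injective e -> (forall j, hgs (e j) (c j)) -> \sum_j c j = 0 ->
    forall j, c j = 0
}.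

Definition sgn (k : fieldType) (n : int) : k := (-1) ^+ `|n|%N.
Arguments sgn {k} n.

Lemma sgnS (k : fieldType) (n : int) : sgn (n + 1) = - sgn n :> k.
Proof.
rewrite /sgn; case: n => n; first by rewrite -PoszD addn1 /= exprS mulN1r.
case: n => [|n]; first by rewrite /= expr1 opprK.
have -> : Negz n.+1 + 1 = Negz n by rewrite !NegzE -addn1 PoszD opprD subrK.
by rewrite /= [in RHS]exprS mulN1r opprK.
Qed.

Record dgAlg (k : fieldType) := DgAlg {
  dga_car :> algType k;
  dga_gr : grading dga_car;
  dga_gr1 : dga_gr 0 1;
  dga_grM : forall i j a b, dga_gr i a -> dga_gr j b -> dga_gr (i + j) (a * b);
  dga_d : {linear dga_car -> dga_car};
  dga_d_gr : forall i a, dga_gr i a -> dga_gr (i + 1) (dga_d a);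
  dga_dd : forall a, dga_d (dga_d a) = 0;
  dga_dM : forall i a b, dga_gr i a ->
    dga_d (a * b) = dga_d a * b + sgn i *: (a * dga_d b)
}.

(* A morphism of dg algebras A -> k, where k sits in degree 0 with d = 0. *)
Record augmentation (k : fieldType) (A : dgAlg k) := Augmentation {
  aug_map :> {lrmorphism A -> k^o};
  aug_gr : forall i (a : A), i != 0 -> dga_gr A i a -> aug_map a = 0;
  aug_d : forall a, aug_map (dga_d A a) = 0
}.

Section DgModules.
Variables (k : fieldType) (A : dgAlg k).

Record grMod := GrMod {
  gm_car :> lmodType k;
  gm_gr : grading gm_car;
  ract : gm_car -> A -> gm_car;
  ract_linl : forall a, linear (ract^~ a);
  ract_linr : forall m, linear (ract m);
  ract1 : forall m, ract m 1 = m;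
  ractM : forall m a b, ract m (a * b) = ract (ract m a) b;
  ract_gr : forall i j m a,
    gm_gr i m -> dga_gr A j a -> gm_gr (i + j) (ract m a)
}.

Lemma ract0l (M : grMod) a : ract (0 : M) a = 0.
Proof.
have /= := ract_linl a 1 (0 : M) 0; rewrite !scale1r addr0 => /eqP.
by rewrite -subr_eq0 opprD addrA subrr sub0r oppr_eq0 => /eqP.
Qed.

Lemma ractZl (M : grMod) c (m : M) a : ract (c *: m) a = c *: ract m a.
Proof. by have /= := ract_linl a c m 0; rewrite ract0l !addr0. Qed.

Lemma ractDl (M : grMod) (m m' : M) a : ract (m + m') a = ract m a + ract m' a.
Proof. by have /= := ract_linl a 1 m m'; rewrite !scale1r. Qed.

Lemma ractNl (M : grMod) (m : M) a : ract (- m) a = - ract m a.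
Proof. by rewrite -scaleN1r ractZl scaleN1r. Qed.

Record dgMod := DgMod {
  dgm_gr :> grMod;
  dgm_d : {linear dgm_gr -> dgm_gr};
  dgm_d_gr : forall i m, gm_gr dgm_gr i m -> gm_gr dgm_gr (i + 1) (dgm_d m);
  dgm_dd : forall m, dgm_d (dgm_d m) = 0;
  dgm_dM : forall i m a, gm_gr dgm_gr i m ->
    dgm_d (ract m a) = ract (dgm_d m) a + sgn i *: ract m (dga_d A a)
}.

(* Hom_A(M, N)^n; k-linearity is implied by A-linearity but convenient. *)
Record ghom (M N : grMod) (n : int) := GHom {
  gh_fun :> {linear M -> N};
  gh_gr : forall i m, gm_gr M i m -> gm_gr N (i + n) (gh_fun m);
  gh_act : forall m a, gh_fun (ract m a) = ract (gh_fun m) a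
}.

(* The differential of the complex Hom_A(M, N). *)
Definition hom_d (M N : dgMod) (n : int) (f : ghom M N n) (m : M) : N :=
  dgm_d N (f m) - sgn n *: f (dgm_d M m).

Definition is_cocycle (M N : dgMod) (n : int) (f : ghom M N n) :=
  forall m, hom_d f m = 0.

Definition is_coboundary (M N : dgMod) (n : int) (f : M -> N) :=
  exists h : ghom M N (n - 1), forall m, f m = hom_d h m.

Record dghom (M N : dgMod) := DgHom {
  dgh_gh :> ghom M N 0;
  dgh_d : forall m, dgm_d N (dgh_gh m) = dgh_gh (dgm_d M m)
}.

(* The map induced by f on H^n(Hom_A(T, -)) is bijective for all n, spelled out
   on representatives. *)
Definition hom_quasi_iso (T M N : dgMod) (f : dghom M N) :=
  forall n : int,
    (forall z z' : ghom T M n, is_cocycle z -> is_cocycle z' ->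
       is_coboundary n (fun t => f (z t) - f (z' t)) ->
       is_coboundary n (fun t => z t - z' t)) /\
    (forall w : ghom T N n, is_cocycle w ->
       exists z : ghom T M n, is_cocycle z /\
         is_coboundary n (fun t => f (z t) - w t)).

Program Definition dg_id (M : dgMod) : dghom M M :=
  @DgHom M M (@GHom M M 0 idfun _ _) _.
Next Obligation. by move=> M i m Hm; rewrite addr0. Qed.
Next Obligation. by []. Qed.
Next Obligation. by []. Qed.

Program Definition dg_comp (M N P : dgMod) (g : dghom N P) (f : dghom M N) :
  dghom M P := @DgHom M P (@GHom M P 0 (g \o f) _ _) _.
Next Obligation.
by move=> M N P g f i m Hm /=; have := gh_gr g (gh_gr f Hm); rewrite !addr0.
Qed.
Next Obligation. by move=> M N P g f m a /=; rewrite !gh_act. Qed.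
Next Obligation. by move=> M N P g f m /=; rewrite !dgh_d. Qed.

Program Definition dgModCat : category :=
  @Category dgMod dghom (fun M N f g => f =1 g) dg_id dg_comp _ _ _ _ _ _ _.
Next Obligation. by []. Qed.
Next Obligation. by move=> M N f g fg m; rewrite fg. Qed.
Next Obligation. by move=> M N f g h fg gh m; rewrite fg gh. Qed.
Next Obligation. by move=> M N P g g' f f' eg ef m /=; rewrite ef eg. Qed.
Next Obligation. by []. Qed.
Next Obligation. by []. Qed.
Next Obligation. by []. Qed.

Definition homotopic (M N : dgMod) (f g : dghom M N) :=
  is_coboundary 0 (fun m => f m - g m).

Definition homotopy_equivalent (M N : dgMod) :=
  exists (f : dghom M N) (g : dghom N M),
    homotopic (dg_comp g f) (dg_id M) /\ homotopic (dg_comp f g) (dg_id N).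

(* N is a retract of T in the homotopy category H^0 of the dg category of
   dg modules.  Pitfall: asking for p i = id on the nose would be too strong,
   since homotopy idempotents of twisted modules need not strictify. *)
Definition is_homotopy_retract (N T : dgMod) :=
  exists (i : dghom N T) (p : dghom T N), homotopic (dg_comp p i) (dg_id N).

Section Free.
Variables (n : nat) (v : 'I_n -> int).

Definition free_hgs (i : int) (f : {ffun 'I_n -> A}) :=
  forall j, dga_gr A (i - v j) (f j).

Lemma free_hgs0 i : free_hgs i 0.
Proof. by move=> j; rewrite ffunE; exact: hgs0. Qed.

Lemma free_hgsP i (c : k) f g :
  free_hgs i f -> free_hgs i g -> free_hgs i (c *: f + g).
Proof. by move=> Hf Hg j; rewrite !ffunE; exact: hgsP. Qed.

Lemma free_hgs_span (f : {ffun 'I_n -> A}) :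
  exists (m : nat) (e : 'I_m -> int) (c : 'I_m -> {ffun 'I_n -> A}),
    (forall j, free_hgs (e j) (c j)) /\ f = \sum_j c j.
Proof.
pose spanned (g : {ffun 'I_n -> A}) :=
  exists (m : nat) (e : 'I_m -> int) (c : 'I_m -> {ffun 'I_n -> A}),
    (forall j, free_hgs (e j) (c j)) /\ g = \sum_j c j.
have spanned0 : spanned 0.
  by exists 0%N, (fun=> 0), (fun=> 0); split=> [[]|]; rewrite ?big_ord0.
have spannedD g h : spanned g -> spanned h -> spanned (g + h).
  move=> [m1 [e1 [c1 [H1 ->]]]] [m2 [e2 [c2 [H2 ->]]]].
  exists (m1 + m2)%N,
    (fun j => match split j with inl j => e1 j | inr j => e2 j end),
    (fun j => match split j with inl j => c1 j | inr j => c2 j end).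
  split=> [j|]; first by case: (split j).
  rewrite big_split_ord /=; congr (_ + _); apply: eq_bigr => j _.
    by case: splitP => j' /= E; [congr c1; exact: val_inj |
      have := ltn_ord j; rewrite E ltnNge leq_addr].
  case: splitP => j' /= E; first by have := ltn_ord j'; rewrite -E ltnNge leq_addr.
  by congr c2; apply: val_inj; exact: addnI E.
pose del (j : 'I_n) (a : A) : {ffun 'I_n -> A} :=
  [ffun j' => if j' == j then a else 0].
have -> : f = \sum_j del j (f j).
  apply/ffunP=> j; rewrite sum_ffunE (bigD1 j) //= ffunE eqxx big1 ?addr0 //.
  by move=> j' /negPf nj; rewrite ffunE eq_sym nj.
apply: (big_ind spanned) => // j _.
have [m [e [c [Hc ->]]]] := hgs_span (dga_gr A) (f j).
exists m, (fun l => e l + v j), (fun l => del j (c l)); split.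
  move=> l j'; rewrite ffunE; case: eqP => [->|_]; last exact: hgs0.
  by rewrite addrK.
apply/ffunP=> j'; rewrite sum_ffunE ffunE; case: eqP => [->|/eqP/negPf nj].
  by apply: eq_bigr => l _; rewrite ffunE eqxx.
by rewrite big1 // => l _; rewrite ffunE nj.
Qed.

Lemma free_hgs_free (m : nat) (e : 'I_m -> int) (c : 'I_m -> {ffun 'I_n -> A}) :
  injective e -> (forall j, free_hgs (e j) (c j)) -> \sum_j c j = 0 ->
  forall j, c j = 0.
Proof.
move=> inj_e Hc c0 j; apply/ffunP=> l; rewrite ffunE.
apply: (@hgs_free _ _ (dga_gr A) m (fun j => e j - v l) (fun j => c j l)) => //.
- by move=> j1 j2 /addIr /inj_e.
- by move=> j'; exact: Hc.
- by have /ffunP /(_ l) := c0; rewrite sum_ffunE ffunE.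
Qed.

Definition free_grading := Grading free_hgs0 free_hgsP free_hgs_span free_hgs_free.

(* V (x) A for V with a homogeneous basis (e_j)_(j < n), e_j of degree v j:
   the family f stands for \sum_j e_j (x) f j. *)
Program Definition freeMod : grMod :=
  @GrMod {ffun 'I_n -> A} free_grading (fun f a => [ffun j => f j * a])
    _ _ _ _ _.
Next Obligation.
by move=> a c f g; apply/ffunP=> j; rewrite !ffunE mulrDl scalerAl.
Qed.
Next Obligation.
by move=> f c a b; apply/ffunP=> j; rewrite !ffunE mulrDr scalerAr.
Qed.
Next Obligation. by move=> f; apply/ffunP=> j; rewrite ffunE mulr1. Qed.
Next Obligation. by move=> f a b; apply/ffunP=> j; rewrite !ffunE mulrA. Qed.
Next Obligation.
by move=> i j f a Hf Ha l; rewrite ffunE addrAC; exact: dga_grM.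
Qed.

End Free.

Definition gr_isomorphic (M N : grMod) :=
  exists (f : ghom M N 0) (g : ghom N M 0), cancel f g /\ cancel g f.

(* No condition on the differential of T: up to isomorphism these are the
   (V (x) A)^[x] for all Maurer-Cartan elements x of End(V) (x) A. *)
Definition is_fg_twisted (T : dgMod) :=
  exists (n : nat) (v : 'I_n -> int), gr_isomorphic T (freeMod v).

(* Weak equivalences, fibrations and cofibrations of the model structure of the
   second kind. *)
Definition weqII : morphism_class dgModCat := fun M N f =>
  forall T : dgMod, is_fg_twisted T -> hom_quasi_iso T f.

Definition fibII : morphism_class dgModCat := fun M N f =>
  forall y : N, exists x : M, f x = y.

Definition cofII : morphism_class dgModCat :=
  has_LLP (fun M N f => fibII f /\ weqII f).

Definition is_cofibrantII (M : dgModCat) :=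
  forall (O : dgModCat) (f : hom O M), is_initial O -> cofII f.

(* D^II_c(A), the homotopy category: all dg modules, weak equivalences formally
   inverted.  It depends on the weak equivalences only. *)
Definition DIIc : category := localization weqII.
Definition gammaII : functor dgModCat DIIc := loc_functor weqII.

Section Shift.
Variable M : dgMod.

Definition shift_grading : grading M.
Proof.
apply: (@Grading k M (fun i => gm_gr M (i + 1))).
- by move=> i; exact: hgs0.
- by move=> i c u w; exact: hgsP.
- move=> m; have [n [e [c [Hc ->]]]] := hgs_span (gm_gr M) m.
  by exists n, (fun j => e j - 1), c; split=> // j; rewrite subrK.
- move=> n e c inj_e Hc; apply: (@hgs_free _ _ (gm_gr M) n (fun j => e j + 1)) => //.
  by move=> i j /addIr /inj_e.
Defined.

Program Definition shift_gr : grMod :=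
  @GrMod M shift_grading (@ract M) (@ract_linl M) (@ract_linr M)
    (@ract1 M) (@ractM M) _.
Next Obligation. by move=> i j m a Hm Ha; rewrite /= addrAC; exact: ract_gr. Qed.

Definition shift_d (m : shift_gr) : shift_gr := - dgm_d M m.

Lemma shift_d_linear : linear shift_d.
Proof. by move=> c u w; rewrite /shift_d linearP opprD scalerN. Qed.
HB.instance Definition _ :=
  GRing.isLinear.Build k shift_gr shift_gr *:%R shift_d shift_d_linear.

(* M[1]^i = M^(i+1), with differential -d and the same right action. *)
Program Definition shift : dgMod := @DgMod shift_gr shift_d _ _ _.
Next Obligation.
move=> i m Hm; have := hgsP (-1) (dgm_d_gr Hm) (hgs0 (gm_gr M) _).
by rewrite addr0 scaleN1r.
Qed.
Next Obligation. by move=> m; rewrite /= /shift_d linearN dgm_dd !oppr0. Qed.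
Next Obligation.
move=> i m a; rewrite /= /shift_d => /dgm_dM ->.
by rewrite opprD sgnS scaleNr opprK ractNl.
Qed.

End Shift.

Section ShiftMap.
Variables M N : dgMod.

Program Definition shift_map (f : dghom M N) : dghom (shift M) (shift N) :=
  @DgHom (shift M) (shift N)
    (@GHom (shift_gr M) (shift_gr N) 0 (gh_fun f) _ _) _.
Next Obligation. by move=> f i m Hm; rewrite /= addrAC; exact: gh_gr. Qed.
Next Obligation. by move=> f m a; exact: (gh_act f m a). Qed.
Next Obligation. by move=> f m; rewrite /= /shift_d linearN dgh_d. Qed.

End ShiftMap.

Program Definition shift_functor : functor dgModCat dgModCat :=
  @Functor dgModCat dgModCat shift shift_map _ _ _.
Next Obligation. by move=> M N f g fg m; exact: fg. Qed.
Next Obligation. by []. Qed.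
Next Obligation. by []. Qed.


Section WeqShift.
Variables T M : dgMod.

Lemma unshift_ghom n n' (c : k) (z : ghom T (shift M) n) :
  n' = n + 1 -> exists z' : ghom T M n', forall t, z' t = c *: (z t : M).
Proof.
move=> ->; pose f : {linear T -> M} := c \*: (gh_fun z : {linear T -> M}).
have fgr i m : gm_gr T i m -> gm_gr M (i + (n + 1)) (f m).
  move=> /(gh_gr z) Hm; rewrite addrA.
  by have := hgsP c Hm (hgs0 (gm_gr M) _); rewrite addr0.
have fact m a : f (ract m a) = ract (f m) a.
  by move: (gh_act z m a) => /= E; rewrite /f /= E -ractZl.
by exists (GHom fgr fact).
Qed.

Lemma shift_ghom n n' (c : k) (z : ghom T M n') :
  n' = n + 1 -> exists z' : ghom T (shift M) n, forall t, z' t = c *: z t :> M.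
Proof.
move=> n'E; pose f : {linear T -> shift M} := c \*: gh_fun z.
have fgr i m : gm_gr T i m -> gm_gr (shift M) (i + n) (f m).
  move=> /(gh_gr z) Hm; rewrite /= -addrA -n'E.
  by have := hgsP c Hm (hgs0 (gm_gr M) _); rewrite addr0.
have fact m a : f (ract m a) = ract (f m) a.
  by transitivity (c *: z (ract m a)); rewrite // (gh_act z) -ractZl.
by exists (GHom fgr fact).
Qed.

Lemma hom_d_shift n n' (c : k) (z : ghom T (shift M) n) (z' : ghom T M n') :
  n' = n + 1 -> (forall t, z' t = c *: (z t : M)) ->
  forall t, hom_d z' t = - (c *: (hom_d z t : M)).
Proof.
move=> n'E E t; rewrite /hom_d !E n'E sgnS linearZ /= /shift_d.
by rewrite scalerDr !scalerN scaleNr opprK opprD !opprK !scalerA mulrC.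
Qed.

Lemma coboundary_shift n (f : T -> M) :
  is_coboundary (M := T) (N := shift M) n f <->
  is_coboundary (M := T) (N := M) (n + 1) f.
Proof.
have E : n + 1 - 1 = n - 1 + 1 by rewrite addrK subrK.
split=> [[h Hh]|[h Hh]].
  have [h' Hh'] := unshift_ghom (-1) h E.
  exists h' => t; rewrite (hom_d_shift E Hh') Hh.
  by rewrite scaleN1r opprK.
have [h' Hh'] := shift_ghom (-1) h E.
exists h' => t; rewrite Hh.
have Eh s : h s = (-1) *: (h' s : M) by rewrite Hh' scalerA mulrNN mulr1 scale1r.
by rewrite (hom_d_shift E Eh) scaleN1r opprK.
Qed.

End WeqShift.

Lemma weqII_shift (M N : dgModCat) (f : hom M N) :
  weqII f -> weqII (fmap shift_functor f).
Proof.
move=> Wf T HT n; have [inj_f surj_f] := Wf T HT (n + 1); split.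
  move=> z z' Hz Hz' /coboundary_shift b; apply/coboundary_shift.
  have [y Ey] := unshift_ghom 1 z erefl.
  have [y' Ey'] := unshift_ghom 1 z' erefl.
  have Hy : is_cocycle y.
    by move=> t; rewrite (hom_d_shift erefl Ey) Hz scaler0 oppr0.
  have Hy' : is_cocycle y'.
    by move=> t; rewrite (hom_d_shift erefl Ey') Hz' scaler0 oppr0.
  have [|h Hh] := inj_f y y' Hy Hy'.
    have [h Hh] := b; exists h => t; rewrite -Hh.
    by rewrite Ey Ey' !scale1r.
  by exists h => t; rewrite -Hh Ey Ey' !scale1r.
move=> w Hw; have [w' Ew] := unshift_ghom 1 w erefl.
have Hw' : is_cocycle w'.
  by move=> t; rewrite (hom_d_shift erefl Ew) Hw scaler0 oppr0.
have [y [Hy b]] := surj_f w' Hw'.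
have [z Ez] := shift_ghom 1 y erefl.
have Ey t : y t = 1 *: (z t : M) by rewrite Ez !scale1r.
exists z; split.
  move=> t; have := Hy t; rewrite (hom_d_shift erefl Ey) scale1r.
  by move/eqP; rewrite oppr_eq0 => /eqP.
apply/coboundary_shift; have [h Hh] := b; exists h => t; rewrite -Hh.
by rewrite Ey Ew !scale1r.
Qed.

Definition DIIc_shift : functor DIIc DIIc := localized_functor weqII_shift.

Section Cone.
Variables (M N : dgMod) (f : dghom M N).

Definition cone_hgs (i : int) (x : (N * M)%type) :=
  gm_gr N i x.1 /\ gm_gr M (i + 1) x.2.

Lemma cone_hgs_span x :
  exists (n : nat) (e : 'I_n -> int) (c : 'I_n -> (N * M)%type),
    (forall j, cone_hgs (e j) (c j)) /\ x = \sum_j c j.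
Proof.
have [n1 [e1 [c1 [H1 E1]]]] := hgs_span (gm_gr N) x.1.
have [n2 [e2 [c2 [H2 E2]]]] := hgs_span (gm_gr M) x.2.
pose e j := match split j with inl j => e1 j | inr j => e2 j - 1 end.
pose c j := match split j with inl j => (c1 j, 0) | inr j => (0, c2 j) end
  : (N * M)%type.
exists (n1 + n2)%N, e, c; split=> [j|].
  rewrite /e /c; case: (split j) => j'; split=> //=; rewrite ?subrK //;
    exact: hgs0.
have cl j : c (lshift n2 j) = (c1 j, 0).
  by rewrite /c; case: splitP => j' /= E; [congr (c1 _, _); exact: val_inj |
    have := ltn_ord j; rewrite E ltnNge leq_addr].
have cr j : c (rshift n1 j) = (0, c2 j).
  rewrite /c; case: splitP => j' /= E.
    by have := ltn_ord j'; rewrite -E ltnNge leq_addr.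
  by congr (_, c2 _); apply: val_inj; exact/esym/addnI/E.
rewrite big_split_ord (eq_bigr _ (fun j _ => cl j)) /=.
rewrite (eq_bigr _ (fun j _ => cr j)).
have sum1 n (g : 'I_n -> (N * M)%type) :
    \sum_j g j = (\sum_j (g j).1, \sum_j (g j).2).
  by rewrite [LHS]surjective_pairing !raddf_sum.
rewrite !sum1 /= -E1 -E2 !big1 //.
by case: x {E1 E2} => a b; congr (_, _); rewrite /= ?addr0 ?add0r.
Qed.

Definition cone_grading : grading (N * M)%type.
Proof.
apply: (@Grading k _ cone_hgs).
- by move=> i; split; exact: hgs0.
- by move=> i c u w [? ?] [? ?]; split; apply: hgsP.
- exact: cone_hgs_span.
- move=> n e c inj_e Hc c0 j.
  have E1 : \sum_j (c j).1 = 0 by rewrite -raddf_sum c0.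
  have E2 : \sum_j (c j).2 = 0 by rewrite -raddf_sum c0.
  rewrite [c j]surjective_pairing; congr (_, _).
    apply: (@hgs_free _ _ (gm_gr N) n e (fun j => (c j).1)) => //.
    by move=> l; have [] := Hc l.
  apply: (@hgs_free _ _ (gm_gr M) n (fun j => e j + 1) (fun j => (c j).2)) => //.
    by move=> i l /addIr /inj_e.
  by move=> l; have [] := Hc l.
Defined.

Program Definition cone_gr : grMod :=
  @GrMod (N * M)%type cone_grading (fun x a => (ract x.1 a, ract x.2 a))
    _ _ _ _ _.
Next Obligation. by move=> a c u w; rewrite /= !ractDl !ractZl. Qed.
Next Obligation. by move=> x c a b; rewrite /= !ract_linr. Qed.
Next Obligation. by move=> [x y]; rewrite /= !ract1. Qed.
Next Obligation. by move=> x a b; rewrite /= !ractM. Qed.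
Next Obligation.
move=> i j x a [H1 H2] Ha; split; first exact: ract_gr.
by rewrite /= addrAC; exact: ract_gr.
Qed.

Definition cone_d (x : cone_gr) : cone_gr :=
  (dgm_d N x.1 + f x.2, - dgm_d M x.2).

Lemma cone_d_linear : linear cone_d.
Proof.
move=> c u w; rewrite /cone_d; congr (_, _); rewrite /= !linearP.
  by rewrite scalerDr addrACA.
by [].
Qed.
HB.instance Definition _ :=
  GRing.isLinear.Build k cone_gr cone_gr *:%R cone_d cone_d_linear.

(* The cone N (+) M[1], with differential (y, x) |-> (d y + f x, - d x). *)
Program Definition cone : dgMod := @DgMod cone_gr cone_d _ _ _.
Next Obligation.
move=> i [y x] [/= Hy Hx]; split=> /=.
  have := gh_gr f Hx; rewrite addr0 => /(hgsP 1 (dgm_d_gr Hy)).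
  by rewrite scale1r.
by have := hgsP (-1) (dgm_d_gr Hx) (hgs0 (gm_gr M) _); rewrite addr0 scaleN1r.
Qed.
Next Obligation.
move=> [y x]; rewrite /= /cone_d /= !linearD !linearN /= !dgm_dd dgh_d.
by rewrite add0r subrr oppr0 oppr0.
Qed.
Next Obligation.
move=> i [y x] a [/= Hy Hx]; rewrite /cone_d /=; congr (_, _) => /=.
  by rewrite (dgm_dM _ Hy) (gh_act f) ractDl addrAC.
by rewrite (dgm_dM _ Hx) sgnS scaleNr opprD opprK ractNl.
Qed.

Definition cone_inj_fun (y : N) : cone_gr := (y, 0).

Lemma cone_inj_fun_linear : linear cone_inj_fun.
Proof. by move=> c u w; congr (_, _); rewrite /= scaler0 addr0. Qed.
HB.instance Definition _ :=
  GRing.isLinear.Build k N cone_gr *:%R cone_inj_fun cone_inj_fun_linear.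

Program Definition cone_inj : dghom N cone :=
  @DgHom N cone (@GHom N cone_gr 0 cone_inj_fun _ _) _.
Next Obligation. by move=> i y Hy; rewrite addr0; split=> //; exact: hgs0. Qed.
Next Obligation. by move=> y a; congr (_, _); rewrite /= ract0l. Qed.
Next Obligation.
by move=> y; congr (_, _); rewrite /= !linear0 ?oppr0 ?addr0.
Qed.

Definition cone_proj_fun (x : cone_gr) : shift_gr M := x.2.

Lemma cone_proj_fun_linear : linear cone_proj_fun.
Proof. by []. Qed.
HB.instance Definition _ := GRing.isLinear.Build k cone_gr (shift_gr M) *:%R
  cone_proj_fun cone_proj_fun_linear.

Program Definition cone_proj : dghom cone (shift M) :=
  @DgHom cone (shift M) (@GHom cone_gr (shift_gr M) 0 cone_proj_fun _ _) _.
Next Obligation. by move=> i x [_ Hx]; rewrite addr0. Qed.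
Next Obligation. by []. Qed.
Next Obligation. by []. Qed.

End Cone.

(* The triangles isomorphic in the homotopy category to the image of
   M -> N -> cone f -> M[1] for some morphism f : M -> N of dg modules. *)
Definition DIIc_dist : triangle_class DIIc_shift := fun X Y Z u v w =>
  exists (M N : dgModCat) (f : dghom M N)
    (a : hom X (gammaII M)) (b : hom Y (gammaII N))
    (c : hom Z (gammaII (cone f))),
    [/\ is_iso a, is_iso b & is_iso c] /\
    [/\ b \c u =~ fmap gammaII f \c a,
        c \c v =~ fmap gammaII (cone_inj f) \c b &
        fmap DIIc_shift a \c w =~ fmap gammaII (cone_proj f) \c c].

Definition is_fg_twisted_retract (M : dgMod) :=
  exists N T : dgMod, [/\ is_fg_twisted T, is_homotopy_retract N T &
    homotopy_equivalent M N].

End DgModules.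

(* Main.v *)
Require Import Defs.
From HB Require Import structures.
From mathcomp Require Import all_boot all_order all_algebra.
From mathcomp Require Import boolp ring.
(* Again, so that [hom] is the one of Defs and not that of mathcomp's vector. *)
Import Defs.

(** The derived category of the second kind is computed inside the homotopy
category K of dg modules.  Call E acyclic if every morphism from a finitely
generated twisted module to E is null homotopic, and Q K-projective if every
morphism from Q to an acyclic module is.  Starting with a module X, coning off
all morphisms from finitely generated twisted modules infinitely often gives a
map from X to an acyclic mapping telescope whose shifted cone is a K-projective
resolution of X.  Hence morphisms out of a K-projective module are the same in K
and in the localization, which yields the additive structure, the exactness of
cone triangles, the five lemma and the axioms of a triangulated category.

A finitely generated twisted module T is compact because its image in a direct
sum lies in a finite subsum; if all morphisms from such T to X vanish in the
localization, then X is acyclic, that is, zero.  Conversely, if X is compact,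
then X -> X_n, the n-th stage of the tower above, is zero for some n, as the
telescope vanishes. A factorization of X -> X_(n+1) through some T descends to
one of X -> X_n, since by compactness only finitely many of the cells attached
to X_n matter; at n = 0 it exhibits X as a retract of a finitely generated
twisted module. *)

Set Implicit Arguments.
Unset Strict Implicit.
Unset Printing Implicit Defensive.
#[local] Obligation Tactic := idtac.

Import GRing.Theory.
Local Open Scope ring_scope.

(** * Degree n maps and null homotopies *)

(** Two facts make the tower work. A map from a finitely generated twisted T to a direct sum has
    finite support, so the map moving each stage into the next one kills it up to homotopy; the
    identity minus that map is then bijective on homotopy classes of maps from T, and its cone, the
    telescope, is acyclic. Moreover, a null homotopy over one stage extends to the next, because the
    obstruction is a map from a K-projective module to an acyclic one. The localization is presented
    by words in strict maps and formal inverses, so an equality of morphisms cannot be read off the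
    words. Instead, words act by recursion on the maps out of a K-projective Q, a formal inverse
    acting by lifting along the weak equivalence; evaluation at the identity of Q recovers the
    homotopy class of a strict map. In the other direction, homotopic maps become equal in the
    localization because they factor through a cylinder whose projection is a weak equivalence. *)

Section DgMaps.
Variables (k : fieldType) (A : dgAlg k).

(* Bare functions with a predicate instead of [ghom], so that one function can be
   read as a map between various shifts of its source and target. *)
Record gmap (M N : grMod A) (n : int) (f : M -> N) : Prop := Gmap {
  gm_lin : linear f;
  gm_deg : forall i m, gm_gr M i m -> gm_gr N (i + n) (f m);
  gm_act : forall m a, f (ract m a) = ract (f m) a
}.

Definition lin_pack (U V : lmodType k) (f : U -> V) (Hf : linear f) :
    {linear U -> V} :=
  HB.pack f (GRing.isLinear.Build k U V *:%R f Hf).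

Section Gmap.
Variables (M N : grMod A) (n : int) (f : M -> N).
Hypothesis Hf : gmap n f.

Lemma gmD x y : f (x + y) = f x + f y.
Proof. exact: (linearD (lin_pack (gm_lin Hf))). Qed.
Lemma gmB x y : f (x - y) = f x - f y.
Proof. exact: (linearB (lin_pack (gm_lin Hf))). Qed.
Lemma gmN x : f (- x) = - f x.
Proof. exact: (linearN (lin_pack (gm_lin Hf))). Qed.
Lemma gmZ c x : f (c *: x) = c *: f x.
Proof. exact: (linearZZ (lin_pack (gm_lin Hf))). Qed.
Lemma gm0 : f 0 = 0.
Proof. exact: (linear0 (lin_pack (gm_lin Hf))). Qed.
End Gmap.

Lemma hgsD (V : lmodType k) (G : grading V) i x y : G i x -> G i y -> G i (x + y).
Proof. by move=> /(hgsP 1) H /H; rewrite scale1r. Qed.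
Lemma hgsZ (V : lmodType k) (G : grading V) i c x : G i x -> G i (c *: x).
Proof. by move=> Hx; have := hgsP c Hx (hgs0 G i); rewrite addr0. Qed.
Lemma hgsN (V : lmodType k) (G : grading V) i x : G i x -> G i (- x).
Proof. by rewrite -scaleN1r; exact: hgsZ. Qed.

Section GmapClosed.
Variables (M N : grMod A).

Lemma gmap_ext n (f g : M -> N) : f =1 g -> gmap n f -> gmap n g.
Proof. by move=> /funext ->. Qed.

Lemma gmap_deg n n' (f : M -> N) : n = n' -> gmap n f -> gmap n' f.
Proof. by move=> ->. Qed.

Lemma gmap_gh n (f : ghom M N n) : gmap n f.
Proof.
by split; [exact: linearP | exact: gh_gr | exact: gh_act].
Qed.

Lemma gmap_cst0 n : gmap n (fun _ : M => 0 : N).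
Proof.
split=> [c u v|i m _|m a]; first by rewrite scaler0 addr0.
  exact: hgs0.
by rewrite ract0l.
Qed.

Lemma gmapD n (f g : M -> N) : gmap n f -> gmap n g -> gmap n (fun m => f m + g m).
Proof.
move=> Hf Hg; split=> [c u v|i m Hm|m a].
- by rewrite (gm_lin Hf) (gm_lin Hg) scalerDr addrACA.
- by apply: hgsD; [exact: (gm_deg Hf) | exact: (gm_deg Hg)].
- by rewrite (gm_act Hf) (gm_act Hg) ractDl.
Qed.

Lemma gmapZ n (c : k) (f : M -> N) : gmap n f -> gmap n (fun m => c *: f m).
Proof.
move=> Hf; split=> [d u v|i m Hm|m a].
- by rewrite (gm_lin Hf) scalerDr !scalerA mulrC.
- by apply: hgsZ; exact: (gm_deg Hf).
- by rewrite (gm_act Hf) ractZl.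
Qed.

Lemma gmapN n (f : M -> N) : gmap n f -> gmap n (fun m => - f m).
Proof. by move=> /(gmapZ (-1)); apply: gmap_ext => m; rewrite scaleN1r. Qed.

Lemma gmapB n (f g : M -> N) : gmap n f -> gmap n g -> gmap n (fun m => f m - g m).
Proof. by move=> Hf /gmapN; exact: gmapD. Qed.

Lemma gmap_id : gmap 0 (fun m : M => m).
Proof. by split=> // i m; rewrite addr0. Qed.

End GmapClosed.

Lemma gmap_comp (M N P : grMod A) n n' (g : N -> P) (f : M -> N) :
  gmap n g -> gmap n' f -> gmap (n' + n) (fun m => g (f m)).
Proof.
move=> Hg Hf; split=> [c u v|i m Hm|m a].
- by rewrite (gm_lin Hf) (gm_lin Hg).
- by rewrite addrA; apply: (gm_deg Hg); exact: (gm_deg Hf).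
- by rewrite (gm_act Hf) (gm_act Hg).
Qed.

Definition mkgh (M N : grMod A) n (f : M -> N) (Hf : gmap n f) : ghom M N n :=
  @GHom _ _ M N n (lin_pack (gm_lin Hf)) (gm_deg Hf) (gm_act Hf).

Definition mkdg (M N : dgMod A) (f : M -> N) (Hf : gmap 0 f)
    (Hd : forall m, dgm_d N (f m) = f (dgm_d M m)) : dghom M N :=
  @DgHom _ _ M N (mkgh Hf) Hd.

Lemma gmap_dg (M N : dgMod A) (f : dghom M N) : gmap 0 f.
Proof. exact: gmap_gh. Qed.

Lemma dg_chain (M N : dgMod A) (f : dghom M N) m :
  dgm_d N (f m) = f (dgm_d M m).
Proof. exact: dgh_d. Qed.

(** The plus sign is the one of [hom_d] in degree -1. [f] is a bare function, so that it can be read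
    between different shifts. *)
Definition nullh (M N : dgMod A) (f : M -> N) :=
  exists h : M -> N, gmap (-1) h /\
    forall m, f m = dgm_d N (h m) + h (dgm_d M m).

Section Null.
Variables M N : dgMod A.

Lemma nullh_ext (f g : M -> N) : f =1 g -> nullh f -> nullh g.
Proof. by move=> /funext ->. Qed.

Lemma nullh0 : nullh (fun _ : M => 0 : N).
Proof.
exists (fun=> 0); split; first exact: gmap_cst0.
by move=> m; rewrite linear0 addr0.
Qed.

Lemma nullhD (f g : M -> N) : nullh f -> nullh g -> nullh (fun m => f m + g m).
Proof.
move=> [h [Hh Eh]] [l [Hl El]]; exists (fun m => h m + l m).
split; first exact: gmapD.
by move=> m; rewrite Eh El linearD /= addrACA.
Qed.

Lemma nullhZ c (f : M -> N) : nullh f -> nullh (fun m => c *: f m).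
Proof.
move=> [h [Hh Eh]]; exists (fun m => c *: h m); split; first exact: gmapZ.
by move=> m; rewrite Eh linearZ /= scalerDr.
Qed.

Lemma nullhN (f : M -> N) : nullh f -> nullh (fun m => - f m).
Proof. by move=> /(nullhZ (-1)); apply: nullh_ext => m; rewrite scaleN1r. Qed.

Lemma nullhB (f g : M -> N) : nullh f -> nullh g -> nullh (fun m => f m - g m).
Proof. by move=> Hf /nullhN; exact: nullhD. Qed.

Lemma nullh_sym (f g : M -> N) :
  nullh (fun m => f m - g m) -> nullh (fun m => g m - f m).
Proof. by move=> /nullhN; apply: nullh_ext => m; rewrite opprB. Qed.

Lemma nullh_trans (f g h : M -> N) :
  nullh (fun m => f m - g m) -> nullh (fun m => g m - h m) ->
  nullh (fun m => f m - h m).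
Proof. by move=> H /(nullhD H); apply: nullh_ext => m; rewrite subrKA. Qed.

Lemma coboundary0P (f : M -> N) : is_coboundary 0 f <-> nullh f.
Proof.
split=> [[h Hh]|[h [Hh Eh]]].
  exists h; split; first by apply: gmap_deg (gmap_gh h).
  by move=> m; rewrite Hh /hom_d /sgn /= expr1 scaleN1r opprK.
exists (mkgh Hh) => m.
by rewrite Eh /hom_d /sgn /= expr1 scaleN1r opprK.
Qed.

Lemma homotopicP (f g : dghom M N) :
  homotopic f g <-> nullh (fun m => f m - g m).
Proof. exact: coboundary0P. Qed.

End Null.

Lemma nullh_compl (M N P : dgMod A) (g : dghom N P) (f : M -> N) :
  nullh f -> nullh (fun m => g (f m)).
Proof.
move=> [h [Hh Eh]]; exists (fun m => g (h m)); split.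
  by apply: gmap_deg (gmap_comp (gmap_dg g) Hh); rewrite addr0.
by move=> m; rewrite Eh linearD dg_chain.
Qed.

Lemma nullh_compr (M N P : dgMod A) (g : N -> P) (f : dghom M N) :
  nullh g -> nullh (fun m => g (f m)).
Proof.
move=> [h [Hh Eh]]; exists (fun m => h (f m)); split.
  by apply: gmap_deg (gmap_comp Hh (gmap_dg f)); rewrite add0r.
by move=> m; rewrite Eh dg_chain.
Qed.

Definition dg0 (M N : dgMod A) : dghom M N.
Proof.
by apply: (@mkdg M N (fun=> 0)); [exact: gmap_cst0 | move=> m; rewrite linear0].
Defined.

Definition dgD (M N : dgMod A) (f g : dghom M N) : dghom M N.
Proof.
apply: (@mkdg M N (fun m => f m + g m)).
  by apply: gmapD; exact: gmap_dg.
by move=> m; rewrite linearD /= !dg_chain.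
Defined.

Definition dgN (M N : dgMod A) (f : dghom M N) : dghom M N.
Proof.
apply: (@mkdg M N (fun m => - f m)).
  by apply: gmapN; exact: gmap_dg.
by move=> m; rewrite linearN /= !dg_chain.
Defined.

End DgMaps.

Lemma sgnD (k : fieldType) (m n : int) : sgn (m + n) = sgn m * sgn n :> k.
Proof.
elim: n => [|n IH|n IH].
- by rewrite addr0 mulr1.
- by rewrite -addn1 PoszD addrA !sgnS IH mulrN.
- apply: oppr_inj; rewrite -mulrN -!sgnS -addn1 PoszD opprD.
  by rewrite addrA !subrK IH.
Qed.

Lemma sgn_sqr (k : fieldType) (n : int) : sgn n * sgn n = 1 :> k.
Proof. by rewrite /sgn -exprD addnn -mul2n exprM sqrrN !expr1n. Qed.

Lemma sgnN (k : fieldType) (n : int) : sgn (- n) = sgn n :> k.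
Proof. by rewrite /sgn abszN. Qed.

(** * Shifts by an arbitrary integer, and degree n cocycles as chain maps *)

Section Regrading.
Variables (k : fieldType) (A : dgAlg k).

Section Shiftz.
Variables (n : int) (M : dgMod A).

Definition shiftz_grading : grading M.
Proof.
apply: (@Grading k M (fun i => gm_gr M (i + n))).
- by move=> i; exact: hgs0.
- by move=> i c u w; exact: hgsP.
- move=> m; have [l [e [c [Hc ->]]]] := hgs_span (gm_gr M) m.
  by exists l, (fun j => e j - n), c; split=> // j; rewrite subrK.
- move=> l e c inj_e Hc.
  apply: (@hgs_free _ _ (gm_gr M) l (fun j => e j + n)) => //.
  by move=> i j /addIr /inj_e.
Defined.

Program Definition shiftz_gr : grMod A :=
  @GrMod k A M shiftz_grading (@ract k A M) (@ract_linl k A M)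
    (@ract_linr k A M) (@ract1 k A M) (@ractM k A M) _.
Next Obligation.
move=> i j m a Hm Ha.
have := @ract_gr k A M (i + n) j m a Hm Ha; rewrite (addrAC i n j) => H.
exact: H.
Qed.

Definition shiftz_d : {linear shiftz_gr -> shiftz_gr} :=
  sgn n \*: (dgm_d M : {linear M -> M}).

(* M[n]^i = M^(i+n), with differential (-1)^n d. *)
Program Definition shiftz : dgMod A := @DgMod k A shiftz_gr shiftz_d _ _ _.
Next Obligation.
move=> i m Hm; have := hgsZ (sgn n) (dgm_d_gr Hm).
by rewrite addrAC.
Qed.
Next Obligation. by move=> m; rewrite /= linearZ /= dgm_dd !scaler0. Qed.
Next Obligation.
move=> i m a; rewrite /= => /dgm_dM ->.
by rewrite scalerDr scalerA sgnD mulrC -mulrA sgn_sqr mulr1 ractZl.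
Qed.

Lemma shiftz_dE (m : M) : dgm_d shiftz m = sgn n *: dgm_d M m.
Proof. by []. Qed.
End Shiftz.

(** All shifts of a module share its carrier, so one function stands on both sides and only the
    degrees are recomputed. *)
Lemma gmap_shiftz a b n n' (M N : dgMod A) (f : M -> N) : n' = n + b - a ->
  gmap (M := M) (N := N) n' f <-> gmap (M := shiftz a M) (N := shiftz b N) n f.
Proof.
move=> ->; split=> -[Hl Hd Ha]; split=> // i m /= Hm.
  by have := Hd _ _ Hm; congr hgs; ring.
have Hm' : gm_gr (shiftz a M) (i - a) m by rewrite /= subrK.
by have := Hd _ _ Hm'; rewrite /=; congr hgs; ring.
Qed.

Definition cocyc (M N : dgMod A) n (f : M -> N) :=
  gmap (M := M) (N := N) n f /\ forall m, dgm_d N (f m) = sgn n *: f (dgm_d M m).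

Definition cobd (M N : dgMod A) n (f : M -> N) :=
  exists h : M -> N, gmap (M := M) (N := N) (n - 1) h /\
    forall m, f m = dgm_d N (h m) + sgn n *: h (dgm_d M m).

Definition chain (M N : dgMod A) (f : M -> N) :=
  gmap (M := M) (N := N) 0 f /\ forall m, dgm_d N (f m) = f (dgm_d M m).

Definition dg_of (M N : dgMod A) (f : M -> N) (Hf : chain f) : dghom M N :=
  mkdg Hf.1 Hf.2.

Lemma chain_dg (M N : dgMod A) (f : dghom M N) : chain f.
Proof. by split; [exact: gmap_dg | exact: dg_chain]. Qed.

Lemma chain_shiftz a b n (M N : dgMod A) (f : M -> N) : n = b - a ->
  chain (M := shiftz a M) (N := shiftz b N) f <-> cocyc (M := M) (N := N) n f.
Proof.
move=> En; have Es : sgn n = sgn a * sgn b :> k by rewrite En sgnD sgnN mulrC.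
have Eg : n = 0 + b - a by rewrite add0r.
split=> -[Hg Hd].
  have Hf := (gmap_shiftz f Eg).2 Hg; split=> // m.
  have := Hd m; rewrite !shiftz_dE (gmZ Hf) => /(congr1 ( *:%R (sgn b))).
  by rewrite !scalerA sgn_sqr scale1r Es mulrC.
split; first exact/(gmap_shiftz f Eg).1.
move=> m; rewrite !shiftz_dE (gmZ Hg) Hd Es scalerA.
by rewrite mulrCA sgn_sqr mulr1.
Qed.

Lemma nullh_shiftz a b n (M N : dgMod A) (f : M -> N) : n = b - a ->
  nullh (M := shiftz a M) (N := shiftz b N) f <-> cobd (M := M) (N := N) n f.
Proof.
move=> En; have Es : sgn n = sgn a * sgn b :> k by rewrite En sgnD sgnN mulrC.
have Eg : n - 1 = - 1 + b - a by rewrite En; ring.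
split=> -[h [Hg Hd]].
  have Hh := (@gmap_shiftz _ _ _ _ M N h Eg).2 Hg.
  (* The factor absorbs the sign of the differential of the shifted target; it is its own inverse,
     hence the same witness in the converse. *)
  exists (fun m => sgn b *: h m); split=> [|m]; first exact: gmapZ.
  rewrite Hd !shiftz_dE (gmZ Hh) linearZ /= scalerA Es.
  by rewrite -mulrA sgn_sqr mulr1.
exists (fun m => sgn b *: h m); split=> [|m].
  by apply/(gmap_shiftz _ Eg).1; exact: gmapZ.
rewrite Hd !shiftz_dE (gmZ Hg) [in RHS]linearZ /= !scalerA sgn_sqr scale1r.
by rewrite Es mulrC.
Qed.

(** [shift M] and [shiftz 1 M] have the same carrier and degrees, but their differentials are equal
    only by a computation of signs; properties of maps are therefore transferred by equivalences,
    here and for [shiftz 0 M] against [M]. *)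
Lemma gmap_shiftL n (M N : dgMod A) (f : M -> N) :
  gmap (M := shift M) (N := N) n f <-> gmap (M := shiftz 1 M) (N := N) n f.
Proof. by split=> -[? ? ?]; split. Qed.

Lemma gmap_shiftR n (M N : dgMod A) (f : M -> N) :
  gmap (M := M) (N := shift N) n f <-> gmap (M := M) (N := shiftz 1 N) n f.
Proof. by split=> -[? ? ?]; split. Qed.

Lemma shift_dE (M : dgMod A) (m : M) : dgm_d (shift M) m = dgm_d (shiftz 1 M) m.
Proof. by rewrite shiftz_dE /sgn /= expr1 scaleN1r. Qed.

Lemma chain_shiftL (M N : dgMod A) (f : M -> N) :
  chain (M := shift M) (N := N) f <-> chain (M := shiftz 1 M) (N := N) f.
Proof.
by split=> -[/gmap_shiftL Hg Hd]; split=> // m; rewrite Hd shift_dE.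
Qed.

Lemma chain_shiftR (M N : dgMod A) (f : M -> N) :
  chain (M := M) (N := shift N) f <-> chain (M := M) (N := shiftz 1 N) f.
Proof.
split=> -[/gmap_shiftR Hg Hd]; split=> // m; rewrite -Hd; [symmetry|];
  exact: (@shift_dE N (f m)).
Qed.

Lemma nullh_shiftL (M N : dgMod A) (f : M -> N) :
  nullh (M := shift M) (N := N) f <-> nullh (M := shiftz 1 M) (N := N) f.
Proof.
by split=> -[h [/gmap_shiftL Hg Hd]]; exists h; split=> // m; rewrite Hd shift_dE.
Qed.

Lemma nullh_shiftR (M N : dgMod A) (f : M -> N) :
  nullh (M := M) (N := shift N) f <-> nullh (M := M) (N := shiftz 1 N) f.
Proof.
split=> -[h [/gmap_shiftR Hg Hd]]; exists h; split=> // m; rewrite Hd;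
  congr (_ + _); [|symmetry]; exact: (@shift_dE N (h m)).
Qed.

Lemma shiftz0_dE (M : dgMod A) (m : M) : dgm_d (shiftz 0 M) m = dgm_d M m.
Proof. by rewrite shiftz_dE /sgn /= expr0 scale1r. Qed.

Lemma gmap_shiftz0L n (M N : dgMod A) (f : M -> N) :
  gmap (M := shiftz 0 M) (N := N) n f <-> gmap (M := M) (N := N) n f.
Proof.
by split=> -[? Hd ?]; split=> // i m Hm; apply: Hd; move: Hm; rewrite /= addr0.
Qed.

Lemma gmap_shiftz0R n (M N : dgMod A) (f : M -> N) :
  gmap (M := M) (N := shiftz 0 N) n f <-> gmap (M := M) (N := N) n f.
Proof.
by split=> -[? Hd ?]; split=> // i m /Hd; rewrite /= addr0.
Qed.

Lemma chain_shiftz0L (M N : dgMod A) (f : M -> N) :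
  chain (M := shiftz 0 M) (N := N) f <-> chain (M := M) (N := N) f.
Proof.
by split=> -[/gmap_shiftz0L Hg Hd]; split=> // m; rewrite Hd shiftz0_dE.
Qed.

Lemma chain_shiftz0R (M N : dgMod A) (f : M -> N) :
  chain (M := M) (N := shiftz 0 N) f <-> chain (M := M) (N := N) f.
Proof.
split=> -[/gmap_shiftz0R Hg Hd]; split=> // m; rewrite -Hd; [symmetry|];
  exact: (@shiftz0_dE N (f m)).
Qed.

Lemma nullh_shiftz0L (M N : dgMod A) (f : M -> N) :
  nullh (M := shiftz 0 M) (N := N) f <-> nullh (M := M) (N := N) f.
Proof.
by split=> -[h [/gmap_shiftz0L Hg Hd]]; exists h; split=> // m; rewrite Hd shiftz0_dE.
Qed.

Lemma nullh_shiftz0R (M N : dgMod A) (f : M -> N) :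
  nullh (M := M) (N := shiftz 0 N) f <-> nullh (M := M) (N := N) f.
Proof.
split=> -[h [/gmap_shiftz0R Hg Hd]]; exists h; split=> // m; rewrite Hd;
  congr (_ + _); [|symmetry]; exact: (@shiftz0_dE N (h m)).
Qed.

Lemma chain_shiftzL a (M N : dgMod A) (f : M -> N) :
  chain (M := shiftz a M) (N := N) f <-> cocyc (M := M) (N := N) (- a) f.
Proof.
have E := @chain_shiftz a 0 (- a) M N f (esym (sub0r a)).
by split=> [/chain_shiftz0R /E.1|/E.2 /chain_shiftz0R].
Qed.

Lemma chain_shiftzR a (M N : dgMod A) (f : M -> N) :
  chain (M := M) (N := shiftz a N) f <-> cocyc (M := M) (N := N) a f.
Proof.
have E := @chain_shiftz 0 a a M N f (esym (subr0 a)).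
by split=> [/chain_shiftz0L /E.1|/E.2 /chain_shiftz0L].
Qed.

Lemma nullh_shiftzL a (M N : dgMod A) (f : M -> N) :
  nullh (M := shiftz a M) (N := N) f <-> cobd (M := M) (N := N) (- a) f.
Proof.
have E := @nullh_shiftz a 0 (- a) M N f (esym (sub0r a)).
by split=> [/nullh_shiftz0R /E.1|/E.2 /nullh_shiftz0R].
Qed.

Lemma nullh_shiftzR a (M N : dgMod A) (f : M -> N) :
  nullh (M := M) (N := shiftz a N) f <-> cobd (M := M) (N := N) a f.
Proof.
have E := @nullh_shiftz 0 a a M N f (esym (subr0 a)).
by split=> [/nullh_shiftz0L /E.1|/E.2 /nullh_shiftz0L].
Qed.

(** Both sides describe the cocycles of degree 0, since 1 - 1 = 0 - 0. *)
Lemma chain_shift2 (M N : dgMod A) (f : M -> N) :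
  chain (M := shift M) (N := shift N) f <-> chain (M := M) (N := N) f.
Proof.
have E := @chain_shiftz 1 1 0 M N f (esym (subrr 1)).
have E' := @chain_shiftz 0 0 0 M N f (esym (subrr 0)).
split.
  move=> /chain_shiftL /chain_shiftR /E.1 /E'.2.
  by move=> /chain_shiftz0L /chain_shiftz0R.
move=> H; apply/chain_shiftL/chain_shiftR/E.2/E'.1.
by apply/chain_shiftz0L/chain_shiftz0R.
Qed.

Lemma nullh_shift2 (M N : dgMod A) (f : M -> N) :
  nullh (M := shift M) (N := shift N) f <-> nullh (M := M) (N := N) f.
Proof.
have E := @nullh_shiftz 1 1 0 M N f (esym (subrr 1)).
have E' := @nullh_shiftz 0 0 0 M N f (esym (subrr 0)).
split.
  move=> /nullh_shiftL /nullh_shiftR /E.1 /E'.2.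
  by move=> /nullh_shiftz0L /nullh_shiftz0R.
move=> H; apply/nullh_shiftL/nullh_shiftR/E.2/E'.1.
by apply/nullh_shiftz0L/nullh_shiftz0R.
Qed.

Lemma cocycleP (M N : dgMod A) n (z : ghom M N n) :
  is_cocycle z <-> cocyc (M := M) (N := N) n z.
Proof.
split=> [Hz|[_ Hz] m]; last by rewrite /hom_d Hz subrr.
split=> [|m]; first exact: gmap_gh.
by apply/eqP; rewrite -subr_eq0; apply/eqP; exact: Hz.
Qed.

Lemma coboundaryP (M N : dgMod A) n (f : M -> N) :
  is_coboundary (M := M) (N := N) n f <-> cobd (M := M) (N := N) n f.
Proof.
have E : - sgn (n - 1) = sgn n :> k by rewrite -sgnS subrK.
split=> [[h Hh]|[h [Hg Hh]]].
  exists h; split=> [|m]; first exact: gmap_gh.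
  by rewrite Hh /hom_d -scaleNr E.
by exists (mkgh Hg) => m; rewrite Hh /hom_d -scaleNr E.
Qed.

End Regrading.

(** * Cones *)

Section Cones.
Variables (k : fieldType) (A : dgAlg k).

Section ConeMaps.
Variables (M N : dgMod A) (f : dghom M N).

Lemma cone_dE (x : cone f) :
  dgm_d (cone f) x = (dgm_d N x.1 + f x.2, - dgm_d M x.2).
Proof. by []. Qed.

Lemma gmap_fst (Q : dgMod A) n (h : Q -> cone f) :
  gmap (M := Q) (N := cone f) n h -> gmap (M := Q) (N := N) n (fun q => (h q).1).
Proof.
move=> [Hl Hd Ha]; split=> [c u v|i m Hm|m a].
- by rewrite Hl.
- by have [] := Hd _ _ Hm.
- by rewrite Ha.
Qed.

Lemma gmap_snd (Q : dgMod A) n (h : Q -> cone f) :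
  gmap (M := Q) (N := cone f) n h ->
  gmap (M := Q) (N := M) (n + 1) (fun q => (h q).2).
Proof.
move=> [Hl Hd Ha]; split=> [c u v|i m Hm|m a].
- by rewrite Hl.
- by have [] := Hd _ _ Hm; rewrite addrA.
- by rewrite Ha.
Qed.

Lemma gmap_pair (Q : dgMod A) n n' (a : Q -> N) (b : Q -> M) : n' = n + 1 ->
  gmap (M := Q) (N := N) n a -> gmap (M := Q) (N := M) n' b ->
  gmap (M := Q) (N := cone f) n (fun q => (a q, b q)).
Proof.
move=> -> [Hl Hd Ha] [Hl' Hd' Ha']; split=> [c u v|i m Hm|m c].
- by rewrite Hl Hl'.
- by split; [exact: Hd | rewrite /= -addrA; exact: Hd'].
- by rewrite Ha Ha'.
Qed.

Lemma gmap_in2 (E : dgMod A) n (H : cone f -> E) :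
  gmap (M := cone f) (N := E) n H ->
  gmap (M := M) (N := E) (n - 1) (fun x => H (0, x)).
Proof.
move=> [Hl Hd Ha]; split=> [c u v|i m Hm|m a].
- by rewrite -Hl; congr H; congr (_, _); rewrite /= scaler0 addr0.
- have -> : i + (n - 1) = (i - 1) + n by ring.
  by apply: Hd; split; [exact: hgs0 | rewrite /= subrK].
- by rewrite -Ha; congr H; congr (_, _); rewrite /= ract0l.
Qed.

Lemma gmap_copair (E : dgMod A) n n' (a : N -> E) (b : M -> E) : n' = n - 1 ->
  gmap (M := N) (N := E) n a -> gmap (M := M) (N := E) n' b ->
  gmap (M := cone f) (N := E) n (fun p => a p.1 + b p.2).
Proof.
move=> -> [Hl Hd Ha] [Hl' Hd' Ha']; split=> [c u v|i m [Hm1 Hm2]|m c].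
- by rewrite Hl Hl' scalerDr addrACA.
- apply: hgsD; first exact: Hd.
  by have := Hd' _ _ Hm2; have -> : i + 1 + (n - 1) = i + n by ring.
- by rewrite Ha Ha' ractDl.
Qed.

Lemma cone_split (E : dgMod A) n (H : cone f -> E) (p : cone f) :
  gmap (M := cone f) (N := E) n H -> H p = H (p.1, 0) + H (0, p.2).
Proof.
by move=> Hg; rewrite -(gmD Hg); congr H; case: p => y x; congr (_, _);
  rewrite /= ?addr0 ?add0r.
Qed.

Lemma cone_inj_comp : nullh (M := M) (N := cone f) (fun x => cone_inj f (f x)).
Proof.
exists (fun x => (0, x)); split=> [|x].
  by apply: (@gmap_pair _ (-1) 0 (fun=> 0) id) => //;
    [exact: gmap_cst0 | exact: gmap_id].
by rewrite cone_dE /=; congr (_, _); rewrite /= ?linear0 ?add0r ?addr0 ?addNr.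
Qed.

Lemma cone_proj_comp :
  nullh (M := cone f) (N := shift N) (fun p => shift_map f (cone_proj f p)).
Proof.
exists (fun p => p.1); split=> [|p].
  by split=> // i m [Hm _]; rewrite /= addrNK.
by rewrite /= /shift_d addKr.
Qed.

Variable Q : dgMod A.

(** A null homotopy into the cone has two components: the second is the chain map [g], the first a
    homotopy between [h] and [f g]. *)
Lemma cone_exact1 (h : dghom Q N) :
  nullh (M := Q) (N := cone f) (fun q => cone_inj f (h q)) ->
  exists g : dghom Q M, nullh (M := Q) (N := N) (fun q => f (g q) - h q).
Proof.
move=> [H [Hg EH]]; pose g0 q := (H q).2.
have Hg0 : chain (M := Q) (N := M) g0.
  split; first exact: (gmap_snd Hg).
  move=> q; have := congr1 snd (EH q); rewrite cone_dE /= => /esym/eqP.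
  by rewrite addrC subr_eq0 => /eqP <-.
exists (dg_of Hg0); apply: nullh_sym; exists (fun q => (H q).1); split.
  exact: gmap_fst Hg.
move=> q; have := congr1 fst (EH q); rewrite cone_dE /= => ->.
by rewrite addrAC addrK.
Qed.

(** If [e] contracts the second component of [h], then pushing that component away along [e] changes
    the first one by [f e], and what is left is a chain map to [N]. *)
Lemma cone_exact2 (h : dghom Q (cone f)) :
  nullh (M := Q) (N := shift M) (fun q => cone_proj f (h q)) ->
  exists g : dghom Q N,
    nullh (M := Q) (N := cone f) (fun q => cone_inj f (g q) - h q).
Proof.
move=> [e [Hge Ee]].
have He : gmap (M := Q) (N := M) 0 e.
  by case: Hge => Hl Hd Ha; split=> // i m /Hd; rewrite /= subrK addr0.
have E2 q : (h q).2 = - dgm_d M (e q) + e (dgm_d Q q) by exact: Ee.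
pose g0 q := (h q).1 - f (e q).
have Hg0 : chain (M := Q) (N := N) g0.
  split.
    apply: gmapB; first exact: gmap_fst (gmap_dg h).
    exact: (gmap_comp (gmap_dg f) He).
  move=> q; have := congr1 fst (dg_chain h q); rewrite cone_dE /= => E1.
  rewrite /g0 linearB /= -E1 E2 (gmD (gmap_dg f)) (gmN (gmap_dg f)) addrA addrK.
  by rewrite dg_chain.
exists (dg_of Hg0); apply: nullh_sym; exists (fun q => (0, e q)); split.
  by apply: (@gmap_pair _ (-1) 0 (fun=> 0) e) => //; exact: gmap_cst0.
move=> q; rewrite cone_dE /=; apply: injective_projections => /=.
  by rewrite linear0 add0r addr0 /g0 opprB addrC subrK.
by rewrite subr0 E2.
Qed.

(** A chain map to the cone is the same as a chain map to [shift M] together with a null homotopy of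
    its composite with [f]. Hence the lift is strict. *)
Lemma cone_exact3 (h : dghom Q (shift M)) :
  nullh (M := Q) (N := shift N) (fun q => shift_map f (h q)) ->
  exists g : dghom Q (cone f), forall q, cone_proj f (g q) = h q.
Proof.
move=> [e [Hge Ee]].
have He : gmap (M := Q) (N := N) 0 e.
  by case: Hge => Hl Hd Ha; split=> // i m /Hd; rewrite /= subrK addr0.
have E2 q : f (h q) = - dgm_d N (e q) + e (dgm_d Q q) by exact: Ee.
have Hh : gmap (M := Q) (N := M) 1 h.
  by case: (gmap_dg h) => Hl Hd Ha; split=> // i m /Hd; rewrite /= addr0.
have Hg : chain (M := Q) (N := cone f) (fun q => (e q, h q)).
  split; first by apply: (@gmap_pair _ 0 1 e h).
  move=> q; rewrite cone_dE; congr (_, _) => /=.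
    by rewrite E2 addrA subrr add0r.
  exact: (dg_chain h q).
by exists (dg_of Hg).
Qed.
End ConeMaps.
End Cones.

(** * Twisted modules, acyclic modules, K-projective modules *)

Section Twisted.
Variables (k : fieldType) (A : dgAlg k).

Lemma fgP (T : dgMod A) : is_fg_twisted T <->
  exists n (v : 'I_n -> int) (f : T -> freeMod A v) (g : freeMod A v -> T),
    [/\ gmap (M := T) (N := freeMod A v) 0 f,
        gmap (M := freeMod A v) (N := T) 0 g, cancel f g & cancel g f].
Proof.
split=> [[n [v [f [g [fK gK]]]]]|[n [v [f [g [Hf Hg fK gK]]]]]].
  by exists n, v, f, g; split=> //; exact: gmap_gh.
by exists n, v, (mkgh Hf), (mkgh Hg).
Qed.

Lemma fg_shiftz a (T : dgMod A) : is_fg_twisted T -> is_fg_twisted (shiftz a T).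
Proof.
move=> /fgP[n [v [f [g [Hf Hg fK gK]]]]]; apply/fgP.
exists n, (fun j => v j - a), f, g; split=> //.
  case: Hf => Hl Hd Ha; split=> // i m /Hd; rewrite !addr0 => H j.
  by have := H j; have -> : i + a - v j = i - (v j - a) by ring.
case: Hg => Hl Hd Ha; split=> // i m Hm.
have := Hd (i + a) m; rewrite /= !addr0; apply=> j.
by have := Hm j; have -> : i - (v j - a) = i + a - v j by ring.
Qed.

Lemma fg_shift (T : dgMod A) : is_fg_twisted T -> is_fg_twisted (shift T).
Proof.
move=> /(fg_shiftz 1) /fgP[n [v [f [g [[? ? ?] [? ? ?] fK gK]]]]]; apply/fgP.
by exists n, v, f, g; split.
Qed.

Definition ffun_cat n m (x : {ffun 'I_n -> A}) (y : {ffun 'I_m -> A}) :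
    {ffun 'I_(n + m) -> A} :=
  [ffun j => match split j with inl j => x j | inr j => y j end].

(** As a graded module the cone is the sum of [N] and the shift of [M]: the bases are concatenated,
    the degrees of that of [M] being lowered by one. *)
Lemma fg_cone (M N : dgMod A) (f : dghom M N) :
  is_fg_twisted M -> is_fg_twisted N -> is_fg_twisted (cone f).
Proof.
move=> /fgP[m [w [a [b [Ha Hb aK bK]]]]] /fgP[n [v [c [d [Hc Hd cK dK]]]]].
apply/fgP; pose u (j : 'I_(n + m)) :=
  match split j with inl j => v j | inr j => w j - 1 end.
pose F (p : cone f) : freeMod A u := ffun_cat (c p.1) (a p.2).
pose G (x : freeMod A u) : cone f :=
  (d [ffun j => x (lshift m j)], b [ffun j => x (rshift n j)]).
exists (n + m)%N, u, F, G; split.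
- split=> [e p q|i p [Hp1 Hp2]|p e].
  + apply/ffunP=> j; rewrite !ffunE; case: (split j) => j' /=.
      by rewrite (gm_lin Hc) !ffunE.
    by rewrite (gm_lin Ha) !ffunE.
  + move=> j; rewrite !ffunE /u addr0; case: (split j) => j'.
      by have := gm_deg Hc Hp1 j'; rewrite addr0.
    have := gm_deg Ha Hp2 j'; rewrite addr0.
    by have -> : i + 1 - w j' = i - (w j' - 1) by ring.
  + apply/ffunP=> j; rewrite !ffunE; case: (split j) => j' /=.
      by rewrite (gm_act Hc) !ffunE.
    by rewrite (gm_act Ha) !ffunE.
- split=> [e p q|i p Hp|p e].
  + rewrite /G; congr (_, _) => /=.
      by rewrite -(gm_lin Hd); congr d; apply/ffunP=> j; rewrite !ffunE.
    by rewrite -(gm_lin Hb); congr b; apply/ffunP=> j; rewrite !ffunE.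
  + rewrite addr0; split=> /=.
      have := gm_deg Hd (i := i); rewrite addr0; apply=> j.
      rewrite ffunE; have := Hp (lshift m j).
      by rewrite /u; have := unsplitK (inl j : 'I_n + 'I_m) => /= ->.
    have := gm_deg Hb (i := i + 1); rewrite addr0; apply=> j.
    rewrite ffunE; have := Hp (rshift n j).
    rewrite /u; have := unsplitK (inr j : 'I_n + 'I_m) => /= ->.
    by have -> : i + 1 - w j = i - (w j - 1) by ring.
  + rewrite /G; congr (_, _) => /=.
      by rewrite -(gm_act Hd); congr d; apply/ffunP=> j; rewrite !ffunE.
    by rewrite -(gm_act Hb); congr b; apply/ffunP=> j; rewrite !ffunE.
- case=> y x; rewrite /G /F /=; congr (_, _).
    rewrite -[RHS]cK; congr d; apply/ffunP=> j; rewrite !ffunE.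
    by have := unsplitK (inl j : 'I_n + 'I_m) => /= ->.
  rewrite -[RHS]aK; congr b; apply/ffunP=> j; rewrite !ffunE.
  by have := unsplitK (inr j : 'I_n + 'I_m) => /= ->.
- move=> x; apply/ffunP=> j; rewrite /F /G /= dK bK ffunE.
  by case: splitP => j' Ej; rewrite ffunE; congr (x _); apply: val_inj.
Qed.

Record free_d n (v : 'I_n -> int) (d : {ffun 'I_n -> A} -> {ffun 'I_n -> A}) :
    Prop := FreeD {
  fd_lin : linear d;
  fd_gr : forall i x, gm_gr (freeMod A v) i x -> gm_gr (freeMod A v) (i + 1) (d x);
  fd_dd : forall x, d (d x) = 0;
  fd_dM : forall i (x : freeMod A v) a, gm_gr (freeMod A v) i x ->
    d (ract x a) = ract (d x : freeMod A v) a + sgn i *: ract x (dga_d A a)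
}.

Definition free_dg n (v : 'I_n -> int) d (Hd : free_d v d) : dgMod A :=
  @DgMod k A (freeMod A v) (lin_pack (fd_lin Hd)) (fd_gr Hd) (fd_dd Hd) (fd_dM Hd).

Lemma fg_free_dg n (v : 'I_n -> int) d (Hd : free_d v d) :
  is_fg_twisted (free_dg Hd).
Proof.
apply/fgP; exists n, v, id, id; split=> //; exact: (@gmap_id _ _ (freeMod A v)).
Qed.

(** Generating families and index types of direct sums have to be small. Twisted modules become a
    small family after transport of the differential to the fixed carrier of [freeMod], which
    [fg_gen_iso] carries out. *)
Definition fg_index :=
  {n : nat & {v : 'I_n -> int &
    {d : {ffun 'I_n -> A} -> {ffun 'I_n -> A} | free_d v d}}}.

Definition fg_gen (i : fg_index) : dgMod A := free_dg (proj2_sig (tagged (tagged i))).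

Lemma fg_gen_fg i : is_fg_twisted (fg_gen i).
Proof. exact: fg_free_dg. Qed.

Lemma fg_gen_iso (T : dgMod A) : is_fg_twisted T ->
  exists (i : fg_index) (f : dghom T (fg_gen i)) (g : dghom (fg_gen i) T),
    cancel f g /\ cancel g f.
Proof.
move=> /fgP[n [v [f [g [Hf Hg fK gK]]]]].
pose d x := f (dgm_d T (g x)).
have fd : free_d v d.
  split=> [c x y|i x /(gm_deg Hg)|x|i x a /(gm_deg Hg)].
  - by rewrite /d (gm_lin Hg) linearP (gm_lin Hf).
  - by rewrite addr0 => /dgm_d_gr /(gm_deg Hf); rewrite addr0.
  - by rewrite /d fK dgm_dd (gm0 Hf).
  - rewrite addr0 /d (gm_act Hg) => /dgm_dM ->.
    by rewrite (gmD Hf) (gmZ Hf) !(gm_act Hf) gK.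
have Hf' : chain (M := T) (N := free_dg fd) f.
  by split=> [|m]; [exact: Hf | rewrite /= /d fK].
have Hg' : chain (M := free_dg fd) (N := T) g.
  by split=> [|m]; [exact: Hg | rewrite /= /d fK].
by exists (existT _ n (existT _ v (exist _ d fd))), (dg_of Hf'), (dg_of Hg').
Qed.

(** The module on an empty basis is zero, so the identity serves as its differential. *)
Lemma zero_free_d : free_d (fun j : 'I_0 => 0) (fun x => x).
Proof.
have E (x y : {ffun 'I_0 -> A}) : x = y by apply/ffunP=> -[].
split.
- by [].
- by move=> i x _ [].
- by move=> x; exact: E.
- by move=> i x a _; exact: E.
Qed.

Definition zero_dg : dgMod A := free_dg zero_free_d.

Lemma zero_dg_eq (x y : zero_dg) : x = y.
Proof. by apply/ffunP=> -[]. Qed.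

Definition acyc (E : dgMod A) :=
  forall T : dgMod A, is_fg_twisted T ->
    forall f, chain (M := T) (N := E) f -> nullh (M := T) (N := E) f.

Definition kproj (Q : dgMod A) :=
  forall E : dgMod A, acyc E ->
    forall f, chain (M := Q) (N := E) f -> nullh (M := Q) (N := E) f.

Lemma kproj_fg T : is_fg_twisted T -> kproj T.
Proof. by move=> HT E HE; exact: HE. Qed.

(** The shift is moved to the source, where it turns a finitely generated twisted module into
    another one. *)
Lemma acyc_shiftz a E : acyc E -> acyc (shiftz a E).
Proof.
move=> HE T HT f /chain_shiftzR Hf; apply/nullh_shiftzR.
have := HE _ (fg_shiftz (- a) HT) f.
by rewrite chain_shiftzL nullh_shiftzL opprK; apply.
Qed.

Lemma kproj_shiftz a Q : kproj Q -> kproj (shiftz a Q).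
Proof.
move=> HQ E HE f /chain_shiftzL Hf; apply/nullh_shiftzL.
have := HQ _ (acyc_shiftz (a := - a) HE) f.
by rewrite chain_shiftzR nullh_shiftzR; apply.
Qed.

Lemma acyc_shift E : acyc E -> acyc (shift E).
Proof.
move=> HE T HT f /chain_shiftR Hf; apply/nullh_shiftR.
exact: acyc_shiftz Hf.
Qed.

Lemma kproj_shift Q : kproj Q -> kproj (shift Q).
Proof.
move=> HQ E HE f /chain_shiftL Hf; apply/nullh_shiftL.
exact: kproj_shiftz Hf.
Qed.

(* The obstruction to extending a null homotopy from M to cone u is a map from
   a shift of U to E. *)
Lemma cone_extend_null (U M : dgMod A) (u : dghom U M) E : kproj U -> acyc E ->
  forall (g : dghom (cone u) E) (h : M -> E), gmap (M := M) (N := E) (-1) h ->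
  (forall y, g (y, 0) = dgm_d E (h y) + h (dgm_d M y)) ->
  exists H : cone u -> E, [/\ gmap (M := cone u) (N := E) (-1) H,
    (forall p, g p = dgm_d E (H p) + H (dgm_d (cone u) p)) &
    forall y, H (y, 0) = h y].
Proof.
move=> HU HE g h Hh Eh.
(* An extension [H] of [h] has to solve d H(0, x) - H(0, d x) = c x on the second summand. So [c] is
   a chain map to the acyclic E[-1], and minus a null homotopy of it is the solution, the sign being
   that of the differential of E[-1]. *)
pose c x := g (0, x) - h (u x).
have Hc : chain (M := U) (N := shiftz (-1) E) c.
  apply/chain_shiftzR; split.
    apply: gmapB; first exact: (gmap_in2 (gmap_dg g)).
    exact: (gmap_comp Hh (gmap_dg u)).
  move=> x; rewrite /c linearB /= (dg_chain g) cone_dE /= linear0 add0r.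
  rewrite (cone_split _ (gmap_dg g)) /= Eh [LHS]addrAC (addrC (dgm_d E _)) addrK.
  rewrite sgnN /sgn /= expr1 scaleN1r opprB dg_chain; congr (_ + _).
  have -> : (0, - dgm_d U x) = - (0, dgm_d U x) :> cone u.
    by congr (_, _); rewrite /= oppr0.
  by rewrite (gmN (gmap_dg g)).
have [l [Hl El]] := HU _ (acyc_shiftz (a := -1) HE) _ Hc.
have Hl' : gmap (M := U) (N := E) (-2) (fun x => - l x).
  apply: gmapN; case: Hl => H1 H2 H3; split=> // i m /H2.
  by rewrite /= -addrA.
exists (fun p => h p.1 + - l p.2); split.
- exact: (@gmap_copair _ _ _ _ u E (-1) (-2) h (fun x => - l x)).
- move=> [y x]; rewrite (cone_split _ (gmap_dg g)) /= Eh.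
  have -> : g (0, x) = c x + h (u x) by rewrite /c subrK.
  rewrite El shiftz_dE sgnN /sgn /= expr1 scaleN1r.
  rewrite linearB /= (gmD Hh) (gmN Hl) opprK.
  by rewrite -!addrA; congr (_ + _); rewrite addrCA; do 2!congr (_ + _); rewrite addrC.
- by move=> y; rewrite /= (gm0 Hl) subr0.
Qed.

Lemma kproj_cone (U M : dgMod A) (u : dghom U M) :
  kproj U -> kproj M -> kproj (cone u).
Proof.
move=> HU HM E HE f Hf; pose g := dg_of Hf.
have Hc : chain (M := M) (N := E) (fun y => g (cone_inj u y)).
  exact: (chain_dg (dg_comp g (cone_inj u))).
have [h [Hh Eh]] := HM _ HE _ Hc.
have [H [Hg EH _]] := cone_extend_null HU HE (g := g) Hh Eh.
by exists H.
Qed.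

Lemma nullh_cone_id (M : dgMod A) :
  nullh (M := cone (dg_id M)) (N := cone (dg_id M)) id.
Proof.
exists (fun p => (0, p.1)); split.
  apply: (@gmap_pair _ _ _ _ _ _ (-1) 0 (fun=> 0)) => //; first exact: gmap_cst0.
  exact: (@gmap_fst _ _ _ _ (dg_id M) _ 0 id (@gmap_id _ _ _)).
case=> y x; rewrite !cone_dE /=; apply: injective_projections => /=.
  by rewrite linear0 add0r addr0.
by rewrite addKr.
Qed.

Lemma kproj_contractible (C : dgMod A) : nullh (M := C) (N := C) id -> kproj C.
Proof.
move=> HC E HE f Hf.
exact: (nullh_compl (dg_of Hf) HC).
Qed.

End Twisted.

(** * Weak equivalences, their acyclic cones, and lifting from K-projective modules *)

Section WeakEquivalences.
Variables (k : fieldType) (A : dgAlg k).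

Lemma weqII_inj (M N T : dgMod A) (f : dghom M N) (z : dghom T M) :
  weqII (X := M) (Y := N) f -> is_fg_twisted T ->
  nullh (M := T) (N := N) (fun t => f (z t)) -> nullh (M := T) (N := M) z.
Proof.
move=> Wf HT Hz; have [inj_f _] := Wf T HT 0.
have cz (y : dghom T M) : is_cocycle y.
  by move=> m; rewrite /hom_d dg_chain /sgn /= expr0 scale1r subrr.
have [|h Hh] := inj_f z (dg0 T M) (cz z) (cz (dg0 T M)).
  apply/coboundary0P; apply: nullh_ext Hz => t.
  by rewrite /= (gm0 (gmap_dg f)) subr0.
apply/coboundary0P; exists h => t.
by rewrite -Hh /= subr0.
Qed.

Lemma weqII_surj (M N T : dgMod A) (f : dghom M N) (w : dghom T N) :
  weqII (X := M) (Y := N) f -> is_fg_twisted T ->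
  exists z : dghom T M, nullh (M := T) (N := N) (fun t => f (z t) - w t).
Proof.
move=> Wf HT; have [_ surj_f] := Wf T HT 0.
have [|z [/cocycleP[Hz Dz] /coboundary0P b]] := surj_f w.
  by move=> m; rewrite /hom_d dg_chain /sgn /= expr0 scale1r subrr.
have cz : chain (M := T) (N := M) z.
  by split=> // m; rewrite Dz /sgn /= expr0 scale1r.
by exists (dg_of cz).
Qed.

(** Degree n classes on T are degree 0 classes on T[-n], which is again finitely generated twisted;
    so degree 0 for all T covers all degrees. *)
Lemma weqII_of0 (M N : dgMod A) (f : dghom M N) :
  (forall T, is_fg_twisted T ->
     (forall z : dghom T M, nullh (M := T) (N := N) (fun t => f (z t)) ->
        nullh (M := T) (N := M) z) /\
     (forall w : dghom T N, exists z : dghom T M,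
        nullh (M := T) (N := N) (fun t => f (z t) - w t))) ->
  weqII (X := M) (Y := N) f.
Proof.
move=> H T HT n; have [inj_f surj_f] := H _ (fg_shiftz (- n) HT).
have cE (L : dgMod A) (z : T -> L) :
    cocyc (M := T) (N := L) n z <-> chain (M := shiftz (- n) T) (N := L) z.
  by rewrite (@chain_shiftzL _ _ (- n) T L z) opprK.
have bE (L : dgMod A) (z : T -> L) :
    cobd (M := T) (N := L) n z <-> nullh (M := shiftz (- n) T) (N := L) z.
  by rewrite (@nullh_shiftzL _ _ (- n) T L z) opprK.
split=> [z z' /cocycleP/cE Hz /cocycleP/cE Hz' /coboundaryP/bE b|w /cocycleP/cE Hw].
  apply/coboundaryP/bE.
  apply: (inj_f (dgD (dg_of Hz) (dgN (dg_of Hz')))).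
  by apply: nullh_ext b => t /=; rewrite (gmB (gmap_dg f)).
have [z Hz] := surj_f (dg_of Hw).
have /cE[Hg Hd] := chain_dg z.
exists (mkgh Hg); split; first by apply/cocycleP; split.
exact/coboundaryP/bE.
Qed.

(** A chase in the exact sequence of homotopy classes: injectivity for the shift of [f] makes [t]
    come from some [g] into [N], surjectivity for [f] lifts [g] to [M], and the composite from [M]
    to the cone is null homotopic. *)
Lemma weqII_acyc_cone (M N : dgMod A) (f : dghom M N) :
  weqII (X := M) (Y := N) f -> acyc (cone f).
Proof.
move=> Wf T HT t0 Ht; pose t := dg_of Ht.
have Wf' : weqII (X := shift M) (Y := shift N) (shift_map f).
  exact: (weqII_shift Wf).
have Hp : nullh (M := T) (N := shift M) (dg_comp (cone_proj f) t).
  apply: (weqII_inj Wf' HT).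
  exact: (nullh_compr t (cone_proj_comp f)).
have [g Hg] := cone_exact2 Hp.
have [z Hz] := weqII_surj g Wf HT.
have H1 := nullh_compl (cone_inj f) Hz.
have H2 := nullh_compr z (cone_inj_comp f).
apply: nullh_ext (nullhB (nullhB H2 H1) Hg) => q.
rewrite (gmB (gmap_dg (cone_inj f))) subKr subKr.
by [].
Qed.

(** The obstruction to lifting [g] is its image in the acyclic cone of [w]. *)
Lemma kproj_lift (Q M N : dgMod A) (w : dghom M N) (g : dghom Q N) :
  kproj Q -> weqII (X := M) (Y := N) w ->
  exists z : dghom Q M, nullh (M := Q) (N := N) (fun q => w (z q) - g q).
Proof.
move=> HQ /weqII_acyc_cone Hw.
apply: cone_exact1; apply: HQ Hw _ _.
exact: (chain_dg (dg_comp (cone_inj w) g)).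
Qed.

(** If [w z] is null homotopic, the shift of [z] factors through the acyclic cone of [w]. *)
Lemma kproj_lift_inj (Q M N : dgMod A) (w : dghom M N) (z : dghom Q M) :
  kproj Q -> weqII (X := M) (Y := N) w ->
  nullh (M := Q) (N := N) (fun q => w (z q)) -> nullh (M := Q) (N := M) z.
Proof.
move=> HQ /weqII_acyc_cone Hw Hz.
have [|g Hg] := @cone_exact3 _ _ _ _ w (shift Q) (shift_map z).
  exact/nullh_shift2.
have Hn : nullh (M := shift Q) (N := cone w) g.
  exact: (kproj_shift HQ) Hw _ (chain_dg g).
apply/nullh_shift2; apply: nullh_ext (nullh_compl (cone_proj w) Hn) => q.
exact: Hg.
Qed.

Lemma weqII_homotopy_equivalence (M N : dgMod A) (f : dghom M N) (g : dghom N M) :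
  nullh (M := M) (N := M) (fun m => g (f m) - m) ->
  nullh (M := N) (N := N) (fun m => f (g m) - m) ->
  weqII (X := M) (Y := N) f.
Proof.
move=> Hgf Hfg; apply: weqII_of0 => T HT; split=> [z Hz|w].
  have := nullhB (nullh_compl g Hz) (nullh_compr z Hgf).
  by apply: nullh_ext => t; rewrite subKr.
by exists (dg_comp g w); exact: (nullh_compr w Hfg).
Qed.

Lemma weqII_to_zero (M : dgMod A) : acyc M ->
  weqII (X := M) (Y := zero_dg A) (dg0 M (zero_dg A)).
Proof.
move=> HM; apply: weqII_of0 => T HT; split=> [z _|w].
  exact: HM HT _ (chain_dg z).
by exists (dg0 T M); apply: nullh_ext (nullh0 T (zero_dg A)) => t; exact: zero_dg_eq.
Qed.

End WeakEquivalences.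

(** * Infinite direct sums *)

Section DirectSum.
Variables (k : fieldType) (A : dgAlg k) (I : small) (M : I -> dgMod A).

(** [{classic I}] equips the arbitrary type [I] with the decidable equality that membership in a
    sequence requires. *)
Definition fin_supp (f : forall i, M i) :=
  exists s : seq {classic I}, forall i : {classic I}, i \notin s -> f i = 0.

Record dsum_car := DSum { dsum_fun :> forall i, M i; dsum_fin : fin_supp dsum_fun }.

Lemma dsum_eq (x y : dsum_car) : (forall i, x i = y i) -> x = y.
Proof.
case: x y => [f Hf] [g Hg] /= E.
have Efg : f = g by apply: functional_extensionality_dep.
by case: g / Efg Hg {E} => Hg; congr DSum; exact: Prop_irrelevance.
Qed.

HB.instance Definition _ := gen_eqMixin dsum_car.
HB.instance Definition _ := gen_choiceMixin dsum_car.

Lemma fin_supp0 : fin_supp (fun i => 0). Proof. by exists [::]. Qed.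

Lemma fin_suppP c (x y : dsum_car) : fin_supp (fun i => c *: x i + y i).
Proof.
case: (dsum_fin x) (dsum_fin y) => s Hs [t Ht]; exists (s ++ t) => i.
by rewrite mem_cat negb_or => /andP[/Hs -> /Ht ->]; rewrite scaler0 addr0.
Qed.

Definition dsum0 := DSum fin_supp0.
Definition dsumP c x y := DSum (fin_suppP c x y).
Definition dsumA x y := dsumP 1 x y.
Definition dsumN x := dsumP (-1) x dsum0.
Definition dsumZ c x := dsumP c x dsum0.

Lemma dsum_addA : associative dsumA.
Proof. by move=> x y z; apply: dsum_eq => i /=; rewrite !scale1r addrA. Qed.
Lemma dsum_addC : commutative dsumA.
Proof. by move=> x y; apply: dsum_eq => i /=; rewrite !scale1r addrC. Qed.
Lemma dsum_add0 : left_id dsum0 dsumA.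
Proof. by move=> x; apply: dsum_eq => i /=; rewrite scaler0 add0r. Qed.
Lemma dsum_addN : left_inverse dsum0 dsumN dsumA.
Proof.
by move=> x; apply: dsum_eq => i /=; rewrite scale1r addr0 scaleN1r addNr.
Qed.
HB.instance Definition _ :=
  GRing.isZmodule.Build dsum_car dsum_addA dsum_addC dsum_add0 dsum_addN.

Lemma dsumDE (x y : dsum_car) i : (x + y) i = x i + y i.
Proof. by rewrite /= scale1r. Qed.

Lemma dsum_scaleA a b x : dsumZ a (dsumZ b x) = dsumZ (a * b) x.
Proof. by apply: dsum_eq => i /=; rewrite !addr0 scalerA. Qed.
Lemma dsum_scale1 : left_id 1 dsumZ.
Proof. by move=> x; apply: dsum_eq => i /=; rewrite !addr0 scale1r. Qed.
Lemma dsum_scaleDr : right_distributive dsumZ +%R.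
Proof.
by move=> a x y; apply: dsum_eq => i; rewrite dsumDE /= !addr0 scale1r scalerDr.
Qed.
Lemma dsum_scaleDl x : {morph dsumZ^~ x : a b / a + b}.
Proof.
by move=> a b; apply: dsum_eq => i; rewrite dsumDE /= !addr0 scalerDl.
Qed.
HB.instance Definition _ := GRing.Zmodule_isLmodule.Build k dsum_car
  dsum_scaleA dsum_scale1 dsum_scaleDr dsum_scaleDl.

Lemma dsumZE c (x : dsum_car) i : (c *: x) i = c *: x i.
Proof. by rewrite /= addr0. Qed.

Definition dsum_ev i (x : dsum_car) : M i := x i.
Lemma dsum_ev_linear i : linear (dsum_ev i).
Proof. by move=> c x y; rewrite /dsum_ev dsumDE dsumZE. Qed.
HB.instance Definition _ i := GRing.isLinear.Build k dsum_car (M i) *:%R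
  (dsum_ev i) (@dsum_ev_linear i).

Lemma dsum_sumE (J : Type) (r : seq J) (F : J -> dsum_car) i :
  (\sum_(j <- r) F j) i = \sum_(j <- r) F j i.
Proof. exact: (raddf_sum (dsum_ev i)). Qed.

Definition din_fun i (m : M i) (j : I) : M j :=
  match pselect (i = j) with
  | left E => eq_rect i (fun j => M j : Type) m j E
  | right _ => 0
  end.

Lemma din_fun_same i (m : M i) : din_fun m i = m.
Proof.
rewrite /din_fun; case: pselect => [E|//].
by rewrite (Prop_irrelevance E erefl).
Qed.

Lemma din_fun_other i (m : M i) j : i <> j -> din_fun m j = 0.
Proof. by rewrite /din_fun; case: pselect. Qed.

Lemma din_fin i (m : M i) : fin_supp (din_fun m).
Proof.
exists [:: i : {classic I}] => j; rewrite inE => /eqP ne.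
by rewrite din_fun_other // => E; apply: ne.
Qed.

Definition din i (m : M i) : dsum_car := DSum (din_fin m).

Lemma din_same i (m : M i) : din m i = m. Proof. exact: din_fun_same. Qed.
Lemma din_other i (m : M i) j : i <> j -> din m j = 0.
Proof. exact: din_fun_other. Qed.

Lemma din_linear i : linear (@din i).
Proof.
move=> c x y; apply: dsum_eq => j; rewrite dsumDE dsumZE.
case: (pselect (i = j)) => [<-|ne]; first by rewrite !din_same.
by rewrite !din_other // scaler0 addr0.
Qed.
HB.instance Definition _ i := GRing.isLinear.Build k (M i) dsum_car *:%R
  (@din i) (@din_linear i).

Lemma dsum_decomp (s : seq {classic I}) (x : dsum_car) : uniq s ->
  (forall i : {classic I}, i \notin s -> x i = 0) -> x = \sum_(i <- s) din (x i).
Proof.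
move=> Us Hs; apply: dsum_eq => i; rewrite dsum_sumE.
case: (boolP ((i : {classic I}) \in s)) => [si|si].
  rewrite (bigD1_seq (i : {classic I})) //= din_fun_same big1 ?addr0 // => j ne.
  by rewrite din_fun_other // => E; case/eqP: ne.
rewrite Hs // big1_seq // => j /= js; rewrite din_fun_other // => E.
by move: si; rewrite -E js.
Qed.

Lemma dsum_supp (x : dsum_car) : exists s : seq {classic I}, uniq s /\
  forall i : {classic I}, i \notin s -> x i = 0.
Proof.
have [s Hs] := dsum_fin x; exists (undup s); split; first exact: undup_uniq.
by move=> i; rewrite mem_undup; exact: Hs.
Qed.

Lemma dsum_ind (P : dsum_car -> Prop) : P 0 ->
  (forall x y, P x -> P y -> P (x + y)) -> (forall i m, P (@din i m)) ->
  forall x, P x.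
Proof.
move=> P0 PD Pin x; have [s [Us Hs]] := dsum_supp x.
by rewrite (dsum_decomp Us Hs); apply: (big_ind P).
Qed.

Definition dsum_hgs n (x : dsum_car) := forall i, gm_gr (M i) n (x i).

Lemma dsum_hgs0 n : dsum_hgs n 0. Proof. by move=> i; exact: hgs0. Qed.
Lemma dsum_hgsP n (c : k) x y :
  dsum_hgs n x -> dsum_hgs n y -> dsum_hgs n (c *: x + y).
Proof. by move=> Hx Hy i; rewrite dsumDE dsumZE; exact: hgsP. Qed.

Lemma dsum_hgs_span x : exists (n : nat) (e : 'I_n -> int) (c : 'I_n -> dsum_car),
  (forall j, dsum_hgs (e j) (c j)) /\ x = \sum_j c j.
Proof.
elim/dsum_ind: x => [|x y [m1 [e1 [c1 [H1 ->]]]] [m2 [e2 [c2 [H2 ->]]]]|i m].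
- by exists 0%N, (fun=> 0), (fun=> 0); split=> [[]|]; rewrite ?big_ord0.
- exists (m1 + m2)%N,
    (fun j => match split j with inl j => e1 j | inr j => e2 j end),
    (fun j => match split j with inl j => c1 j | inr j => c2 j end).
  split=> [j|]; first by case: (split j).
  rewrite big_split_ord /=; congr (_ + _); apply: eq_bigr => j _.
    by have := unsplitK (inl j : 'I_m1 + 'I_m2) => /= ->.
  by have := unsplitK (inr j : 'I_m1 + 'I_m2) => /= ->.
- have [n [e [c [Hc ->]]]] := hgs_span (gm_gr (M i)) m.
  exists n, e, (fun j => din (c j)); split; last by rewrite linear_sum.
  move=> j l; case: (pselect (i = l)) => [<-|ne]; first by rewrite din_same.
  by rewrite din_other //; exact: hgs0.
Qed.

Lemma dsum_hgs_free (m : nat) (e : 'I_m -> int) (c : 'I_m -> dsum_car) :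
  injective e -> (forall j, dsum_hgs (e j) (c j)) -> \sum_j c j = 0 ->
  forall j, c j = 0.
Proof.
move=> inj_e Hc c0 j; apply: dsum_eq => i.
apply: (@hgs_free _ _ (gm_gr (M i)) m e (fun j => c j i)) => //.
  by move=> j'; exact: Hc.
by rewrite -dsum_sumE c0.
Qed.

Definition dsum_grading := Grading dsum_hgs0 dsum_hgsP dsum_hgs_span dsum_hgs_free.

Lemma dsum_act_fin (x : dsum_car) a : fin_supp (fun i => ract (x i) a).
Proof. by case: (dsum_fin x) => s Hs; exists s => i /Hs ->; rewrite ract0l. Qed.
Definition dsum_act x a := DSum (dsum_act_fin x a).

Program Definition dsum_gr : grMod A :=
  @GrMod k A dsum_car dsum_grading dsum_act _ _ _ _ _.
Next Obligation.
by move=> a c x y; apply: dsum_eq => i; rewrite dsumDE dsumZE /= scale1r !addr0 ractDl ractZl.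
Qed.
Next Obligation.
by move=> x c a b; apply: dsum_eq => i; rewrite dsumDE dsumZE /= ract_linr.
Qed.
Next Obligation. by move=> x; apply: dsum_eq => i /=; rewrite ract1. Qed.
Next Obligation. by move=> x a b; apply: dsum_eq => i /=; rewrite ractM. Qed.
Next Obligation. by move=> i j x a Hx Ha l; exact: ract_gr. Qed.

Lemma dsum_d_fin (x : dsum_car) : fin_supp (fun i => dgm_d (M i) (x i)).
Proof. by case: (dsum_fin x) => s Hs; exists s => i /Hs ->; rewrite linear0. Qed.
Definition dsum_d (x : dsum_gr) : dsum_gr := DSum (dsum_d_fin x).
Lemma dsum_d_linear : linear dsum_d.
Proof.
by move=> c x y; apply: dsum_eq => i; rewrite dsumDE dsumZE /= scale1r !addr0 linearP.
Qed.

Program Definition dsum : dgMod A :=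
  @DgMod k A dsum_gr (lin_pack dsum_d_linear) _ _ _.
Next Obligation. by move=> i x Hx j; exact: dgm_d_gr. Qed.
Next Obligation. by move=> x; apply: dsum_eq => i /=; rewrite dgm_dd. Qed.
Next Obligation.
move=> i x a Hx; apply: dsum_eq => j; rewrite dsumDE dsumZE /=.
by rewrite (dgm_dM _ (Hx j)).
Qed.

Lemma dsum_dE (x : dsum) i : dgm_d dsum x i = dgm_d (M i) (x i).
Proof. by []. Qed.

Lemma gmap_din i : gmap (M := M i) (N := dsum) 0 (@din i).
Proof.
split=> [||m a]; first exact: din_linear.
  move=> n m Hm j; rewrite addr0.
  case: (pselect (i = j)) => [<-|ne]; first by rewrite din_same.
  by rewrite din_other //; exact: hgs0.
apply: dsum_eq => j /=; case: (pselect (i = j)) => [<-|ne].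
  by rewrite !din_fun_same.
by rewrite !din_fun_other // ract0l.
Qed.

Lemma din_d i m : dgm_d dsum (@din i m) = din (dgm_d (M i) m).
Proof.
apply: dsum_eq => j; rewrite dsum_dE; case: (pselect (i = j)) => [<-|ne].
  by rewrite !din_same.
by rewrite !din_other // linear0.
Qed.

Definition dg_in i : dghom (M i) dsum := mkdg (gmap_din i) (@din_d i).

Lemma gmap_ev i : gmap (M := dsum) (N := M i) 0 (dsum_ev i).
Proof.
split=> [|n x Hx|//]; first exact: dsum_ev_linear.
by rewrite addr0; exact: Hx.
Qed.

Definition dg_pr i : dghom dsum (M i) :=
  @mkdg _ _ dsum (M i) (dsum_ev i) (gmap_ev i) (fun x => erefl).

Section Lift.
Variables (E : dgMod A) (n : int) (f : forall i, M i -> E).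
Hypothesis Hf : forall i, gmap (M := M i) (N := E) n (@f i).

(** Any two finite sets containing the support give the same sum, by comparison with their union.
    Stating this for all of them at once allows each later proof to pick a convenient one. *)
Lemma dsum_lift_ex (x : dsum) : exists y : E,
  forall s : seq {classic I}, uniq s ->
  (forall i : {classic I}, i \notin s -> x i = 0) -> y = \sum_(i <- s) f (x i).
Proof.
have [s [Us Hs]] := dsum_supp x; exists (\sum_(i <- s) f (x i)) => t Ut Ht.
have main (u v : seq {classic I}) : uniq u -> uniq v ->
    (forall i : {classic I}, i \notin u -> x i = 0) -> {subset u <= v} ->
    \sum_(i <- u) f (x i) = \sum_(i <- v) f (x i).
  move=> Uu Uv Hu uv; rewrite [RHS](bigID (fun i => i \in u)) /=.
  rewrite [X in _ = _ + X]big1 ?addr0 => [|i /Hu ->]; last exact: gm0.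
  rewrite -[RHS]big_filter; apply: perm_big.
  apply: uniq_perm => //; first exact: filter_uniq.
  by move=> i; rewrite mem_filter; case: (boolP (i \in u)) => // /uv.
have Hw : uniq (undup (s ++ t)) by exact: undup_uniq.
transitivity (\sum_(i <- undup (s ++ t)) f (x i)).
  by apply: main => // i si; rewrite mem_undup mem_cat si.
by apply/esym/main => // i ti; rewrite mem_undup mem_cat ti orbT.
Qed.

Definition dsum_lift (x : dsum) : E := sval (cid (dsum_lift_ex x)).

Lemma dsum_liftE (s : seq {classic I}) (x : dsum) : uniq s ->
  (forall i : {classic I}, i \notin s -> x i = 0) ->
  dsum_lift x = \sum_(i <- s) f (x i).
Proof. by move=> Us Hs; rewrite /dsum_lift; case: cid => y /= H; exact: H. Qed.

Lemma dsum_lift_in i m : dsum_lift (@din i m) = f m.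
Proof.
rewrite (@dsum_liftE [:: i : {classic I}]) // => [|j].
  by rewrite big_seq1 /= din_fun_same.
by rewrite inE => /eqP ne; rewrite /= din_fun_other // => E'; apply: ne.
Qed.

Lemma dsum_lift_linear : linear dsum_lift.
Proof.
move=> c x y; have [s [Us Hs]] := dsum_supp x; have [t [Ut Ht]] := dsum_supp y.
have H (s1 s2 : seq {classic I}) (z : dsum) (Hz : forall i : {classic I}, i \notin s1 -> z i = 0) :
    {subset s1 <= s2} -> forall i : {classic I}, i \notin undup s2 -> z i = 0.
  by move=> sub i; rewrite mem_undup => /negP ni; apply: Hz; apply/negP => /sub.
have sub1 : {subset s <= s ++ t} by move=> i; rewrite mem_cat => ->.
have sub2 : {subset t <= s ++ t} by move=> i; rewrite mem_cat orbC => ->.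
have Hx := H _ _ _ Hs sub1; have Hy := H _ _ _ Ht sub2.
rewrite !(@dsum_liftE (undup (s ++ t))) ?undup_uniq //; last first.
  by move=> i ni; rewrite dsumDE dsumZE Hx // Hy // scaler0 addr0.
rewrite scaler_sumr -big_split /=; apply: eq_bigr => i _.
by rewrite addr0 scale1r (gm_lin (Hf i)).
Qed.

Lemma gmap_lift : gmap (M := dsum) (N := E) n dsum_lift.
Proof.
split=> [|i x Hx|x a]; first exact: dsum_lift_linear.
  have [s [Us Hs]] := dsum_supp x; rewrite (dsum_liftE Us Hs).
  apply: (big_ind (gm_gr E (i + n))); [exact: hgs0|exact: hgsD|].
  by move=> j _; apply: (gm_deg (Hf j)); exact: Hx.
have [s [Us Hs]] := dsum_supp x; rewrite !(@dsum_liftE s) //; last first.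
  by move=> i /Hs E0; rewrite /= E0 ract0l.
rewrite (big_morph (fun y : E => ract y a) (id1 := 0) (op1 := +%R)) //.
- by apply: eq_bigr => i _; rewrite (gm_act (Hf i)).
- by move=> y z; exact: ractDl.
- exact: ract0l.
Qed.
End Lift.

Lemma dg_lift (E : dgMod A) (f : forall i, dghom (M i) E) :
  exists F : dghom dsum E, forall i m, F (@din i m) = f i m.
Proof.
have Hf i := gmap_dg (f i).
have Hl : chain (M := dsum) (N := E) (dsum_lift Hf).
  split=> [|x]; first exact: gmap_lift.
  elim/dsum_ind: x => [|x y Ex Ey|i m].
  - by rewrite !linear0 (gm0 (gmap_lift Hf)) linear0.
  - by rewrite (gmD (gmap_lift Hf)) !linearD /= (gmD (gmap_lift Hf)) Ex Ey.
  - by rewrite din_d !dsum_lift_in dg_chain.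
by exists (dg_of Hl) => i m; exact: dsum_lift_in.
Qed.

(** A homotopy is a map out of the direct sum, hence may be chosen summand by summand. *)
Lemma nullh_dsum (E : dgMod A) (F : dsum -> E) :
  gmap (M := dsum) (N := E) 0 F ->
  (forall i, nullh (M := M i) (N := E) (fun m => F (din m))) ->
  nullh (M := dsum) (N := E) F.
Proof.
move=> HF /(_ _)/cid; move=> H.
have Hh i : gmap (M := M i) (N := E) (-1) (sval (H i)) by case: (H i) => h [].
exists (dsum_lift Hh); split; first exact: gmap_lift.
elim/dsum_ind => [|x y Ex Ey|i m].
- by rewrite !linear0 (gm0 (gmap_lift Hh)) linear0 (gm0 HF) addr0.
- rewrite (gmD HF) Ex Ey !linearD !(gmD (gmap_lift Hh)) linearD /=.
  by rewrite addrACA.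
- rewrite din_d !dsum_lift_in; case: (H i) => h [/= _ Eh]; exact: Eh.
Qed.

Lemma kproj_dsum : (forall i, kproj (M i)) -> kproj dsum.
Proof.
move=> HM E HE F HF; apply: nullh_dsum => [|i]; first exact: HF.1.
apply: HM HE _ _.
exact: (chain_dg (dg_comp (dg_of HF) (dg_in i))).
Qed.

(** By A-linearity [h] is determined on the finite basis [e], and each of the values on it has
    finite support. *)
Lemma fg_finite_support (T : dgMod A) (h : dghom T dsum) : is_fg_twisted T ->
  exists s : seq {classic I}, uniq s /\
    forall t (i : {classic I}), i \notin s -> h t i = 0.
Proof.
move=> /fgP[n [v [f [g [Hf Hg fK gK]]]]].
pose e (j : 'I_n) : T := g [ffun l => if l == j then 1 else 0].
have /choice[S HS] : forall j, exists s : seq {classic I},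
    forall i : {classic I}, i \notin s -> h (e j) i = 0.
  by move=> j; have [s [_ Hs]] := dsum_supp (h (e j)); exists s.
exists (undup (flatten [seq S j | j <- enum 'I_n])); split.
  exact: undup_uniq.
move=> t i; rewrite mem_undup => ni.
have -> : t = \sum_j ract (e j) (f t j).
  rewrite -[LHS]fK.
  have E (x : freeMod A v) : x = \sum_j
      ract ([ffun l => if l == j then 1 else 0] : freeMod A v) (x j).
    apply/ffunP=> l; rewrite sum_ffunE (bigD1 l) //= !ffunE eqxx mul1r.
    rewrite big1 ?addr0 // => j ne; rewrite !ffunE eq_sym (negPf ne).
    by rewrite mul0r.
  rewrite {1}[f t]E (big_morph g (gmD Hg) (gm0 Hg)).
  by apply: eq_bigr => j _; rewrite (gm_act Hg).
rewrite linear_sum dsum_sumE big1 // => j _.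
rewrite gh_act /= HS ?ract0l //; apply: contra ni => Hi.
by apply/flattenP; exists (S j) => //; apply/mapP; exists j => //; rewrite mem_enum.
Qed.

End DirectSum.

(** * K-projective resolutions *)

Section Tower.
Variables (k : fieldType) (A : dgAlg k).

Definition all_maps (M : dgMod A) : small :=
  {i : fg_index A & dghom (fg_gen i) M}.

Definition all_source (M : dgMod A) : dgMod A :=
  dsum (fun j : all_maps M => fg_gen (tag j)).

Definition all_eval (M : dgMod A) : dghom (all_source M) M :=
  sval (cid (dg_lift (fun j : all_maps M => tagged j))).

Definition step (M : dgMod A) : dgMod A := cone (all_eval M).
Definition step_inj (M : dgMod A) : dghom M (step M) := cone_inj (all_eval M).

Lemma kproj_all_source M : kproj (all_source M).
Proof. by apply: kproj_dsum => j; apply: kproj_fg; exact: fg_gen_fg. Qed.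

(** Up to an isomorphism of [T] with some [fg_gen i], the map [g] is one of the components of
    [all_eval M], and [all_eval M] followed by [step_inj M] is null homotopic. *)
Lemma step_inj_kills (M T : dgMod A) (g : dghom T M) : is_fg_twisted T ->
  nullh (M := T) (N := step M) (fun t => step_inj M (g t)).
Proof.
move=> /fg_gen_iso[i [f0 [g0 [fK _]]]].
pose j : all_maps M := Tagged (fun i => dghom (fg_gen i) M) (dg_comp g g0).
pose w := dg_comp (dg_in (fun j : all_maps M => fg_gen (tag j)) j) f0.
apply: nullh_ext (nullh_compr w (cone_inj_comp (all_eval M))) => t.
congr (step_inj M _); rewrite /w /= /all_eval; case: cid => u Hu /=.
by rewrite Hu /= fK.
Qed.

Variable X : dgMod A.

Definition tower n : dgMod A := iter n step X.
Definition tower_inj n : dghom (tower n) (tower n.+1) := step_inj (tower n).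
Definition tower_sum : dgMod A := dsum tower.

Definition tower_shift : dghom tower_sum tower_sum :=
  sval (cid (dg_lift (fun n => dg_comp (dg_in tower n.+1) (tower_inj n)))).

Lemma tower_shift_in n m : tower_shift (din m) = din (tower_inj n m) :> tower_sum.
Proof. by rewrite /tower_shift; case: cid => u Hu /=; rewrite Hu. Qed.

Definition tower_diff : dghom tower_sum tower_sum :=
  dgD (dg_id tower_sum) (dgN tower_shift).

Lemma tower_diffE x : tower_diff x = x - tower_shift x. Proof. by []. Qed.

(** The usual model of the homotopy colimit of the tower. *)
Definition tel : dgMod A := cone tower_diff.

(** Only finitely many components of [g] are nonzero, and one step of the tower kills each of
    them. *)
Lemma tower_shift_kills (T : dgMod A) (g : dghom T tower_sum) : is_fg_twisted T ->
  nullh (M := T) (N := tower_sum) (fun t => tower_shift (g t)).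
Proof.
move=> HT; have [s [Us Hs]] := fg_finite_support g HT.
pose F n t : tower_sum := din (tower_inj n (g t n)).
have HF n : nullh (M := T) (N := tower_sum) (F n).
  apply: (nullh_compl (dg_in tower n.+1)).
  exact: (step_inj_kills (dg_comp (dg_pr tower n) g) HT).
have : nullh (M := T) (N := tower_sum) (fun t => \sum_(n <- s) F n t).
  elim: (s) => [|n r IH].
    by apply: nullh_ext (nullh0 T tower_sum) => t; rewrite big_nil.
  by apply: nullh_ext (nullhD (HF n) IH) => t; rewrite big_cons.
apply: nullh_ext => t; rewrite [in RHS](dsum_decomp Us (Hs t)) linear_sum /=.
by apply: eq_bigr => n _; rewrite tower_shift_in.
Qed.

(** [tower_diff] acts as the identity on homotopy classes of maps from T, so the exact sequence
    leaves no room for a nonzero class into its cone. *)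
Lemma acyc_tel : acyc tel.
Proof.
move=> T HT t0 Ht; pose t := dg_of Ht.
have Hp : nullh (M := T) (N := shift tower_sum) (dg_comp (cone_proj tower_diff) t).
  have H1 := nullh_compr t (cone_proj_comp tower_diff).
  pose z := dg_comp (cone_proj tower_diff) t.
  (* [tower_shift_kills] concerns maps into [tower_sum] itself, so the shift is moved from the
     target to the source. *)
  have Hz : chain (M := shiftz (-1) T) (N := tower_sum) z.
    have /chain_shiftR/chain_shiftzR := chain_dg z => H.
    by apply/chain_shiftzL; rewrite opprK.
  have := tower_shift_kills (dg_of Hz) (fg_shiftz (-1) HT).
  move=> /nullh_shiftzL; rewrite opprK => /nullh_shiftzR/nullh_shiftR => H2.
  by apply: nullh_ext (nullhD H1 H2) => x /=; rewrite subrK.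
have [g Hg] := cone_exact2 Hp.
have H1 := nullh_compl (cone_inj tower_diff) (tower_shift_kills g HT).
have H2 := nullh_compr g (cone_inj_comp tower_diff).
apply: nullh_ext (nullhB (nullhD H2 H1) Hg) => x.
rewrite -(gmD (gmap_dg (cone_inj tower_diff))) tower_diffE subrK subKr.
by [].
Qed.

Definition to_tel : dghom X tel := dg_comp (cone_inj tower_diff) (dg_in tower 0).

Section Extension.
Variables (E : dgMod A) (HE : acyc E) (f : dghom (cone to_tel) E).

(** [f0] and [f1] restrict [f] to the two copies of the n-th stage inside the telescope, the second
    of which is shifted. *)
Let f0 n : dghom (tower n) E :=
  dg_comp (dg_comp f (cone_inj to_tel))
    (dg_comp (cone_inj tower_diff) (dg_in tower n)).
Let f1 n (y : tower n) : E := f ((0, din y : tower_sum), 0).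

Let good n (h : tower n -> E) := gmap (M := tower n) (N := E) (-1) h /\
  forall y, f0 n y = dgm_d E (h y) + h (dgm_d (tower n) y).

Lemma gmap_f1 n : gmap (M := tower n) (N := E) (-1) (@f1 n).
Proof.
have H := gmap_in2 (gmap_dg (dg_comp f (cone_inj to_tel))).
exact: (gmap_comp H (gmap_din tower n)).
Qed.

(** In other words, [f1] is a homotopy between [f0 n] and the restriction of [f0 n.+1] to the n-th
    stage. *)
Lemma f1_d n (y : tower n) :
  dgm_d E (f1 y) = f0 n y - f0 n.+1 (tower_inj n y) - f1 (dgm_d (tower n) y).
Proof.
have -> : dgm_d E (f1 y) = f (dgm_d (cone to_tel) ((0, din y : tower_sum), 0)).
  exact: dg_chain.
pose e0 m (x : tower m) : cone to_tel := ((din x : tower_sum, 0), 0).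
pose e1 (x : tower n) : cone to_tel := ((0, din x : tower_sum), 0).
have -> : dgm_d (cone to_tel) (e1 y) =
    e0 n y - e0 n.+1 (tower_inj n y) - e1 (dgm_d (tower n) y).
  rewrite !cone_dE; apply: injective_projections; last by rewrite /= linear0 oppr0 !addr0.
  apply: injective_projections.
    have -> : to_tel (e1 y).2 = 0 by rewrite linear0.
    change (dgm_d tower_sum 0 + tower_diff (din y) + 0 =
      din y - din (tower_inj n y) - 0 :> tower_sum).
    by rewrite linear0 add0r addr0 subr0 tower_diffE tower_shift_in.
  have -> : to_tel (e1 y).2 = 0 by rewrite linear0.
  change (- dgm_d tower_sum (din y) + 0 = 0 - 0 - din (dgm_d (tower n) y) :> tower_sum).
  by rewrite addr0 din_d subr0 sub0r.
by rewrite !linearB.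
Qed.

(** By [f1_d], [h - f1] is a null homotopy of [f0 n.+1] restricted to the n-th stage; it extends
    over the attached cone because [all_source] is K-projective. *)
Lemma tower_extend n (h : tower n -> E) : good h ->
  exists h' : tower n.+1 -> E, good h' /\
    forall y, h' (tower_inj n y) = h y - f1 y.
Proof.
move=> [Hh Eh].
have [|H [HH EH Ei]] := cone_extend_null (@kproj_all_source (tower n)) HE
    (g := f0 n.+1) (gmapB Hh (@gmap_f1 n)).
  move=> y; rewrite linearB /= f1_d.
  rewrite Eh -[LHS]/(f0 n.+1 (tower_inj n y)) !opprB addrACA.
  by rewrite (addrC (f1 _)) addrK addrC subrK.
by exists H; split.
Qed.

(** The value of [f] on the copy of X is itself a null homotopy of [f0 0], which starts the
    recursion. The homotopies assemble to one on the unshifted copies and zero elsewhere; the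
    relation between [h n.+1] and [h n] is exactly what the shifted copies demand. *)
Lemma cone_to_tel_null : nullh (M := cone to_tel) (N := E) f.
Proof.
have base : good (n := 0) (fun x => f (0, x)).
  split; first exact: (gmap_in2 (gmap_dg f)).
  move=> x; rewrite (dg_chain f (0, x)) -linearD.
  rewrite -[LHS]/(f (to_tel x, 0)); congr (f _).
  rewrite cone_dE; apply: injective_projections.
    change (to_tel x = dgm_d tel 0 + to_tel x + 0).
    by rewrite linear0 add0r addr0.
  change (0 = - dgm_d X x + dgm_d X x).
  by rewrite addNr.
pose nxt n (h : {h | good (n := n) h}) : {h' | good (n := n.+1) h'} :=
  exist _ _ (svalP (cid (tower_extend (svalP h)))).1.
(* The choices are made recursively, since each homotopy has to be compatible with the previous
   one. *)
pose seqh := nat_rect (fun n => {h | good (n := n) h}) (exist _ _ base) nxt.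
pose h n := sval (seqh n).
have Hh n : gmap (M := tower n) (N := E) (-1) (h n) by exact: (svalP (seqh n)).1.
have Eh n y : f0 n y = dgm_d E (h n y) + h n (dgm_d (tower n) y).
  exact: (svalP (seqh n)).2.
have Nh n y : h n.+1 (tower_inj n y) = h n y - f1 y.
  exact: (svalP (cid (tower_extend (svalP (seqh n))))).2.
pose L : tower_sum -> E := dsum_lift Hh.
have HL : gmap (M := tower_sum) (N := E) (-1) L by exact: gmap_lift.
have Lin n (m : tower n) : L (@din _ _ _ tower n m) = h n m by exact: dsum_lift_in.
have HL1 : gmap (M := tel) (N := E) (-1) (fun p => L p.1).
  by apply: gmap_ext (gmap_copair tower_diff (n := -1) erefl HL (gmap_cst0 _ _ _))
    => p; rewrite addr0.
have HL2 : gmap (M := cone to_tel) (N := E) (-1) (fun p => L p.1.1).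
  by apply: gmap_ext (gmap_copair to_tel (n := -1) erefl HL1 (gmap_cst0 _ _ _))
    => p; rewrite addr0.
exists (fun p => L p.1.1); split=> // p.
rewrite (cone_split p (gmap_dg f)).
rewrite [f (p.1, 0)](cone_split p.1 (gmap_dg (dg_comp f (cone_inj to_tel)))).
have Ex : f (0, p.2) = L (@din _ _ _ tower 0%N p.2).
  by rewrite Lin.
have E0 y : f ((y, 0), 0) = dgm_d E (L y) + L (dgm_d tower_sum y).
  elim/dsum_ind: y => [|y y' IH IH'|n m].
  - by rewrite !linear0 (gm0 HL) linear0 addr0.
  - have -> : ((y + y', 0), 0) = ((y, 0), 0) + ((y', 0), 0) :> cone to_tel.
      by congr ((_, _), _); rewrite /= addr0.
    by rewrite linearD IH IH' !linearD !(gmD HL) linearD /= addrACA.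
  - by rewrite din_d !Lin; exact: Eh.
have E1 y : f ((0, y), 0) = L (tower_diff y).
  elim/dsum_ind: y => [|y y' IH IH'|n m].
  - by rewrite !linear0 (gm0 HL).
  - have -> : ((0, y + y'), 0) = ((0, y), 0) + ((0, y'), 0) :> cone to_tel.
      by congr ((_, _), _); rewrite /= addr0.
    rewrite linearD IH IH' -(gmD HL); congr L.
    by rewrite (gmD (gmap_dg tower_diff)).
  - rewrite tower_diffE (gmB HL) tower_shift_in !Lin Nh.
    by rewrite subKr.
rewrite Ex [X in X + _ + _](E0 p.1.1) [X in _ + X + _](E1 p.1.2).
by rewrite -!addrA -!(gmD HL); congr (_ + L _); exact: addrA.
Qed.
End Extension.

Lemma kproj_cone_to_tel : kproj (cone to_tel).
Proof. by move=> E HE f Hf; exact: (cone_to_tel_null HE (dg_of Hf)). Qed.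

(** Q is the cone of [to_tel] shifted by -1. It sits in a triangle Q -> X -> tel with [tel] acyclic,
    so its projection to X is a weak equivalence; both halves are exactness of the cone sequence. *)
Lemma resolution : exists (Q : dgMod A) (p : dghom Q X),
  kproj Q /\ weqII (X := Q) (Y := X) p.
Proof.
pose C := cone to_tel; pose Q := shiftz (-1) C.
have EQ (T : dgMod A) (z : T -> C) : chain (M := T) (N := Q) z <->
    chain (M := shift T) (N := C) z.
  by rewrite chain_shiftL (@chain_shiftzL _ _ 1) -chain_shiftzR.
have EQn (T : dgMod A) (z : T -> C) : nullh (M := T) (N := Q) z <->
    nullh (M := shift T) (N := C) z.
  by rewrite nullh_shiftL (@nullh_shiftzL _ _ 1) -nullh_shiftzR.
have Hp : chain (M := Q) (N := X) (cone_proj to_tel).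
  apply/chain_shiftzL/chain_shiftzR/chain_shiftR; exact: chain_dg.
exists Q, (dg_of Hp); split; first exact: kproj_shiftz kproj_cone_to_tel.
apply: weqII_of0 => T HT; split=> [z Hz|w].
  have Hz' := (EQ T z).1 (chain_dg z); apply/EQn.
  have [|g Hg] := cone_exact2 (h := dg_of Hz'); first exact/nullh_shift2.
  have H1 := acyc_tel (fg_shift HT) (chain_dg g).
  apply: nullh_ext (nullhB (nullh_compl (cone_inj to_tel) H1) Hg) => t.
  by rewrite subKr.
have [|g Hg] := @cone_exact3 _ _ _ _ to_tel (shift T) (shift_map w).
  apply: (acyc_shift acyc_tel (fg_shift HT)).
  exact: (chain_dg (dg_comp (shift_map to_tel) (shift_map w))).
have Hg' := (EQ T g).2 (chain_dg g).
exists (dg_of Hg'); apply: nullh_ext (nullh0 T X) => t.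
by have /= := Hg t; rewrite /= => ->; rewrite subrr.
Qed.

End Tower.

(** * Functoriality, rotation and octahedron for cones; binary sums and cylinders *)

Section ConeConstructions.
Variables (k : fieldType) (A : dgAlg k).

(** The homotopy filling the square becomes the off-diagonal entry of [c], and for this reason the
    squares with injections and projections commute strictly. *)
Lemma cone_map (M N M' N' : dgMod A) (f : dghom M N) (f' : dghom M' N')
    (a : dghom M M') (b : dghom N N') :
  nullh (M := M) (N := N') (fun x => b (f x) - f' (a x)) ->
  exists c : dghom (cone f) (cone f'),
    (forall y, c (cone_inj f y) = cone_inj f' (b y)) /\
    (forall p, cone_proj f' (c p) = shift_map a (cone_proj f p)).
Proof.
move=> [h [Hh Eh]].
have Hc : chain (M := cone f) (N := cone f')
    (fun p => (b p.1 + h p.2, a p.2)).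
  split.
    apply: (@gmap_pair _ _ _ _ f' (cone f) 0 1 (fun p => b p.1 + h p.2)
              (fun p => a p.2)) => //.
      exact: (@gmap_copair _ _ _ _ f N' 0 (-1) b h _ (gmap_dg b) Hh).
    have H2 := @gmap_snd _ _ _ _ f (cone f) 0 id (gmap_id _).
    exact: (gmap_comp (gmap_dg a) H2).
  move=> p; rewrite !cone_dE; congr (_, _) => /=; last first.
    by rewrite linearN dg_chain.
  rewrite linearD (gmD (gmap_dg b)) (gmN Hh) dg_chain -!addrA; congr (_ + _).
  have := Eh p.2 => /eqP; rewrite subr_eq => /eqP ->.
  by rewrite addrAC addrK.
exists (dg_of Hc); split=> // y.
by rewrite /= (gm0 Hh) addr0 (gm0 (gmap_dg a)).
Qed.

Section Rotation.
Variables (M N : dgMod A) (f : dghom M N).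
Let C := cone (cone_inj f).

(** In N + M[1] + N[1] the two copies of N cancel up to homotopy and M[1] remains. The sign in the
    last clause is the one of a rotated triangle. *)
Lemma cone_rotate : exists (p : dghom C (shift M)) (t : dghom (shift M) C),
  [/\ forall x, p (t x) = x,
      nullh (M := C) (N := C) (fun c => t (p c) - c),
      forall x, p (cone_inj (cone_inj f) x) = cone_proj f x &
      forall x, cone_proj (cone_inj f) (t x) = - shift_map f x].
Proof.
have Hp : chain (M := C) (N := shift M) (fun c => c.1.2).
  split; first by split=> // i m [[_ Hm] _]; rewrite addr0.
  by move=> c; rewrite !cone_dE /= addr0.
have Ht : chain (M := shift M) (N := C) (fun x => ((0, x), - f x)).
  split; first split=> [c u v|i m Hm|m a].
  - apply: injective_projections.
      apply: injective_projections => //=; by rewrite scaler0 addr0.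
    by rewrite /= linearP opprD scalerN.
  - rewrite addr0; split; first by split=> //; exact: hgs0.
    by apply: hgsN; have := gh_gr f Hm; rewrite addr0.
  - apply: injective_projections.
      by apply: injective_projections => //=; rewrite ract0l.
    by rewrite /= ractNl; congr (- _); exact: (gh_act f m a).
  move=> x; rewrite !cone_dE; apply: injective_projections.
    apply: injective_projections.
      by rewrite /= linear0 add0r subrr.
    by rewrite /= addr0.
  by rewrite /= /shift_d !linearN dg_chain.
exists (dg_of Hp), (dg_of Ht); split=> //.
exists (fun c => ((0, 0), - c.1.1)); split.
  split=> [c u v|i m [[Hm _] _]|m a].
  - apply: injective_projections.
      by apply: injective_projections => /=; rewrite scaler0 addr0.
    by rewrite /= opprD scalerN.
  - split; first by split; exact: hgs0.
    by rewrite /= subrK; exact: hgsN.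
  - apply: injective_projections.
      by apply: injective_projections => /=; rewrite ract0l.
    by rewrite /= ractNl.
case=> -[y x] y'; rewrite !cone_dE; apply: injective_projections.
  apply: injective_projections => /=.
    by rewrite !linear0 !addr0 !add0r.
  by rewrite subrr !(linear0, oppr0, addr0).
rewrite /= linearN opprK !opprD !addrA addrN.
by rewrite add0r.
Qed.
End Rotation.

Section Octahedron.
Variables (M N O : dgMod A) (f : dghom M N) (g : dghom N O).

(** [cone u] consists of O, M[1], N[1] and M[2]. The identity between the two copies of M contracts
    them and leaves [cone g]. *)
Lemma cone_octahedron :
  exists (u : dghom (cone f) (cone (dg_comp g f)))
    (v : dghom (cone (dg_comp g f)) (cone g))
    (p : dghom (cone u) (cone g)) (t : dghom (cone g) (cone u)),
  [/\ [/\ forall x, cone_proj (dg_comp g f) (u x) = cone_proj f x,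
          forall x, v (cone_inj (dg_comp g f) x) = cone_inj g x,
          forall y, u (cone_inj f y) = cone_inj (dg_comp g f) (g y) &
          forall x, cone_proj g (v x) = shift_map f (cone_proj (dg_comp g f) x)],
      forall x, p (t x) = x,
      nullh (M := cone u) (N := cone u) (fun c => t (p c) - c),
      forall x, p (cone_inj u x) = v x &
      forall x, cone_proj u (t x) = shift_map (cone_inj f) (cone_proj g x)].
Proof.
have Hu : chain (M := cone f) (N := cone (dg_comp g f)) (fun p => (g p.1, p.2)).
  split; first split=> [c x y|i m [Hm1 Hm2]|m a].
  - by rewrite /= linearP.
  - rewrite addr0; split=> //=; by have := gh_gr g Hm1; rewrite addr0.
  - by congr (_, _); exact: (gh_act g).
  by move=> p; rewrite !cone_dE /= linearD dg_chain.
have Hv : chain (M := cone (dg_comp g f)) (N := cone g) (fun p => (p.1, f p.2)).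
  split; first split=> [c x y|i m [Hm1 Hm2]|m a].
  - by rewrite /= linearP.
  - rewrite addr0; split=> //=; by have := gh_gr f Hm2; rewrite addr0.
  - by congr (_, _); exact: (gh_act f).
  by move=> p; rewrite !cone_dE /= linearN dg_chain.
pose u := dg_of Hu; pose v := dg_of Hv.
have Hp : chain (M := cone u) (N := cone g) (fun c => (c.1.1, c.2.1 + f c.1.2)).
  split; first split=> [c x y|i m [[Hm1 Hm2] [Hm3 Hm4]]|m a].
  - by congr (_, _); rewrite /= linearP scalerDr addrACA.
  - rewrite addr0; split=> //=; apply: hgsD => //.
    by have := gh_gr f Hm2; rewrite addr0.
  - congr (_, _); rewrite /= ractDl; congr (_ + _); exact: (gh_act f).
  move=> [[z x] [y x']]; rewrite !cone_dE; congr (_, _) => /=.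
    by rewrite linearD [in RHS]addrAC addrA.
  rewrite linearD (linearD f) linearN dg_chain opprD opprD /=.
  by rewrite addrACA addNr addr0.
have Ht : chain (M := cone g) (N := cone u) (fun p => ((p.1, 0), (p.2, 0))).
  split; first split=> [c x y|i m [Hm1 Hm2]|m a].
  - by congr ((_, _), (_, _)); rewrite /= scaler0 addr0.
  - by rewrite addr0; split; split=> //; exact: hgs0.
  - by congr ((_, _), (_, _)); rewrite /= ract0l.
  move=> [z y]; rewrite !cone_dE; apply: injective_projections.
    apply: injective_projections => /=.
      by rewrite !linear0 addr0.
    by rewrite linear0 oppr0 addr0.
  apply: injective_projections => /=; first by rewrite linear0 addr0.
  by rewrite linear0 !oppr0.
exists u, v, (dg_of Hp), (dg_of Ht); split=> //.
- by split=> // x; rewrite /= linear0.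
- move=> [z y]; rewrite /= linear0 addr0 //.
- exists (fun c => ((0, 0), (0, - c.1.2))); split.
    split=> [c x y|i m [[Hm1 Hm2] [Hm3 Hm4]]|m a].
    + by congr ((_, _), (_, _)); rewrite /= ?scaler0 ?addr0 // opprD scalerN.
    + split; split=> //=; try exact: hgs0.
      by rewrite subrK; exact: hgsN.
    + by congr ((_, _), (_, _)); rewrite /= ?ract0l ?ractNl.
  case=> -[z x] [y x']; rewrite !cone_dE; apply: injective_projections.
    apply: injective_projections => /=.
      by rewrite !linear0 !addr0 subrr.
    by rewrite !(linear0, oppr0, sub0r, add0r, addr0).
  apply: injective_projections => /=.
    by rewrite (linearN f) !(linear0, add0r, addr0) opprK addrAC subrr add0r.
  by rewrite (linearN (dgm_d M)) !opprK sub0r opprD opprK addrA addNr add0r.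
- by move=> x; congr (_, _); rewrite /= add0r.
Qed.
End Octahedron.

(** The direct sum, as the cone of a zero map, inherits from cones the closure properties of twisted
    and of K-projective modules. *)
Definition bsum (M N : dgMod A) : dgMod A := cone (dg0 (shiftz (-1) N) M).

Section BinarySum.
Variables M N : dgMod A.

Lemma bsum_dE (p : bsum M N) :
  dgm_d (bsum M N) p = (dgm_d M p.1, dgm_d N p.2).
Proof.
rewrite cone_dE; congr (_, _); first by rewrite /= addr0.
by rewrite shiftz_dE /sgn /= expr1 scaleN1r opprK.
Qed.

Lemma bsum_maps : exists (i1 : dghom M (bsum M N)) (i2 : dghom N (bsum M N))
    (p1 : dghom (bsum M N) M) (p2 : dghom (bsum M N) N),
  [/\ forall x, i1 x = (x, 0), forall y, i2 y = (0, y),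
      forall p, p1 p = p.1 & forall p, p2 p = p.2].
Proof.
have H1 : chain (M := M) (N := bsum M N) (fun x => (x, 0)).
  exact: (chain_dg (cone_inj (dg0 (shiftz (-1) N) M))).
have H2 : chain (M := N) (N := bsum M N) (fun y => (0, y)).
  split; last by move=> y; rewrite bsum_dE /= linear0.
  split=> [c x y|i m Hm|m a].
  - by congr (_, _); rewrite /= scaler0 addr0.
  - rewrite addr0; split; first exact: hgs0.
    by rewrite /= addrK.
  - by congr (_, _); rewrite /= ract0l.
have H3 : chain (M := bsum M N) (N := M) (fun p => p.1).
  split; last by move=> p; rewrite bsum_dE.
  by split=> // i m []; rewrite addr0.
have H4 : chain (M := bsum M N) (N := N) (fun p => p.2).
  split; last by move=> p; rewrite bsum_dE.
  by split=> // i m [_]; rewrite /= addrK addr0.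
by exists (dg_of H1), (dg_of H2), (dg_of H3), (dg_of H4).
Qed.

Lemma fg_bsum : is_fg_twisted M -> is_fg_twisted N -> is_fg_twisted (bsum M N).
Proof. by move=> HM HN; apply: fg_cone => //; exact: fg_shiftz. Qed.
End BinarySum.

(** C is the cone of m |-> (m, -m) on M + M. Its two ends are sections of one weak equivalence,
    which will identify them, and with them [f] and [g], in the localization. *)
Lemma cylinder (M N : dgMod A) (f g : dghom M N) :
  nullh (M := M) (N := N) (fun m => f m - g m) ->
  exists (C : dgMod A) (s : dghom C M) (i0 i1 : dghom M C) (H : dghom C N),
    [/\ weqII (X := C) (Y := M) s, forall m, s (i0 m) = m, forall m, s (i1 m) = m,
        forall m, H (i0 m) = f m & forall m, H (i1 m) = g m].
Proof.
move=> [h [Hh Eh]]; pose B := bsum M M.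
have Hd : chain (M := M) (N := B) (fun m => (m, - m)).
  have [i1 [i2 [_ [_ [E1 E2 _ _]]]]] := bsum_maps M M.
  have := chain_dg (dgD i1 (dgN i2)); congr (chain _); apply/funext => m /=.
  by rewrite E1 E2; congr (_, _); rewrite /= ?subr0 ?sub0r.
pose C := cone (dg_of Hd).
(* A map out of C is a pair of maps with a homotopy between them. The zero homotopy gives [s], the
   given one gives the map to N. *)
have cm (L : dgMod A) (a b : dghom M L) c : gmap (M := M) (N := L) (-1) c ->
    (forall m, a m - b m = dgm_d L (c m) + c (dgm_d M m)) ->
    chain (M := C) (N := L) (fun p => a p.1.1 + b p.1.2 + c p.2).
  move=> Hc Ec; split; first split=> [e x y|i p [[H1 H2] H3]|p e].
  - rewrite /= !linearP (gm_lin Hc) !scalerDr.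
    by rewrite [RHS]addrACA; congr (_ + _); exact: addrACA.
  - rewrite addr0; apply: hgsD; first apply: hgsD.
    + by have := gh_gr a H1; rewrite addr0.
    + by move: H2; rewrite /= addrK => /(gh_gr b); rewrite addr0.
    + by have := gm_deg Hc H3; rewrite addrK.
  - by rewrite /= !ractDl (gm_act Hc) (gh_act a) (gh_act b).
  move=> [[y0 y1] x]; rewrite cone_dE (bsum_dE (y0, y1)) /= !linearD !linearN /=.
  rewrite (gmN Hc) !dg_chain addrACA.
  rewrite -!addrA; do 2!congr (_ + _).
  by rewrite addrA Ec addrK.
have Hs := @cm M (dg_id M) (dg_id M) _ (gmap_cst0 M M (-1)).
have {}Hs : chain (M := C) (N := M) (fun p => p.1.1 + p.1.2 + 0).
  by apply: Hs => m; rewrite subrr linear0 addr0.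
pose s := dg_of Hs.
pose i0 := dg_comp (cone_inj (dg_of Hd)) (cone_inj (dg0 (shiftz (-1) M) M)).
have [_ [i2 [_ [_ [_ E2 _ _]]]]] := bsum_maps M M.
pose i1 := dg_comp (cone_inj (dg_of Hd)) i2.
exists C, s, i0, i1, (dg_of (cm _ _ _ _ Hh Eh)).
have E0 m : i0 m = ((m, 0), 0) by [].
have E1 m : i1 m = ((0, m), 0) by rewrite /= E2.
split; last first.
- by move=> m; rewrite E1 /= linear0 add0r (gm0 Hh) addr0.
- by move=> m; rewrite E0 /= linear0 (gm0 Hh) !addr0.
- by move=> m; rewrite E1 /= add0r addr0.
- by move=> m; rewrite E0 /= !addr0.
apply: (@weqII_homotopy_equivalence _ _ _ _ s i0).
  exists (fun p => ((0, 0), p.1.2)); split.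
    split=> [c x y|i p [[H1 H2] H3]|p a].
    - by congr ((_, _), _); rewrite /= scaler0 addr0.
    - split; first by split; exact: hgs0.
      by move: H2; rewrite /= addrK subrK.
    - by congr ((_, _), _); rewrite /= ract0l.
  move=> [[y0 y1] x]; rewrite E0 (@cone_dE _ _ _ _ (dg_of Hd) (0, 0, y1)).
  rewrite (@cone_dE _ _ _ _ (dg_of Hd) (y0, y1, x)).
  rewrite (bsum_dE (0, 0)) (bsum_dE (y0, y1)) /=.
  apply: injective_projections.
    apply: injective_projections => /=.
      by rewrite linear0 !addr0 add0r addrAC subrr add0r.
    by rewrite linear0 addr0 !add0r.
  by rewrite /= sub0r addKr.
by apply: nullh_ext (nullh0 M M) => m; rewrite E0 /= !addr0 subrr.
Qed.

End ConeConstructions.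

(** * Morphisms of the localization *)

Section HomotopyRelation.
Variables (k : fieldType) (A : dgAlg k).

Definition hmt (M N : dgMod A) (f g : dghom M N) :=
  nullh (M := M) (N := N) (fun m => f m - g m).

Lemma hmt_eq1 (M N : dgMod A) (f g : dghom M N) : f =1 g -> hmt f g.
Proof.
by move=> E; apply: nullh_ext (nullh0 M N) => m; rewrite E subrr.
Qed.

Lemma hmt_refl (M N : dgMod A) (f : dghom M N) : hmt f f.
Proof. exact: hmt_eq1. Qed.

Lemma hmt_sym (M N : dgMod A) (f g : dghom M N) : hmt f g -> hmt g f.
Proof. exact: nullh_sym. Qed.

Lemma hmt_trans (M N : dgMod A) (g f h : dghom M N) :
  hmt f g -> hmt g h -> hmt f h.
Proof. exact: nullh_trans. Qed.

Lemma hmt_comp (M N P : dgMod A) (g g' : dghom N P) (f f' : dghom M N) :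
  hmt g g' -> hmt f f' -> hmt (dg_comp g f) (dg_comp g' f').
Proof.
move=> Hg Hf; apply: (@hmt_trans _ _ (dg_comp g f')); last exact: (nullh_compr f' Hg).
by apply: nullh_ext (nullh_compl g Hf) => m; rewrite (gmB (gmap_dg g)).
Qed.

Lemma hmt_add (M N : dgMod A) (f f' g g' : dghom M N) :
  hmt f f' -> hmt g g' -> hmt (dgD f g) (dgD f' g').
Proof.
by move=> Hf Hg; apply: nullh_ext (nullhD Hf Hg) => m; rewrite /= opprD addrACA.
Qed.

Lemma hmt0P (M N : dgMod A) (f : dghom M N) :
  hmt f (dg0 M N) <-> nullh (M := M) (N := N) f.
Proof. by split; apply: nullh_ext => m; rewrite /= subr0. Qed.

Lemma homotopic_hmt (M N : dgMod A) (f g : dghom M N) : homotopic f g <-> hmt f g.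
Proof. exact: homotopicP. Qed.

Notation W := (@weqII k A).
Notation D := (DIIc A).

Definition gam (M N : dgMod A) (f : dghom M N) : @hom D M N := loc_of W f.

Lemma gam_comp (M N P : dgMod A) (g : dghom N P) (f : dghom M N) :
  gam (dg_comp g f) =~ gam g \c gam f.
Proof. exact: (@loc_of_cmp (dgModCat A) W). Qed.

Lemma gam_id (M : dgMod A) : gam (dg_id M) =~ @idm D M.
Proof. exact: (@heq_refl D). Qed.

Lemma gam_eq1 (M N : dgMod A) (f g : dghom M N) : f =1 g -> gam f =~ gam g.
Proof. exact: (@loc_of_heq (dgModCat A) W). Qed.

Lemma gam_iso (M N : dgMod A) (w : dghom M N) :
  weqII (X := M) (Y := N) w -> is_iso (gam w).
Proof.
move=> Ww; exists (@loc_inv (dgModCat A) W M N w Ww); split.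
  exact: (@loc_invl (dgModCat A) W).
exact: (@loc_invr (dgModCat A) W).
Qed.

(** Both ends of the cylinder become the inverse of [gam s]. *)
Lemma gam_hmt (M N : dgMod A) (f g : dghom M N) : hmt f g -> gam f =~ gam g.
Proof.
move=> /cylinder[C [s [i0 [i1 [H [Ws s0 s1 H0 H1]]]]]].
have [t [ts _]] := gam_iso Ws.
have E (i : dghom M C) : (forall m, s (i m) = m) -> gam i =~ t.
  move=> si; apply: heq_trans (heq_sym (cmp1m _)) _.
  apply: heq_trans (cmp_heq (heq_sym ts) (heq_refl _)) _.
  apply: heq_trans (heq_sym (cmpA _ _ _)) _.
  apply: heq_trans (cmpm1 t); apply: cmp_heq (heq_refl _) _.
  apply: heq_trans (heq_sym (gam_comp _ _)) _.
  exact: (@gam_eq1 _ _ (dg_comp s i) (dg_id M) si).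
apply: heq_trans (_ : gam H \c gam i0 =~ _).
  apply: heq_trans (gam_comp _ _).
  by apply: gam_eq1 => m; rewrite -H0.
apply: heq_trans (_ : gam H \c gam i1 =~ _).
  by apply: cmp_heq (heq_refl _) _; apply: heq_trans (E _ s0) (heq_sym (E _ s1)).
apply: heq_trans (heq_sym (gam_comp _ _)) _.
by apply: gam_eq1 => m; rewrite -H1.
Qed.

Section Act.
Variables (Q : dgMod A) (HQ : kproj Q).

Definition weq_lift (X Y : dgMod A) (w : dghom X Y)
    (Ww : weqII (X := X) (Y := Y) w) (g : dghom Q Y) : dghom Q X :=
  sval (cid (kproj_lift g HQ Ww)).

Lemma weq_liftP (X Y : dgMod A) (w : dghom X Y)
    (Ww : weqII (X := X) (Y := Y) w) (g : dghom Q Y) :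
  hmt (dg_comp w (weq_lift Ww g)) g.
Proof. by rewrite /weq_lift; case: cid. Qed.

Lemma weq_lift_uniq (X Y : dgMod A) (w : dghom X Y)
    (Ww : weqII (X := X) (Y := Y) w) (z z' : dghom Q X) :
  hmt (dg_comp w z) (dg_comp w z') -> hmt z z'.
Proof.
move=> H; apply: (@kproj_lift_inj _ _ _ _ _ w (dgD z (dgN z')) HQ Ww).
by apply: nullh_ext H => m /=; rewrite (gmB (gmap_dg w)).
Qed.

(* Hom_K(Q, -) inverts weak equivalences, so the localization acts on it. *)
Fixpoint act (X Y : dgModCat A) (phi : loc_hom W X Y) : dghom Q X -> dghom Q Y :=
  match phi in loc_hom _ X Y return dghom Q X -> dghom Q Y with
  | loc_of _ _ f => fun g => dg_comp f g
  | loc_inv _ _ _ Ww => fun g => weq_lift Ww g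
  | loc_cmp _ _ _ phi psi => fun g => act phi (act psi g)
  end.

Lemma act_hmt X Y (phi : loc_hom W X Y) g g' :
  hmt g g' -> hmt (act phi g) (act phi g').
Proof.
elim: phi g g' => {X Y} [X Y f|X Y w Ww|X Y Z phi IH psi IH'] g g' H /=.
- exact: hmt_comp (hmt_refl _) H.
- apply: (weq_lift_uniq Ww).
  apply: hmt_trans (weq_liftP _ _) _; apply: hmt_trans H _.
  exact: hmt_sym (weq_liftP _ _).
- exact/IH/IH'.
Qed.

Lemma act_add X Y (phi : loc_hom W X Y) g g' :
  hmt (act phi (dgD g g')) (dgD (act phi g) (act phi g')).
Proof.
elim: phi g g' => {X Y} [X Y f|X Y w Ww|X Y Z phi IH psi IH'] g g' /=.
- by apply: hmt_eq1 => m; rewrite /= (gmD (gmap_dg f)).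
- apply: (weq_lift_uniq Ww); apply: hmt_trans (weq_liftP _ _) _.
  apply: hmt_sym; apply: hmt_trans (hmt_add (weq_liftP Ww g) (weq_liftP Ww g')).
  by apply: hmt_eq1 => m; rewrite /= (gmD (gmap_dg w)).
- exact: hmt_trans (act_hmt _ (IH' _ _)) (IH _ _).
Qed.

(** Each defining relation of the localization holds for the action up to homotopy; the two about
    inverses are existence and uniqueness of lifts. *)
Lemma act_eq X Y (phi psi : loc_hom W X Y) : loc_eq phi psi ->
  forall g, hmt (act phi g) (act psi g).
Proof.
elim=> {X Y phi psi} /=.
- by move=> *; exact: hmt_refl.
- by move=> X Y f g _ IH h; apply/hmt_sym/IH.
- by move=> X Y f g h _ IH _ IH' z; exact: hmt_trans (IH z) (IH' z).
- move=> X Y Z g g' f f' _ IH _ IH' z.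
  exact: hmt_trans (IH _) (act_hmt _ (IH' _)).
- by move=> *; exact: hmt_refl.
- by move=> X Y f z; apply: hmt_eq1.
- by move=> X Y f z; apply: act_hmt; apply: hmt_eq1.
- by move=> X Y f g fg z; apply: hmt_eq1 => m; exact: fg.
- by move=> X Y Z g f z; apply: hmt_eq1.
- move=> X Y w Ww z; apply: (weq_lift_uniq Ww).
  by apply: hmt_trans (weq_liftP _ _) _; apply: hmt_eq1.
- move=> X Y w Ww z; apply: hmt_trans (weq_liftP _ _) _; exact: hmt_eq1.
Qed.

(** The action is composition in the localization. Applied to the identity of Q, it gives every
    morphism out of Q a strict representative. *)
Lemma gam_act (X Y : dgMod A) (phi : @hom D X Y) (g : dghom Q X) :
  gam (act phi g) =~ phi \c gam g.
Proof.
elim: phi g => {X Y} [X Y f|X Y w Ww|X Y Z phi IH psi IH'] g /=.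
- exact: gam_comp.
- have wl : @heq D X X (loc_cmp (loc_inv Ww) (loc_of W w)) (@idm D X).
    exact: (@loc_invl (dgModCat A) W).
  apply: heq_trans (heq_sym (@cmp1m D _ _ _)) _.
  apply: heq_trans (cmp_heq (heq_sym wl) (heq_refl _)) _.
  apply: heq_trans (heq_sym (@cmpA D _ _ _ _ _ _ _)) _.
  apply: cmp_heq (heq_refl _) _.
  apply: heq_trans (heq_sym (gam_comp _ _)) _.
  exact: gam_hmt (weq_liftP _ _).
- apply: heq_trans (IH _) _.
  apply: heq_trans (cmp_heq (heq_refl _) (IH' _)) _.
  exact: (@cmpA D).
Qed.

Lemma gam_full (Y : dgMod A) (phi : @hom D Q Y) :
  exists f : dghom Q Y, phi =~ gam f.
Proof.
exists (act phi (dg_id Q)); apply: heq_sym.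
exact: heq_trans (gam_act _ _) (@cmpm1 D _ _ _).
Qed.

Lemma gam_faithful (Y : dgMod A) (f g : dghom Q Y) : gam f =~ gam g -> hmt f g.
Proof.
move=> /act_eq/(_ (dg_id Q)) H.
apply: hmt_trans (hmt_trans _ H) _; exact: hmt_eq1.
Qed.
End Act.

Definition res (X : dgMod A) : dgMod A := sval (cid (resolution X)).
Definition res_map (X : dgMod A) : dghom (res X) X :=
  sval (cid (svalP (cid (resolution X)))).
Lemma res_kproj (X : dgMod A) : kproj (res X).
Proof. exact: (svalP (cid (svalP (cid (resolution X))))).1. Qed.
Lemma res_weq (X : dgMod A) : weqII (X := res X) (Y := X) (res_map X).
Proof. exact: (svalP (cid (svalP (cid (resolution X))))).2. Qed.

(** [toK] and [ofK] identify the morphisms X -> Y of the localization with homotopy classes of maps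
    [res X] -> Y; words cannot be added, but such maps can. *)
Definition toK (X Y : dgMod A) (phi : @hom D X Y) : dghom (res X) Y :=
  act (@res_kproj X) phi (res_map X).
Definition ofK (X Y : dgMod A) (f : dghom (res X) Y) : @hom D X Y :=
  gam f \c (loc_inv (@res_weq X) : @hom D X (res X)).

Lemma toKP (X Y : dgMod A) (phi : @hom D X Y) : gam (toK phi) =~ phi \c gam (res_map X).
Proof. exact: gam_act. Qed.

Lemma ofKP (X Y : dgMod A) (f : dghom (res X) Y) : ofK f \c gam (res_map X) =~ gam f.
Proof.
apply: heq_trans (heq_sym (@cmpA D _ _ _ _ _ _ _)) _.
apply: heq_trans (@cmpm1 D _ _ _); apply: cmp_heq (heq_refl _) _.
exact: (@loc_invl (dgModCat A) W).
Qed.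

Lemma heq_res (X Y : dgMod A) (phi psi : @hom D X Y) :
  phi \c gam (res_map X) =~ psi \c gam (res_map X) -> phi =~ psi.
Proof.
move=> H; pose i : @hom D X (res X) := loc_inv (@res_weq X).
have E (f : @hom D X Y) : f =~ f \c gam (res_map X) \c i.
  apply: heq_trans (heq_sym (@cmpm1 D _ _ _)) _.
  apply: heq_trans (@cmpA D _ _ _ _ _ _ _); apply: cmp_heq (heq_refl _) _.
  apply: heq_sym; exact: (@loc_invr (dgModCat A) W).
apply: heq_trans (E phi) _; apply: heq_trans (heq_sym (E psi)).
exact: cmp_heq H (heq_refl _).
Qed.

Lemma toK_inj (X Y : dgMod A) (phi psi : @hom D X Y) :
  hmt (toK phi) (toK psi) -> phi =~ psi.
Proof.
move=> /gam_hmt H; apply: heq_res.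
apply: heq_trans (heq_sym (toKP _)) _; apply: heq_trans H _; exact: toKP.
Qed.

Lemma toK_heq (X Y : dgMod A) (phi psi : @hom D X Y) :
  phi =~ psi -> hmt (toK phi) (toK psi).
Proof. by move=> H; exact: act_eq. Qed.

Lemma ofK_heq (X Y : dgMod A) (f g : dghom (res X) Y) : hmt f g -> ofK f =~ ofK g.
Proof. by move=> /gam_hmt H; exact: cmp_heq H (heq_refl _). Qed.

Lemma toK_ofK (X Y : dgMod A) (f : dghom (res X) Y) : hmt (toK (ofK f)) f.
Proof.
apply: (gam_faithful (@res_kproj X)).
apply: heq_trans (toKP _) _; exact: ofKP.
Qed.

Lemma toK_cmp (X Y Z : dgMod A) (phi : @hom D Y Z) (psi : @hom D X Y) :
  hmt (toK (phi \c psi)) (act (@res_kproj X) phi (toK psi)).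
Proof. exact: hmt_refl. Qed.

Definition DhD (X Y : dgMod A) (phi psi : @hom D X Y) := ofK (dgD (toK phi) (toK psi)).
Definition Dh0 (X Y : dgMod A) : @hom D X Y := ofK (dg0 (res X) Y).
Definition DhN (X Y : dgMod A) (phi : @hom D X Y) := ofK (dgN (toK phi)).

Lemma toK_add (X Y : dgMod A) (phi psi : @hom D X Y) :
  hmt (toK (DhD phi psi)) (dgD (toK phi) (toK psi)).
Proof. exact: toK_ofK. Qed.

Lemma DhD_heq (X Y : dgMod A) (f f' g g' : @hom D X Y) :
  f =~ f' -> g =~ g' -> DhD f g =~ DhD f' g'.
Proof. by move=> Hf Hg; apply: ofK_heq; apply: hmt_add; exact: toK_heq. Qed.

Lemma DhDA (X Y : dgMod A) (f g h : @hom D X Y) :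
  DhD f (DhD g h) =~ DhD (DhD f g) h.
Proof.
apply: ofK_heq; apply: hmt_trans (hmt_add (hmt_refl _) (toK_add _ _)) _.
apply: hmt_trans (hmt_sym (hmt_add (toK_add _ _) (hmt_refl _))).
by apply: hmt_eq1 => m; rewrite /= addrA.
Qed.

Lemma DhDC (X Y : dgMod A) (f g : @hom D X Y) : DhD f g =~ DhD g f.
Proof. by apply: ofK_heq; apply: hmt_eq1 => m; rewrite /= addrC. Qed.

Lemma DhD0 (X Y : dgMod A) (f : @hom D X Y) : DhD (Dh0 X Y) f =~ f.
Proof.
apply: toK_inj; apply: hmt_trans (toK_add _ _) _.
apply: hmt_trans (hmt_add (toK_ofK _) (hmt_refl _)) _.
by apply: hmt_eq1 => m; rewrite /= add0r.
Qed.

Lemma DhDN (X Y : dgMod A) (f : @hom D X Y) : DhD (DhN f) f =~ Dh0 X Y.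
Proof.
apply: ofK_heq; apply: hmt_trans (hmt_add (toK_ofK _) (hmt_refl _)) _.
by apply: hmt_eq1 => m; rewrite /= addNr.
Qed.

Lemma DcmpDr (X Y Z : dgMod A) (g : @hom D Y Z) (f f' : @hom D X Y) :
  g \c DhD f f' =~ DhD (g \c f) (g \c f').
Proof.
apply: toK_inj; apply: hmt_trans (toK_cmp _ _) _.
apply: hmt_trans (act_hmt _ _ (toK_add _ _)) _.
apply: hmt_trans (act_add _ _ _ _) _.
exact: hmt_sym (toK_add (g \c f) (g \c f')).
Qed.

(** [act_add] only gives additivity in the right factor. Here [f] is first represented by a strict
    map [a] between the resolutions, so that composing with [f] becomes composing with [a]. *)
Lemma DcmpDl (X Y Z : dgMod A) (g g' : @hom D Y Z) (f : @hom D X Y) :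
  DhD g g' \c f =~ DhD (g \c f) (g' \c f).
Proof.
have HX := @res_kproj X; have [a Ha] := kproj_lift (toK f) HX (@res_weq Y).
have {}Ha : hmt (dg_comp (res_map Y) a) (toK f) by exact: Ha.
have {Ha} fa : f \c gam (res_map X) =~ gam (res_map Y) \c gam a.
  apply: heq_trans (heq_sym (toKP _)) _.
  apply: heq_trans (gam_comp _ _); apply: gam_hmt; exact: hmt_sym Ha.
have E (h : @hom D Y Z) : hmt (toK (h \c f)) (dg_comp (toK h) a).
  apply: (gam_faithful HX); apply: heq_trans (toKP _) _.
  apply: heq_trans (heq_sym (@cmpA D _ _ _ _ _ _ _)) _.
  apply: heq_trans (cmp_heq (heq_refl _) fa) _.
  apply: heq_trans (@cmpA D _ _ _ _ _ _ _) _.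
  apply: heq_trans (cmp_heq (heq_sym (toKP _)) (heq_refl _)) _.
  exact: heq_sym (gam_comp _ _).
apply: toK_inj; apply: hmt_trans (E _) _.
apply: hmt_trans (hmt_sym (toK_add _ _)).
apply: hmt_trans (hmt_comp (toK_add _ _) (hmt_refl _)) _.
apply: hmt_trans (hmt_sym (hmt_add (E g) (E g'))).
exact: hmt_eq1.
Qed.

Definition Dpreadd : preadditive D :=
  @Preadditive D DhD Dh0 DhN DhD_heq DhDA DhDC DhD0 DhDN DcmpDl DcmpDr.

Lemma gamD (X Y : dgMod A) (f g : dghom X Y) :
  gam (dgD f g) =~ hadd Dpreadd (gam f) (gam g).
Proof.
apply: toK_inj; apply: hmt_sym; apply: hmt_trans (toK_add _ _) _; exact: hmt_eq1.
Qed.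

Lemma gam0 (X Y : dgMod A) : gam (dg0 X Y) =~ hzero Dpreadd X Y.
Proof.
apply: toK_inj; apply: hmt_sym; apply: hmt_trans (toK_ofK _) _; exact: hmt_eq1.
Qed.

Lemma gamN (X Y : dgMod A) (f : dghom X Y) : gam (dgN f) =~ hopp Dpreadd (gam f).
Proof.
apply: toK_inj; apply: hmt_sym; apply: hmt_trans (toK_ofK _) _; exact: hmt_eq1.
Qed.

End HomotopyRelation.

(** * The morphism groups of the homotopy category, exact triangles and the five lemma *)

Section HomClasses.
Variables (k : fieldType) (A : dgAlg k).
Notation C := (DIIc A).
Notation P := (Dpreadd A).

(* The homs of the localization as zmodTypes.  Their elements are sets of maps
   res X -> Y, because [hom X Y] lives in too large a universe. *)
Definition qhom (X Y : C) :=
  {S : dghom (res X) Y -> Prop | exists f : hom X Y, S = fun h => ofK h =~ f}.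
HB.instance Definition _ X Y := gen_eqMixin (qhom X Y).
HB.instance Definition _ X Y := gen_choiceMixin (qhom X Y).

Definition cls (X Y : C) (f : hom X Y) : qhom X Y :=
  exist _ (fun h => ofK h =~ f) (ex_intro _ f erefl).

Lemma ofK_toK (X Y : C) (f : hom X Y) : ofK (toK f) =~ f.
Proof. by apply: toK_inj; exact: toK_ofK. Qed.

Lemma clsE (X Y : C) (f g : hom X Y) : cls f = cls g <-> f =~ g.
Proof.
split=> [/(congr1 sval)/= E|E].
  have : ofK (toK f) =~ g by have := congr1 (@^~ (toK f)) E => /= <-; exact: ofK_toK.
  exact: heq_trans (heq_sym (ofK_toK f)).
apply: eq_exist; apply/predeqP => h; split=> H; first exact: heq_trans H E.
exact: heq_trans H (heq_sym E).
Qed.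

Lemma cls_surj (X Y : C) (x : qhom X Y) : exists f, x = cls f.
Proof. by case: x => S HS; case: (HS) => f Ef; exists f; exact: eq_exist. Qed.

Definition qrep (X Y : C) (x : qhom X Y) : hom X Y := sval (cid (cls_surj x)).
Lemma qrepK (X Y : C) (x : qhom X Y) : cls (qrep x) = x.
Proof. by rewrite /qrep; case: cid. Qed.
Lemma qrep_cls (X Y : C) (f : hom X Y) : qrep (cls f) =~ f.
Proof. by apply/clsE; rewrite qrepK. Qed.

Section QhomZmod.
Variables X Y : C.
Definition qadd (x y : qhom X Y) := cls (hadd P (qrep x) (qrep y)).
Definition qopp (x : qhom X Y) := cls (hopp P (qrep x)).
Definition qzero := cls (hzero P X Y).
Lemma cls_qadd f g : cls (hadd P f g) = qadd (cls f) (cls g).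
Proof. by apply/clsE/heq_sym; apply: hadd_heq; exact: qrep_cls. Qed.
Lemma qaddA : associative qadd.
Proof.
move=> x y z; rewrite -(qrepK x) -(qrepK y) -(qrepK z) -!cls_qadd.
by apply/clsE; exact: haddA.
Qed.
Lemma qaddC : commutative qadd.
Proof. by move=> x y; apply/clsE; exact: haddC. Qed.
Lemma qadd0 : left_id qzero qadd.
Proof. by move=> x; rewrite -(qrepK x) -cls_qadd; apply/clsE; exact: hadd0. Qed.
Lemma qaddN : left_inverse qzero qopp qadd.
Proof.
by move=> x; rewrite -{2}(qrepK x) -cls_qadd; apply/clsE; exact: haddN.
Qed.
HB.instance Definition _ :=
  GRing.isZmodule.Build (qhom X Y) qaddA qaddC qadd0 qaddN.
End QhomZmod.

Lemma clsD (X Y : C) (f g : hom X Y) : cls (hadd P f g) = cls f + cls g.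
Proof. exact: cls_qadd. Qed.
Lemma cls0 (X Y : C) : cls (hzero P X Y) = 0. Proof. by []. Qed.
Lemma clsN (X Y : C) (f : hom X Y) : cls (hopp P f) = - cls f.
Proof.
apply/eqP; rewrite -addr_eq0; apply/eqP; rewrite -clsD -cls0.
by apply/clsE; exact: haddN.
Qed.

Definition qcomp (X Y Z : C) (g : qhom Y Z) (f : qhom X Y) : qhom X Z :=
  cls (qrep g \c qrep f).
Local Notation "g ** f" := (qcomp g f) (at level 40, left associativity).
Definition q1 (X : C) : qhom X X := cls (idm X).

Lemma clsM (X Y Z : C) (g : hom Y Z) (f : hom X Y) : cls (g \c f) = cls g ** cls f.
Proof. by apply/clsE/heq_sym; apply: cmp_heq; exact: qrep_cls. Qed.

Lemma cls_big (X Y : C) n (F : 'I_n -> hom X Y) :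
  cls (\big[@hadd _ P X Y/hzero P X Y]_(j < n) F j) = \sum_(j < n) cls (F j).
Proof. by apply: (big_morph (@cls X Y)) => // f g; exact: clsD. Qed.

Lemma qcompA (X Y Z T : C) (h : qhom Z T) (g : qhom Y Z) (f : qhom X Y) :
  h ** (g ** f) = h ** g ** f.
Proof.
by rewrite -(qrepK f) -(qrepK g) -(qrepK h) -!clsM; apply/clsE; exact: cmpA.
Qed.
Lemma qcomp1 (X Y : C) (f : qhom X Y) : q1 Y ** f = f.
Proof. by rewrite -(qrepK f) /q1 -clsM; apply/clsE; exact: cmp1m. Qed.
Lemma q1comp (X Y : C) (f : qhom X Y) : f ** q1 X = f.
Proof. by rewrite -(qrepK f) /q1 -clsM; apply/clsE; exact: cmpm1. Qed.
Lemma qcompDl (X Y Z : C) (g g' : qhom Y Z) (f : qhom X Y) :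
  (g + g') ** f = g ** f + g' ** f.
Proof.
rewrite -(qrepK f) -(qrepK g) -(qrepK g') -clsD -!clsM -clsD.
by apply/clsE; exact: cmpDl.
Qed.
Lemma qcompDr (X Y Z : C) (g : qhom Y Z) (f f' : qhom X Y) :
  g ** (f + f') = g ** f + g ** f'.
Proof.
rewrite -(qrepK f) -(qrepK g) -(qrepK f') -clsD -!clsM -clsD.
by apply/clsE; exact: cmpDr.
Qed.
Lemma qcomp0l (X Y Z : C) (f : qhom X Y) : (0 : qhom Y Z) ** f = 0.
Proof. by apply: (addrI (0 ** f)); rewrite -qcompDl !addr0. Qed.
Lemma qcomp0r (X Y Z : C) (g : qhom Y Z) : g ** (0 : qhom X Y) = 0.
Proof. by apply: (addrI (g ** 0)); rewrite -qcompDr !addr0. Qed.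
Lemma qcompNl (X Y Z : C) (g : qhom Y Z) (f : qhom X Y) : (- g) ** f = - (g ** f).
Proof. by apply: (addrI (g ** f)); rewrite -qcompDl !subrr qcomp0l. Qed.
Lemma qcompNr (X Y Z : C) (g : qhom Y Z) (f : qhom X Y) : g ** (- f) = - (g ** f).
Proof. by apply: (addrI (g ** f)); rewrite -qcompDr !subrr qcomp0r. Qed.
Lemma qcompBl (X Y Z : C) (g g' : qhom Y Z) (f : qhom X Y) :
  (g - g') ** f = g ** f - g' ** f.
Proof. by rewrite qcompDl qcompNl. Qed.
Lemma qcompBr (X Y Z : C) (g : qhom Y Z) (f f' : qhom X Y) :
  g ** (f - f') = g ** f - g ** f'.
Proof. by rewrite qcompDr qcompNr. Qed.
Lemma qcomp_sumr (X Y Z : C) (g : qhom Y Z) (J : Type) (r : seq J)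
    (F : J -> qhom X Y) : g ** (\sum_(j <- r) F j) = \sum_(j <- r) g ** F j.
Proof. exact: (big_morph (qcomp g) (qcompDr g) (qcomp0r _ g)). Qed.
Lemma qcomp_suml (X Y Z : C) (f : qhom X Y) (J : Type) (r : seq J)
    (G : J -> qhom Y Z) : (\sum_(j <- r) G j) ** f = \sum_(j <- r) G j ** f.
Proof.
exact: (big_morph (fun g => g ** f) (fun g g' => qcompDl g g' f) (qcomp0l _ f)).
Qed.

Definition qiso (X Y : C) (x : qhom X Y) := exists y, y ** x = q1 X /\ x ** y = q1 Y.

Lemma qisoP (X Y : C) (f : hom X Y) : is_iso f <-> qiso (cls f).
Proof.
split=> [[g [/clsE E1 /clsE E2]]|[y [E1 E2]]].
  by exists (cls g); rewrite -!clsM.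
by exists (qrep y); split; apply/clsE; rewrite clsM qrepK.
Qed.

Lemma qiso1 X : qiso (q1 X).
Proof. by exists (q1 X); rewrite qcomp1. Qed.

Lemma qiso_inv (X Y : C) (x : qhom X Y) y :
  y ** x = q1 X -> x ** y = q1 Y -> qiso y.
Proof. by move=> E1 E2; exists x. Qed.

Lemma qiso_comp (X Y Z : C) (g : qhom Y Z) (f : qhom X Y) :
  qiso g -> qiso f -> qiso (g ** f).
Proof.
move=> [g' [E1 E2]] [f' [E3 E4]]; exists (f' ** g'); split.
  by rewrite -qcompA (qcompA g') E1 qcomp1.
by rewrite -qcompA (qcompA f) E4 qcomp1.
Qed.

Lemma zero_object_cls (Z : C) : q1 Z = 0 -> is_zero_object Z.
Proof.
move=> E; split=> Y; exists (hzero P _ _) => g; apply/clsE; rewrite cls0.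
  by rewrite -[cls g]q1comp E qcomp0r.
by rewrite -[cls g]qcomp1 E qcomp0l.
Qed.

Lemma zero_object_1 (Z : C) : is_zero_object Z -> q1 Z = 0.
Proof.
move=> [/(_ Z)[f Hf] _]; rewrite /q1 -cls0; apply/clsE.
exact: heq_trans (Hf _) (heq_sym (Hf _)).
Qed.

Notation Sh := (DIIc_shift A).

Definition qmap (X Y : C) (x : qhom X Y) : qhom (Sh X) (Sh Y) :=
  cls (fmap Sh (qrep x)).
Lemma cls_fmap (X Y : C) (f : hom X Y) : cls (fmap Sh f) = qmap (cls f).
Proof. by apply/clsE/heq_sym; apply: fmap_heq; exact: qrep_cls. Qed.
Lemma qmapM (X Y Z : C) (g : qhom Y Z) (f : qhom X Y) :
  qmap (g ** f) = qmap g ** qmap f.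
Proof.
rewrite -(qrepK f) -(qrepK g) -clsM -!cls_fmap -clsM.
by apply/clsE; exact: fmap_cmp.
Qed.
Lemma qmap1 X : qmap (q1 X) = q1 (Sh X).
Proof. by rewrite -cls_fmap; apply/clsE; exact: fmap_id. Qed.
Lemma qiso_map (X Y : C) (x : qhom X Y) : qiso x -> qiso (qmap x).
Proof.
by move=> [y [E1 E2]]; exists (qmap y); rewrite -!qmapM E1 E2 !qmap1.
Qed.

(** The window of the long exact sequences of Hom(W, -) that the five lemma consumes. It makes sense
    before triangles are known to be closed under rotation. *)
Record exact_tri (X Y Z : C) (u : qhom X Y) (v : qhom Y Z) (w : qhom Z (Sh X)) :
    Prop := ExactTri {
  et_vu : v ** u = 0;
  et_wv : w ** v = 0;
  et_uw : qmap u ** w = 0;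
  et_Y : forall W (h : qhom W Y), v ** h = 0 -> exists g, u ** g = h;
  et_Z : forall W (h : qhom W Z), w ** h = 0 -> exists g, v ** g = h;
  et_SX : forall W (h : qhom W (Sh X)), qmap u ** h = 0 -> exists g, w ** g = h
}.

Lemma exact_tri_iso (X Y Z X' Y' Z' : C)
    (u : qhom X Y) (v : qhom Y Z) (w : qhom Z (Sh X))
    (u' : qhom X' Y') (v' : qhom Y' Z') (w' : qhom Z' (Sh X'))
    (a : qhom X X') (b : qhom Y Y') (c : qhom Z Z') :
  qiso a -> qiso b -> qiso c ->
  b ** u = u' ** a -> c ** v = v' ** b -> qmap a ** w = w' ** c ->
  exact_tri u' v' w' -> exact_tri u v w.
Proof.
move=> [a' [a'a aa']] [b' [b'b bb']] [c' [c'c cc']] Eu Ev Ew [H1 H2 H3 H4 H5 H6].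
have sa'a : qmap a' ** qmap a = q1 _ by rewrite -qmapM a'a qmap1.
have saa' : qmap a ** qmap a' = q1 _ by rewrite -qmapM aa' qmap1.
have sb'b : qmap b' ** qmap b = q1 _ by rewrite -qmapM b'b qmap1.
have Eu' : u = b' ** u' ** a by rewrite -qcompA -Eu qcompA b'b qcomp1.
have Ev' : v = c' ** v' ** b by rewrite -qcompA -Ev qcompA c'c qcomp1.
have Ew' : w = qmap a' ** w' ** c by rewrite -qcompA -Ew qcompA sa'a qcomp1.
split.
- rewrite Ev' -qcompA Eu; rewrite -!qcompA (qcompA v') H1 qcomp0l qcomp0r //.
- rewrite Ew' -qcompA Ev; rewrite -!qcompA (qcompA w') H2 qcomp0l qcomp0r //.
- rewrite Eu' !qmapM Ew' -!qcompA (qcompA (qmap a)) saa' qcomp1.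
  by rewrite (qcompA (qmap u')) H3 qcomp0l qcomp0r.
- move=> W h Hh; have [|g Hg] := H4 W (b ** h).
    by rewrite qcompA -Ev -qcompA Hh qcomp0r.
  exists (a' ** g); rewrite Eu' -!qcompA (qcompA a) aa' qcomp1 Hg.
  by rewrite qcompA b'b qcomp1.
- move=> W h Hh; have [|g Hg] := H5 W (c ** h).
    by rewrite qcompA -Ew -qcompA Hh qcomp0r.
  exists (b' ** g); rewrite Ev' -!qcompA (qcompA b) bb' qcomp1 Hg.
  by rewrite qcompA c'c qcomp1.
- move=> W h Hh; have [|g Hg] := H6 W (qmap a ** h).
    by rewrite qcompA -qmapM -Eu qmapM -qcompA Hh qcomp0r.
  exists (c' ** g); rewrite Ew' -!qcompA (qcompA c) cc' qcomp1 Hg.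
  by rewrite qcompA sa'a qcomp1.
Qed.

(** A chase shows that composing with [c] is injective, and a second one, applied to the identity of
    [Z'], gives a right inverse [s]. Since c (s c - 1) = 0, injectivity makes [s] a two-sided
    inverse. *)
Lemma exact_tri_five (X Y Z X' Y' Z' : C)
    (u : qhom X Y) (v : qhom Y Z) (w : qhom Z (Sh X))
    (u' : qhom X' Y') (v' : qhom Y' Z') (w' : qhom Z' (Sh X'))
    (a : qhom X X') (b : qhom Y Y') (c : qhom Z Z') :
  exact_tri u v w -> exact_tri u' v' w' -> qiso a -> qiso b ->
  b ** u = u' ** a -> c ** v = v' ** b -> qmap a ** w = w' ** c -> qiso c.
Proof.
move=> T T' [a' [a'a aa']] [b' [b'b bb']] Eu Ev Ew.
have sa'a : qmap a' ** qmap a = q1 _ by rewrite -qmapM a'a qmap1.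
have saa' : qmap a ** qmap a' = q1 _ by rewrite -qmapM aa' qmap1.
have sb'b : qmap b' ** qmap b = q1 _ by rewrite -qmapM b'b qmap1.
have inj W (h : qhom W Z) : c ** h = 0 -> h = 0.
  move=> ch; have wh : w ** h = 0.
    rewrite -[w]qcomp1 -sa'a -!qcompA (qcompA (qmap a)) Ew -qcompA ch.
    by rewrite !qcomp0r.
  have [g Hg] := et_Z T wh.
  have [l Hl] : exists l, u' ** l = b ** g.
    by apply: (et_Y T'); rewrite qcompA -Ev -qcompA Hg.
  have {}Hl : u ** (a' ** l) = g.
    rewrite -[LHS]qcomp1 -b'b -!qcompA (qcompA b) Eu -qcompA (qcompA a) aa' qcomp1.
    by rewrite Hl qcompA b'b qcomp1.
  by rewrite -Hg -Hl qcompA (et_vu T) qcomp0l.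
have [s Hs] : exists s, c ** s = q1 Z'.
  have [g Hg] : exists g, w ** g = qmap a' ** w'.
    apply: (et_SX T); rewrite -[LHS]qcomp1 -sb'b -qcompA.
    have -> : qmap b ** (qmap u ** (qmap a' ** w')) = 0; last by rewrite qcomp0r.
    rewrite qcompA -qmapM Eu qmapM -qcompA (qcompA (qmap a)) saa' qcomp1.
    exact: et_uw T'.
  have [l Hl] : exists l, v' ** l = q1 Z' - c ** g.
    apply: (et_Z T'); rewrite qcompBr q1comp qcompA -Ew -qcompA Hg.
    by rewrite qcompA saa' qcomp1 subrr.
  exists (g + v ** (b' ** l)); rewrite qcompDr [X in _ + X]qcompA Ev -qcompA.
  by rewrite (qcompA b) bb' qcomp1 Hl addrC subrK.
exists s; split=> //; apply/eqP; rewrite -subr_eq0; apply/eqP; apply: inj.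
by rewrite qcompBr qcompA Hs qcomp1 q1comp subrr.
Qed.
End HomClasses.

Local Notation "g ** f" := (qcomp g f) (at level 40, left associativity).

(** * Distinguished triangles *)

Section Triangulation.
Variables (k : fieldType) (A : dgAlg k).
Notation D := (DIIc A).
Notation P := (Dpreadd A).
Notation Sh := (DIIc_shift A).
Implicit Types X Y Z W : dgMod A.

Definition cg X Y (f : dghom X Y) : qhom (X : D) (Y : D) := cls (gam f).

Lemma cgM X Y Z (g : dghom Y Z) (f : dghom X Y) : cg (dg_comp g f) = cg g ** cg f.
Proof. by rewrite /cg -clsM; apply/clsE; exact: gam_comp. Qed.
Lemma cg1 X : cg (dg_id X) = q1 (X : D).
Proof. by apply/clsE; exact: gam_id. Qed.
Lemma cgD X Y (f g : dghom X Y) : cg (dgD f g) = cg f + cg g.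
Proof. by rewrite -clsD; apply/clsE; exact: gamD. Qed.
Lemma cg0 X Y : cg (dg0 X Y) = 0.
Proof. by rewrite -cls0; apply/clsE; exact: gam0. Qed.
Lemma cgN X Y (f : dghom X Y) : cg (dgN f) = - cg f.
Proof. by rewrite -clsN; apply/clsE; exact: gamN. Qed.
Lemma cg_hmt X Y (f g : dghom X Y) : hmt f g -> cg f = cg g.
Proof. by move=> H; apply/clsE; exact: gam_hmt. Qed.
Lemma cg_eq1 X Y (f g : dghom X Y) : f =1 g -> cg f = cg g.
Proof. by move=> H; apply: cg_hmt; exact: hmt_eq1. Qed.
Lemma cg_null X Y (f : dghom X Y) : nullh (M := X) (N := Y) f -> cg f = 0.
Proof. by move=> H; rewrite -cg0; apply: cg_hmt; exact/hmt0P. Qed.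
Lemma cg_inj X Y (f g : dghom X Y) : kproj X -> cg f = cg g -> hmt f g.
Proof. by move=> HX /clsE; exact: gam_faithful. Qed.
Lemma cg_null_inv X Y (f : dghom X Y) :
  kproj X -> cg f = 0 -> nullh (M := X) (N := Y) f.
Proof. by move=> HX; rewrite -cg0 => /(cg_inj HX)/hmt0P. Qed.
Lemma cg_full X Y (x : qhom (X : D) (Y : D)) : kproj X ->
  exists f : dghom X Y, x = cg f.
Proof.
move=> HX; have [f ->] := cls_surj x; have [g Hg] := gam_full HX f.
by exists g; exact/clsE.
Qed.
Lemma cg_iso X Y (w : dghom X Y) : weqII (X := X) (Y := Y) w -> qiso (cg w).
Proof. by move=> /gam_iso/qisoP. Qed.
Lemma qmap_cg X Y (f : dghom X Y) : qmap (cg f) = cg (shift_map f).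
Proof. by rewrite /cg -cls_fmap; apply/clsE; exact: heq_refl. Qed.

Lemma res_iso X : exists (p : qhom (res X : D) (X : D)) (p' : qhom (X : D) (res X : D)),
  [/\ p = cg (res_map X), p' ** p = q1 (res X : D) & p ** p' = q1 (X : D)].
Proof.
by have [p' [E1 E2]] := cg_iso (@res_weq _ _ X); exists (cg (res_map X)), p'.
Qed.

(** Reduces statements about morphisms out of any X to homotopy classes of strict maps out of
    [res X]. *)
Lemma res_factor X : exists (p : qhom (res X : D) (X : D)) (p' : qhom (X : D) (res X : D)),
  [/\ p' ** p = q1 (res X : D), p ** p' = q1 (X : D) &
      forall Y (x : qhom (X : D) (Y : D)), exists f : dghom (res X) Y,
        x ** p = cg f /\ x = cg f ** p'].
Proof.
have [p [p' [_ E1 E2]]] := res_iso X; exists p, p'; split=> // Y x.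
have [f Hf] := cg_full (x ** p) (@res_kproj _ _ X).
by exists f; rewrite -Hf -qcompA E2 q1comp.
Qed.

Lemma qmap_inj X Y (x y : qhom (X : D) (Y : D)) : qmap x = qmap y -> x = y.
Proof.
have [p [p' [E1 E2 F]]] := res_factor X.
have [f [Ef ->]] := F _ x; have [g [Eg ->]] := F _ y => H.
congr (_ ** _); apply: cg_hmt.
have : cg (shift_map f) = cg (shift_map g).
  have := congr1 (fun z => z ** qmap p) H; rewrite -!qmapM -!qcompA E1 !q1comp.
  by rewrite !qmap_cg.
move=> /(cg_inj (kproj_shift (@res_kproj _ _ X))) Hn.
by apply/nullh_shift2; exact: Hn.
Qed.

Lemma qmap_surj X Y (z : qhom (shift X : D) (shift Y : D)) :
  exists x : qhom (X : D) (Y : D), qmap x = z.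
Proof.
have [p [p' [E1 E2 F]]] := res_factor X.
have [h Eh] := cg_full (z ** qmap p) (kproj_shift (@res_kproj _ _ X)).
have /chain_shift2 Hh := chain_dg h.
exists (cg (dg_of Hh) ** p'); rewrite qmapM qmap_cg.
have -> : cg (shift_map (dg_of Hh)) = cg h by exact: cg_eq1.
by rewrite -Eh -qcompA -qmapM E2 qmap1 q1comp.
Qed.

Lemma qmap_iso_inv X Y (x : qhom (X : D) (Y : D)) : qiso (qmap x) -> qiso x.
Proof.
move=> [y [E1 E2]]; have [y' Ey] := qmap_surj y; exists y'.
by split; apply: qmap_inj; rewrite qmapM qmap1 Ey.
Qed.

Lemma qmapD X Y (x y : qhom (X : D) (Y : D)) : qmap (x + y) = qmap x + qmap y.
Proof.
have [p [p' [E1 E2 F]]] := res_factor X.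
have [f [_ ->]] := F _ x; have [g [_ ->]] := F _ y.
rewrite -qcompDl -cgD !qmapM !qmap_cg -qcompDl -cgD; congr (_ ** _).
exact: cg_eq1.
Qed.

Lemma qmap0 X Y : qmap (0 : qhom (X : D) (Y : D)) = 0.
Proof. by apply: (addrI (qmap 0)); rewrite -qmapD !addr0. Qed.

Section Standard.
Variables (M N : dgMod A) (f : dghom M N).

(** After W is replaced by its resolution, vanishing in the localization means being null homotopic,
    and the cone lemmas apply. *)
Lemma std_exact : exact_tri (cg f) (cg (cone_inj f)) (cg (cone_proj f)).
Proof.
split; rewrite ?qmap_cg -?cgM.
- apply: cg_null; exact: cone_inj_comp.
- by rewrite -cg0; exact: cg_eq1.
- apply: cg_null; exact: cone_proj_comp.
- move=> W h Hh; have [p [p' [E1 E2 F]]] := res_factor W.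
  have [h0 [Eh0 ->]] := F _ h; have [|g Hg] := @cone_exact1 _ _ _ _ f (res W) h0.
    apply: (@cg_null_inv _ _ (dg_comp _ h0)); first exact: res_kproj.
    by rewrite cgM -Eh0 qcompA Hh qcomp0l.
  by exists (cg g ** p'); rewrite qcompA -cgM; congr (_ ** _); exact: cg_hmt.
- move=> W h Hh; have [p [p' [E1 E2 F]]] := res_factor W.
  have [h0 [Eh0 ->]] := F _ h; have [|g Hg] := @cone_exact2 _ _ _ _ f (res W) h0.
    apply: (@cg_null_inv _ _ (dg_comp _ h0)); first exact: res_kproj.
    by rewrite cgM -Eh0 qcompA Hh qcomp0l.
  by exists (cg g ** p'); rewrite qcompA -cgM; congr (_ ** _); exact: cg_hmt.
- move=> W h Hh; have [p [p' [E1 E2 F]]] := res_factor W.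
  have [h0 [Eh0 ->]] := F _ h; have [|g Hg] := @cone_exact3 _ _ _ _ f (res W) h0.
    apply: (@cg_null_inv _ _ (dg_comp _ h0)); first exact: res_kproj.
    by rewrite cgM -Eh0 qcompA Hh qcomp0l.
  by exists (cg g ** p'); rewrite qcompA -cgM; congr (_ ** _); exact: cg_eq1.
Qed.
End Standard.

Definition qdist X Y Z (u : qhom (X : D) (Y : D)) (v : qhom (Y : D) (Z : D))
    (w : qhom (Z : D) (shift X : D)) :=
  exists (M N : dgMod A) (f : dghom M N) (a : qhom (X : D) (M : D))
    (b : qhom (Y : D) (N : D)) (c : qhom (Z : D) (cone f : D)),
    [/\ qiso a, qiso b & qiso c] /\
    [/\ b ** u = cg f ** a, c ** v = cg (cone_inj f) ** b &
        qmap a ** w = cg (cone_proj f) ** c].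

Lemma qdistP X Y Z (u : hom (X : D) (Y : D)) v w :
  @DIIc_dist k A X Y Z u v w <-> @qdist X Y Z (cls u) (cls v) (cls w).
Proof.
split=> [[M [N [f [a [b [c [[Ia Ib Ic] [/clsE Eu /clsE Ev /clsE Ew]]]]]]]]|].
  exists M, N, f, (cls a), (cls b), (cls c); split; first by split; exact/qisoP.
  by split; [rewrite -clsM Eu clsM|rewrite -clsM Ev clsM|rewrite -cls_fmap -clsM Ew clsM].
move=> [M [N [f [a [b [c [[Ia Ib Ic] [Eu Ev Ew]]]]]]]].
exists M, N, f, (qrep a), (qrep b), (qrep c); split.
  by split; apply/qisoP; rewrite qrepK.
split; apply/clsE; rewrite !clsM ?cls_fmap !qrepK; [exact: Eu|exact: Ev|exact: Ew].
Qed.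

Lemma qdist_std M N (f : dghom M N) : qdist (cg f) (cg (cone_inj f)) (cg (cone_proj f)).
Proof.
exists M, N, f, (q1 (M : D)), (q1 (N : D)), (q1 (cone f : D)).
split; first by split; exact: qiso1.
by rewrite !qcomp1 !q1comp qmap1 qcomp1.
Qed.

Lemma qdist_iso X Y Z X' Y' Z'
    (u : qhom (X : D) (Y : D)) (v : qhom (Y : D) (Z : D))
    (w : qhom (Z : D) (shift X : D))
    (u' : qhom (X' : D) (Y' : D)) (v' : qhom (Y' : D) (Z' : D))
    (w' : qhom (Z' : D) (shift X' : D))
    (a : qhom (X : D) (X' : D)) (b : qhom (Y : D) (Y' : D)) (c : qhom (Z : D) (Z' : D)) :
  qiso a -> qiso b -> qiso c ->
  b ** u = u' ** a -> c ** v = v' ** b -> qmap a ** w = w' ** c ->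
  qdist u' v' w' -> qdist u v w.
Proof.
move=> Ia Ib Ic Eu Ev Ew [M [N [f [a' [b' [c' [[Ia' Ib' Ic'] [Eu' Ev' Ew']]]]]]]].
exists M, N, f, (a' ** a), (b' ** b), (c' ** c); split.
  by split; exact: qiso_comp.
split.
- by rewrite -qcompA Eu !qcompA Eu'.
- by rewrite -qcompA Ev !qcompA Ev'.
- by rewrite qmapM -qcompA Ew !qcompA Ew'.
Qed.

Lemma qdist_iso' X Y Z X' Y' Z'
    (u : qhom (X : D) (Y : D)) (v : qhom (Y : D) (Z : D))
    (w : qhom (Z : D) (shift X : D))
    (u' : qhom (X' : D) (Y' : D)) (v' : qhom (Y' : D) (Z' : D))
    (w' : qhom (Z' : D) (shift X' : D))
    (a : qhom (X : D) (X' : D)) (b : qhom (Y : D) (Y' : D)) (c : qhom (Z : D) (Z' : D)) :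
  qiso a -> qiso b -> qiso c ->
  b ** u = u' ** a -> c ** v = v' ** b -> qmap a ** w = w' ** c ->
  qdist u v w -> qdist u' v' w'.
Proof.
move=> [a' [E1 E2]] [b' [E3 E4]] [c' [E5 E6]] Eu Ev Ew.
apply: (@qdist_iso _ _ _ _ _ _ u' v' w' u v w a' b' c').
- exact: qiso_inv E1 E2.
- exact: qiso_inv E3 E4.
- exact: qiso_inv E5 E6.
- by rewrite -[u']q1comp -E2 (qcompA u') -Eu !qcompA E3 qcomp1.
- by rewrite -[v']q1comp -E4 (qcompA v') -Ev !qcompA E5 qcomp1.
- by rewrite -[w']q1comp -E6 (qcompA w') -Ew !qcompA -qmapM E1 qmap1 qcomp1.
Qed.

Lemma qdist_exact X Y Z (u : qhom (X : D) (Y : D)) (v : qhom (Y : D) (Z : D))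
    (w : qhom (Z : D) (shift X : D)) : qdist u v w -> exact_tri u v w.
Proof.
move=> [M [N [f [a [b [c [[Ia Ib Ic] [Eu Ev Ew]]]]]]]].
exact: exact_tri_iso Ia Ib Ic Eu Ev Ew (std_exact f).
Qed.

(** [u] need not come from a strict map X -> Y, so the cone is taken of its representative on the
    resolution of X. *)
Lemma qdist_cone X Y (u : qhom (X : D) (Y : D)) :
  exists (Z : dgMod A) (v : qhom (Y : D) (Z : D)) (w : qhom (Z : D) (shift X : D)),
    qdist u v w.
Proof.
have [p [p' [E1 E2 F]]] := res_factor X; have [f [Ef ->]] := F _ u.
exists (cone f), (cg (cone_inj f)), (qmap p ** cg (cone_proj f)).
exists (res X), Y, f, p', (q1 (Y : D)), (q1 (cone f : D)); split.
  by split; [exists p | exact: qiso1 | exact: qiso1].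
split; rewrite ?qcomp1 ?q1comp // qcompA -qmapM E1 qmap1 qcomp1.
by [].
Qed.

(** The strict map defining the triangle is lifted to the resolutions of its ends; the induced map
    of cones is an isomorphism by the five lemma. *)
Lemma qdist_kproj X Y Z (u : qhom (X : D) (Y : D)) (v : qhom (Y : D) (Z : D))
    (w : qhom (Z : D) (shift X : D)) : qdist u v w ->
  exists (M N : dgMod A) (f : dghom M N) (a : qhom (X : D) (M : D))
    (b : qhom (Y : D) (N : D)) (c : qhom (Z : D) (cone f : D)),
    [/\ kproj M, kproj N, qiso a, qiso b & qiso c] /\
    [/\ b ** u = cg f ** a, c ** v = cg (cone_inj f) ** b &
        qmap a ** w = cg (cone_proj f) ** c].
Proof.
move=> [M [N [f [a [b [c [[Ia Ib Ic] [Eu Ev Ew]]]]]]]].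
have [pM [pM' [EpM E1 E2]]] := res_iso M; have [pN [pN' [EpN E3 E4]]] := res_iso N.
have [f0 Hf0] := kproj_lift (dg_comp f (res_map M)) (@res_kproj _ _ M) (@res_weq _ _ N).
have [c0 [Ec1 Ec2]] := cone_map (f := f0) (f' := f) (a := res_map M) (b := res_map N) Hf0.
have Ef : pN ** cg f0 = cg f ** pM by rewrite EpN EpM -!cgM; exact: cg_hmt.
have Einj : cg c0 ** cg (cone_inj f0) = cg (cone_inj f) ** pN.
  by rewrite EpN -!cgM; exact: cg_eq1.
have Eproj : qmap pM ** cg (cone_proj f0) = cg (cone_proj f) ** cg c0.
  by rewrite EpM qmap_cg -!cgM; apply: cg_eq1 => p; rewrite /= -Ec2.
have Ic0 : qiso (cg c0).
  apply: (exact_tri_five (std_exact f0) (std_exact f) _ _ Ef Einj Eproj).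
    by exists pM'.
  by exists pN'.
have [c0' [E5 E6]] := Ic0.
have IpM' : qiso pM' by exists pM.
have IpN' : qiso pN' by exists pN.
have Ic0' : qiso c0' by exists (cg c0).
exists (res M), (res N), f0, (pM' ** a), (pN' ** b), (c0' ** c); split.
  by split; [exact: res_kproj|exact: res_kproj|exact: qiso_comp|exact: qiso_comp|
    exact: qiso_comp].
split.
- rewrite -qcompA Eu !qcompA; congr (_ ** _).
  by rewrite -[cg f0]qcomp1 -E3 -!qcompA (qcompA pN) Ef -qcompA E2 q1comp.
- rewrite -qcompA Ev !qcompA; congr (_ ** _).
  by rewrite -[cg (cone_inj f0)]qcomp1 -E5 -!qcompA (qcompA (cg c0)) Einj -qcompA E4 q1comp.
- rewrite qmapM -qcompA Ew !qcompA; congr (_ ** _).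
  rewrite -[cg (cone_proj f0)]qcomp1 -(qmap1 (res M : D)) -E1 qmapM -!qcompA.
  by rewrite (qcompA (qmap pM)) Eproj -qcompA E6 q1comp.
Qed.

(** Once the first triangle has a K-projective model, [a] and [b] have strict representatives and
    their square commutes up to a homotopy, from which [cone_map] builds the third map. *)
Lemma qdist_morphism X Y Z X' Y' Z'
    (u : qhom (X : D) (Y : D)) (v : qhom (Y : D) (Z : D))
    (w : qhom (Z : D) (shift X : D))
    (u' : qhom (X' : D) (Y' : D)) (v' : qhom (Y' : D) (Z' : D))
    (w' : qhom (Z' : D) (shift X' : D))
    (a : qhom (X : D) (X' : D)) (b : qhom (Y : D) (Y' : D)) :
  qdist u v w -> qdist u' v' w' -> b ** u = u' ** a ->
  exists c : qhom (Z : D) (Z' : D), c ** v = v' ** b /\ qmap a ** w = w' ** c.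
Proof.
move=> /qdist_kproj[M [N [f [al [be [ga [[KM KN Ial Ibe Iga] [Eu Ev Ew]]]]]]]].
move=> [M' [N' [f' [al' [be' [ga' [[Ial' Ibe' Iga'] [Eu' Ev' Ew']]]]]]]] E.
have [al1 [E1 E2]] := Ial; have [be1 [E3 E4]] := Ibe.
have [al2 [E5 E6]] := Ial'; have [ga2 [E7 E8]] := Iga'.
have [a0 Ha0] := cg_full (al' ** a ** al1) KM.
have [b0 Hb0] := cg_full (be' ** b ** be1) KN.
have Hn : nullh (M := M) (N := N') (fun x => b0 (f x) - f' (a0 x)).
  apply: (@cg_inj _ _ (dg_comp b0 f) (dg_comp f' a0) KM).
  rewrite !cgM -Ha0 -Hb0 !qcompA -Eu' -[cg f]q1comp -E2 (qcompA (cg f)) -Eu.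
  rewrite !qcompA; congr (_ ** _).
  by rewrite -(qcompA _ be1) E3 q1comp -!qcompA E.
have [c0 [Ec1 Ec2]] := cone_map Hn.
have Einj : cg c0 ** cg (cone_inj f) = cg (cone_inj f') ** cg b0.
  by rewrite -!cgM; exact: cg_eq1.
have Eproj : qmap (cg a0) ** cg (cone_proj f) = cg (cone_proj f') ** cg c0.
  by rewrite qmap_cg -!cgM; apply: cg_eq1 => p; rewrite /= -Ec2.
exists (ga2 ** cg c0 ** ga); split.
  rewrite -qcompA Ev qcompA -(qcompA ga2) Einj -Hb0 !qcompA.
  rewrite -(qcompA _ be1) E3 q1comp; congr (_ ** b).
  by rewrite -qcompA -Ev' qcompA E7 qcomp1.
rewrite !qcompA -[w']qcomp1 -(qmap1 (X' : D)) -E5 qmapM -!qcompA.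
rewrite (qcompA (qmap al')) Ew' -!qcompA (qcompA ga') E8 qcomp1.
rewrite (qcompA (cg _)) -Eproj -Ha0 !qmapM -!qcompA -Ew.
rewrite (qcompA (qmap al1)) -qmapM E1 qmap1 qcomp1.
by rewrite qcompA -qmapM E5 qmap1 qcomp1.
Qed.

Lemma qdist_rotate X Y Z (u : qhom (X : D) (Y : D)) (v : qhom (Y : D) (Z : D))
    (w : qhom (Z : D) (shift X : D)) : qdist u v w -> qdist v w (- qmap u).
Proof.
move=> [M [N [f [a [b [c [[Ia Ib Ic] [Eu Ev Ew]]]]]]]].
have [p [t [pt tp Ep Et]]] := cone_rotate f.
have It : qiso (cg t).
  exists (cg p); rewrite -!cgM; split; rewrite -cg1; first exact: cg_eq1.
  exact: cg_hmt.
exists N, (cone f), (cone_inj f), b, c, (cg t ** qmap a); split.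
  by split=> //; apply: qiso_comp => //; exact: qiso_map.
split=> //.
  rewrite -qcompA Ew qcompA; congr (_ ** _); rewrite -cgM; apply: cg_hmt.
  apply: nullh_ext (nullh_compr (cone_inj (cone_inj f)) tp) => x.
  by rewrite /= -Ep.
rewrite qcompNr -qmapM Eu qmapM qmap_cg -qcompNl qcompA; congr (_ ** _).
rewrite -cgN -cgM; apply: cg_eq1 => x /=.
by rewrite Et.
Qed.

Lemma qdist_third_iso X Y Z X' Y' Z'
    (u : qhom (X : D) (Y : D)) (v : qhom (Y : D) (Z : D))
    (w : qhom (Z : D) (shift X : D))
    (u' : qhom (X' : D) (Y' : D)) (v' : qhom (Y' : D) (Z' : D))
    (w' : qhom (Z' : D) (shift X' : D))
    (a : qhom (X : D) (X' : D)) (b : qhom (Y : D) (Y' : D)) :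
  qdist u v w -> qdist u' v' w' -> qiso a -> qiso b -> b ** u = u' ** a ->
  exists c : qhom (Z : D) (Z' : D),
    [/\ qiso c, c ** v = v' ** b & qmap a ** w = w' ** c].
Proof.
move=> T T' Ia Ib E; have [c [E1 E2]] := qdist_morphism T T' E.
exists c; split=> //.
exact: exact_tri_five (qdist_exact T) (qdist_exact T') Ia Ib E E1 E2.
Qed.

(** [u] is completed to some triangle. Rotated three times, it begins with [- qmap u], as does the
    given triangle rotated twice more. The resulting isomorphism of third terms lies between shifts
    and is unshifted. *)
Lemma qdist_unrotate X Y Z (u : qhom (X : D) (Y : D)) (v : qhom (Y : D) (Z : D))
    (w : qhom (Z : D) (shift X : D)) : qdist v w (- qmap u) -> qdist u v w.
Proof.
move=> T; have [Z' [v' [w' T']]] := qdist_cone u.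
have T2 := qdist_rotate (qdist_rotate (qdist_rotate T')).
have T3 := qdist_rotate (qdist_rotate T).
have [|c1 [Ic1 Ec1 Ec2]] := qdist_third_iso T2 T3 (qiso1 _) (qiso1 _).
  by rewrite qcomp1 q1comp.
have [c Ec] := qmap_surj c1.
have Ic : qiso c by apply: qmap_iso_inv; rewrite Ec.
have Ev : c ** v' = v.
  apply: qmap_inj; apply: oppr_inj; rewrite qmapM Ec -qcompNr Ec1.
  by rewrite q1comp.
have Ew : w' = w ** c.
  apply: qmap_inj; apply: oppr_inj; rewrite qmapM Ec -qcompNl -Ec2.
  by rewrite qmap1 qcomp1.
apply: (qdist_iso' (qiso1 _) (qiso1 _) Ic _ _ _ T').
- by rewrite qcomp1 q1comp.
- by rewrite q1comp.
- by rewrite qmap1 qcomp1.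
Qed.

Lemma qdist_octahedron X Y Z X' Y' Z'
    (f : qhom (X : D) (Y : D)) (j : qhom (Y : D) (Z' : D))
    (kk : qhom (Z' : D) (shift X : D))
    (g : qhom (Y : D) (Z : D)) (l : qhom (Z : D) (X' : D))
    (i : qhom (X' : D) (shift Y : D))
    (m : qhom (Z : D) (Y' : D)) (n : qhom (Y' : D) (shift X : D)) :
  qdist f j kk -> qdist g l i -> qdist (g ** f) m n ->
  exists (u : qhom (Z' : D) (Y' : D)) (v : qhom (Y' : D) (X' : D)),
    qdist u v (qmap j ** i) /\
    [/\ kk = n ** u, l = v ** m, u ** j = m ** g & i ** v = qmap f ** n].
Proof.
move=> Tf Tg Tgf.
have [p [a [E1 E2 F]]] := res_factor X; have [q [b [E3 E4 G]]] := res_factor Y.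
(* Strict composable models: [f0] goes from [res X] to [res Y] and [g0] from [res Y] to Z, so
   [cone_octahedron] applies and is then transported along the isomorphisms of third terms. *)
have [f0 Ef0] := cg_full (b ** f ** p) (@res_kproj _ _ X).
have [g0 [Eg0 Eg1]] := G _ g.
have Ia : qiso a by exists p.
have Ib : qiso b by exists q.
have Ef : b ** f = cg f0 ** a by rewrite -Ef0 -!qcompA E2 q1comp.
have Egf : q1 (Z : D) ** (g ** f) = cg (dg_comp g0 f0) ** a.
  by rewrite qcomp1 cgM -qcompA -Ef qcompA -Eg1.
have Eg : q1 (Z : D) ** g = cg g0 ** b by rewrite qcomp1.
have [c1 [Ic1 Ec1j Ec1k]] := qdist_third_iso Tf (qdist_std f0) Ia Ib Ef.
have [c2 [Ic2 Ec2l Ec2i]] := qdist_third_iso Tg (qdist_std g0) Ib (qiso1 _) Eg.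
have [c3 [Ic3 Ec3m Ec3n]] :=
  qdist_third_iso Tgf (qdist_std (dg_comp g0 f0)) Ia (qiso1 _) Egf.
have [c1' [K1 L1]] := Ic1; have [c2' [K2 L2]] := Ic2; have [c3' [K3 L3]] := Ic3.
have [u0 [v0 [ps [t [[Pu Pv Pui Pvp] pt tp Ep Et]]]]] := cone_octahedron f0 g0.
have It : qiso (cg t).
  exists (cg ps); rewrite -!cgM; split; rewrite -cg1; first exact: cg_eq1.
  exact: cg_hmt.
have T0 : qdist (cg u0) (cg v0) (qmap (cg (cone_inj f0)) ** cg (cone_proj g0)).
  apply: (qdist_iso (qiso1 _) (qiso1 _) It _ _ _ (qdist_std u0)).
  - by rewrite qcomp1 q1comp.
  - rewrite q1comp -cgM; apply: cg_hmt.
    by apply: nullh_ext (nullh_compr (cone_inj u0) tp) => x; rewrite /= -Ep.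
  - rewrite qmap1 qcomp1 qmap_cg -!cgM; apply: cg_eq1 => x.
    exact: esym (Et x).
have Qu : cg (cone_proj (dg_comp g0 f0)) ** cg u0 = cg (cone_proj f0).
  by rewrite -cgM; exact: cg_eq1.
have Qv : cg v0 ** cg (cone_inj (dg_comp g0 f0)) = cg (cone_inj g0).
  by rewrite -cgM; exact: cg_eq1.
have Qui : cg u0 ** cg (cone_inj f0) = cg (cone_inj (dg_comp g0 f0)) ** cg g0.
  by rewrite -!cgM; exact: cg_eq1.
have Qvp : cg (cone_proj g0) ** cg v0 =
    qmap (cg f0) ** cg (cone_proj (dg_comp g0 f0)).
  by rewrite qmap_cg -!cgM; exact: cg_eq1.
rewrite q1comp in Ec2l; rewrite q1comp in Ec3m.
have Sa : qmap p ** qmap a = q1 _ by rewrite -qmapM E2 qmap1.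
have Sb : qmap q ** qmap b = q1 _ by rewrite -qmapM E4 qmap1.
exists (c3' ** cg u0 ** c1), (c2' ** cg v0 ** c3); split.
  apply: (qdist_iso Ic1 Ic3 Ic2 _ _ _ T0).
  - by rewrite !qcompA L3 qcomp1.
  - by rewrite !qcompA L2 qcomp1.
  - by rewrite qcompA -qmapM Ec1j qmapM -!qcompA Ec2i.
split.
- have -> : n = qmap p ** cg (cone_proj (dg_comp g0 f0)) ** c3.
    by rewrite -qcompA -Ec3n qcompA Sa qcomp1.
  rewrite -!qcompA (qcompA c3) L3 qcomp1 (qcompA (cg _)) Qu -Ec1k.
  by rewrite qcompA Sa qcomp1.
- by rewrite -qcompA Ec3m -qcompA Qv -Ec2l qcompA K2 qcomp1.
- rewrite -qcompA Ec1j qcompA -(qcompA c3') Qui -!qcompA -Eg1.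
  by rewrite -Ec3m !qcompA K3 qcomp1.
- have -> : i = qmap q ** cg (cone_proj g0) ** c2.
    by rewrite -qcompA -Ec2i qcompA Sb qcomp1.
  rewrite -!qcompA (qcompA c2) L2 qcomp1 (qcompA (cg _)) Qvp -!qcompA -Ec3n.
  rewrite (qcompA (qmap (cg f0))) -qmapM -Ef qmapM !qcompA Sb qcomp1.
  by [].
Qed.

End Triangulation.

(** * Additivity, invertibility of the shift and the triangulated structure *)

Section TriangulatedStructure.
Variables (k : fieldType) (A : dgAlg k).
Notation D := (DIIc A).
Notation P := (Dpreadd A).
Notation Sh := (DIIc_shift A).

Lemma zero_dg_zero : q1 (zero_dg A : D) = 0.
Proof. by rewrite -cg1 -cg0; apply: cg_eq1 => x; exact: zero_dg_eq. Qed.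

Lemma bsum_biproduct (X Y : dgMod A) :
  exists (i1 : qhom (X : D) (bsum X Y : D)) (i2 : qhom (Y : D) (bsum X Y : D))
    (p1 : qhom (bsum X Y : D) (X : D)) (p2 : qhom (bsum X Y : D) (Y : D)),
  [/\ p1 ** i1 = q1 (X : D), p2 ** i2 = q1 (Y : D), p1 ** i2 = 0, p2 ** i1 = 0 &
      i1 ** p1 + i2 ** p2 = q1 (bsum X Y : D)].
Proof.
have [i1 [i2 [p1 [p2 [E1 E2 E3 E4]]]]] := bsum_maps X Y.
exists (cg i1), (cg i2), (cg p1), (cg p2).
rewrite -!cgM -cgD -!cg1 -!cg0; split; apply: cg_eq1 => x /=.
- by rewrite E1 E3.
- by rewrite E2 E4.
- by rewrite E2 E3.
- by rewrite E1 E4.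
- rewrite E1 E2 E3 E4; case: x => y z.
  by apply: injective_projections => /=; rewrite ?addr0 ?add0r.
Qed.

Lemma qdist_id (X Z : dgMod A) : q1 (Z : D) = 0 ->
  qdist (q1 (X : D)) (0 : qhom (X : D) (Z : D)) (0 : qhom (Z : D) (shift X : D)).
Proof.
(* Z is zero, and so is the contractible cone of the identity; hence the zero morphism between them
   is invertible. *)
move=> Z0; exists X, X, (dg_id X), (q1 (X : D)), (q1 (X : D)), 0.
have C0 : q1 (cone (dg_id X) : D) = 0.
  by rewrite -cg1; apply: cg_null; exact: nullh_cone_id.
split.
  split; [exact: qiso1 | exact: qiso1 |].
  by exists 0; rewrite !qcomp0l Z0 C0.
split; first by rewrite cg1.
  by rewrite qcomp0r -[cg _ ** _]qcomp1 C0 qcomp0l.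
by rewrite !qcomp0r.
Qed.

Lemma shift_shiftz_iso (Y : dgMod A) : exists (f : dghom (shift (shiftz (-1) Y)) Y)
  (g : dghom Y (shift (shiftz (-1) Y))), cancel f g /\ cancel g f.
Proof.
have dE (y : Y) : dgm_d (shift (shiftz (-1) Y)) y = dgm_d Y y.
  by rewrite /= /shift_d /= /sgn /= expr1 scaleN1r opprK.
have Hf : chain (M := shift (shiftz (-1) Y)) (N := Y) id.
  split; last by move=> y; rewrite dE.
  by split=> // i m /=; rewrite addrK addr0.
have Hg : chain (M := Y) (N := shift (shiftz (-1) Y)) id.
  split; last by move=> y; rewrite -[RHS]dE.
  by split=> // i m /=; rewrite addrK addr0.
by exists (dg_of Hf), (dg_of Hg).
Qed.

Lemma dg_iso_qiso (X Y : dgMod A) (f : dghom X Y) (g : dghom Y X) :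
  cancel f g -> cancel g f -> qiso (cg f).
Proof. by move=> fK gK; exists (cg g); rewrite -!cgM -!cg1; split; exact: cg_eq1. Qed.

Lemma D_shift_equivalence : is_equivalence Sh.
Proof.
split=> [X Y|Y]; last first.
  exists (shiftz (-1) (Y : dgMod A)); have [f [g [fK gK]]] := shift_shiftz_iso Y.
  by exists (gam f); apply/qisoP; exact: dg_iso_qiso fK gK.
split=> [f g /clsE|h].
  by rewrite !cls_fmap => /qmap_inj/clsE.
have [x Ex] := qmap_surj (cls h); exists (qrep x).
by apply/clsE; rewrite cls_fmap qrepK.
Qed.

Lemma D_additive : is_additive P.
Proof.
split=> [|X Y].
  by exists (zero_dg A); apply: zero_object_cls; exact: zero_dg_zero.
have [i1 [i2 [p1 [p2 [E1 E2 E3 E4 E5]]]]] := bsum_biproduct X Y.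
exists (bsum X Y), (qrep i1), (qrep i2), (qrep p1), (qrep p2).
split; apply/clsE.
- by rewrite clsM !qrepK.
- by rewrite clsM !qrepK.
- by rewrite clsM !qrepK E3.
- by rewrite clsM !qrepK E4.
- by rewrite clsD !clsM !qrepK.
Qed.

Lemma D_triangulated : is_triangulated P (@DIIc_dist k A).
Proof.
split.
- exact: D_additive.
- move=> X Y f g; apply/clsE.
  by rewrite clsD !cls_fmap clsD qmapD.
- exact: D_shift_equivalence.
- move=> X Y Z X' Y' Z' f g h f' g' h' a b c /qisoP Ia /qisoP Ib /qisoP Ic.
  move=> /clsE E1 /clsE E2 /clsE E3 /qdistP T; apply/qdistP.
  rewrite !clsM ?cls_fmap in E1 E2 E3.
  exact: qdist_iso' Ia Ib Ic E1 E2 E3 T.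
- move=> X Z /zero_object_1 HZ; apply/qdistP; exact: qdist_id.
- move=> X Y f; have [Z [v [w T]]] := qdist_cone (cls f).
  by exists Z, (qrep v), (qrep w); apply/qdistP; rewrite !qrepK.
- move=> X Y Z f g h; split=> /qdistP T; apply/qdistP.
    by rewrite clsN cls_fmap; exact: qdist_rotate.
  by apply: qdist_unrotate; rewrite clsN cls_fmap in T.
- move=> X Y Z X' Y' Z' f g h f' g' h' a b /qdistP T /qdistP T' /clsE E.
  rewrite !clsM in E; have [c [E1 E2]] := qdist_morphism T T' E.
  exists (qrep c); split; apply/clsE; rewrite !clsM ?cls_fmap qrepK //.
- move=> X Y Z X' Y' Z' f j kk g l i m n /qdistP Tf /qdistP Tg /qdistP Tgf.
  rewrite clsM in Tgf; have [u [v [T [E1 E2 E3 E4]]]] := qdist_octahedron Tf Tg Tgf.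
  exists (qrep u), (qrep v); split.
    by apply/qdistP; rewrite clsM cls_fmap !qrepK.
  by split; apply/clsE; rewrite !clsM ?cls_fmap ?qrepK.
Qed.

End TriangulatedStructure.

(** * Coproducts and compact objects *)

Section Compactness.
Variables (k : fieldType) (A : dgAlg k).
Notation D := (DIIc A).
Notation P := (Dpreadd A).
Notation Sh := (DIIc_shift A).

Section DsumHom.
Variables (I : small) (M : I -> dgMod A).
Hypothesis HM : forall i, kproj (M i).

Lemma cg_pr_in_same i : cg (dg_pr M i) ** cg (dg_in M i) = q1 (M i : D).
Proof. by rewrite -cgM -cg1; apply: cg_eq1 => m; exact: din_same. Qed.

Lemma cg_pr_in_other i j : i <> j -> cg (dg_pr M j) ** cg (dg_in M i) = 0.
Proof. by move=> ne; rewrite -cgM -cg0; apply: cg_eq1 => m; exact: din_other. Qed.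

Lemma dsum_hom_ext (T : dgMod A) (x y : qhom (dsum M : D) (T : D)) :
  (forall i, x ** cg (dg_in M i) = y ** cg (dg_in M i)) -> x = y.
Proof.
have [f ->] := cg_full x (kproj_dsum HM); have [g ->] := cg_full y (kproj_dsum HM).
move=> H; apply: cg_hmt; apply: (nullh_dsum (F := fun s => f s - g s)).
  by apply: gmapB; exact: gmap_dg.
move=> i; have := H i; rewrite -!cgM => /(cg_inj (@HM i)).
exact.
Qed.

Lemma dsum_coproduct : is_coproduct (C := D) (fun i => gam (dg_in M i)).
Proof.
move=> T f; pose g i : dghom (M i) T := sval (cid (gam_full (@HM i) (f i))).
have Eg i : f i =~ gam (g i) by rewrite /g; case: cid.
have [F HF] := dg_lift g.
have EF i : gam F \c gam (dg_in M i) =~ f i.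
  apply: heq_trans (heq_sym (Eg i)); apply: heq_trans (heq_sym (gam_comp _ _)) _.
  by apply: gam_eq1 => m; exact: HF.
exists (gam F); split=> // v Hv; apply/clsE; apply: dsum_hom_ext => i.
rewrite /cg -!clsM; apply/clsE; apply: heq_trans (Hv i) _; exact: heq_sym.
Qed.
End DsumHom.

(** The coproduct is the direct sum of resolutions: on K-projective summands the universal property
    can be checked on strict maps. *)
Lemma D_coproducts : has_small_coproducts D.
Proof.
move=> I Y; pose M i := res (Y i : dgMod A).
have HM i : kproj (M i) by exact: res_kproj.
pose inv i : hom (Y i) (M i : D) := loc_inv (@res_weq _ _ (Y i)).
exists (dsum M), (fun i => gam (dg_in M i) \c inv i) => T f.
have [u [Hu Uu]] := dsum_coproduct HM (fun i => f i \c gam (res_map (Y i))).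
have invr i : gam (res_map (Y i)) \c inv i =~ idm (Y i).
  exact: (@loc_invr (dgModCat A) (@weqII k A)).
have invl i : inv i \c gam (res_map (Y i)) =~ idm (M i : D).
  exact: (@loc_invl (dgModCat A) (@weqII k A)).
exists u; split=> [i|v Hv].
  apply: heq_trans (cmpA _ _ _) _.
  apply: heq_trans (cmp_heq (Hu i) (heq_refl _)) _.
  apply: heq_trans (heq_sym (cmpA _ _ _)) _.
  exact: heq_trans (cmp_heq (heq_refl _) (invr i)) (cmpm1 _).
apply: Uu => i.
apply: heq_trans (cmp_heq (Hv i) (heq_refl _)).
apply: heq_sym; apply: heq_trans (heq_sym (cmpA _ _ _)) _.
apply: cmp_heq (heq_refl _) _; apply: heq_trans (heq_sym (cmpA _ _ _)) _.
exact: heq_trans (cmp_heq (heq_refl _) (invl i)) (cmpm1 _).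
Qed.

Lemma coproduct_projection (I : small) (Y : I -> D) (S : D)
    (inj : forall i, hom (Y i) S) : is_coproduct inj ->
  forall i, exists p : qhom S (Y i), p ** cls (inj i) = q1 (Y i) /\
    forall j, j <> i -> p ** cls (inj j) = 0.
Proof.
move=> HS i.
pose f j : hom (Y j) (Y i) := match pselect (j = i) with
  | left E => eq_rect j (fun l => hom (Y j) (Y l)) (idm (Y j)) i E
  | right _ => hzero P (Y j) (Y i) end.
have [u [Hu _]] := HS (Y i) f; exists (cls u); split=> [|j ne].
  rewrite -clsM; apply/clsE; apply: heq_trans (Hu i) _; rewrite /f.
  case: pselect => // E; rewrite (Prop_irrelevance E erefl); exact: heq_refl.
rewrite -clsM -cls0; apply/clsE; apply: heq_trans (Hu j) _; rewrite /f.
by case: pselect => // _; exact: heq_refl.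
Qed.

(* Injectivity of (+) Hom(X, Y i) -> Hom(X, S) is automatic. *)
Lemma compact_of_surj (X : D) :
  (forall (I : small) (Y : I -> D) (S : D) (inj : forall i, hom (Y i) S),
    is_coproduct inj -> forall h : qhom X S,
    exists (s : seq {classic I}) (f : forall i : {classic I}, qhom X (Y i)),
      uniq s /\ h = \sum_(i <- s) cls (inj i) ** f i) -> is_compact P X.
Proof.
move=> H I Y S inj HS; split=> [h|n e f inj_e E j].
  have [s [f [Us Eh]]] := H I Y S inj HS (cls h).
  have inj_s : injective (tnth (in_tuple s)) by apply/tuple_uniqP.
  exists (size s), (tnth (in_tuple s)), (fun j => qrep (f (tnth (in_tuple s) j))).
  split; first exact: inj_s.
  apply/clsE; rewrite Eh cls_big big_tnth; apply: eq_bigr => j _.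
  by rewrite clsM qrepK.
apply/clsE; move/clsE: E; rewrite cls_big cls0 => E.
have [p [Ep Eo]] := coproduct_projection HS (e j).
have := congr1 (fun x => p ** x) E; rewrite qcomp0r qcomp_sumr (bigD1 j) //=.
rewrite clsM qcompA Ep qcomp1 big1 ?addr0 // => l ne.
rewrite clsM qcompA Eo ?qcomp0l // => El; move/eqP: ne; apply; exact: inj_e.
Qed.

(** The universal properties present an arbitrary coproduct S as a retract of the direct sum of
    resolutions. A map from T to S thus passes through that sum, where it has a strict
    representative of finite support, equal to the sum of its components. *)
Lemma fg_compact (T : dgMod A) : is_fg_twisted T -> is_compact P (T : D).
Proof.
move=> HT; have KT := kproj_fg HT; apply: compact_of_surj => I Y S inj HS h.
pose M i := res (Y i : dgMod A).
have HM i : kproj (M i) by exact: res_kproj.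
pose p i : qhom (M i : D) (Y i) := cg (res_map (Y i)).
pose p' i : qhom (Y i) (M i : D) := cls (loc_inv (@res_weq _ _ (Y i)) : @hom D _ _).
have Ep i : p i ** p' i = q1 (Y i).
  by rewrite -clsM; apply/clsE; exact: (@loc_invr (dgModCat A) (@weqII k A)).
have [t [Ht _]] := HS (dsum M : D) (fun i => qrep (cg (dg_in M i) ** p' i)).
have {}Ht i : cls t ** cls (inj i) = cg (dg_in M i) ** p' i.
  by rewrite -clsM -[RHS]qrepK; apply/clsE; exact: Ht.
have [s0 [Hs0 _]] := dsum_coproduct HM (fun i => qrep (cls (inj i) ** p i)).
have {}Hs0 i : cls s0 ** cg (dg_in M i) = cls (inj i) ** p i.
  by rewrite -clsM -[RHS]qrepK; apply/clsE; exact: Hs0.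
have Est : cls s0 ** cls t = q1 S.
  have [u [_ Hu]] := HS S inj.
  have E1 : s0 \c t =~ u.
    apply: Hu => i; apply/clsE; rewrite !clsM -qcompA Ht qcompA Hs0 -qcompA Ep.
    by rewrite q1comp.
  rewrite -clsM; apply/clsE; apply: heq_trans E1 _; apply: heq_sym.
  by apply: Hu => i; exact: cmp1m.
have [h0 Eh0] := cg_full (cls t ** h) KT.
have [s [Us Hs]] := fg_finite_support h0 HT.
exists s, (fun i => p i ** cg (dg_comp (dg_pr M i) h0)); split=> //.
have -> : h = cls s0 ** cg h0 by rewrite -Eh0 qcompA Est qcomp1.
have -> : cg h0 = \sum_(i <- s) cg (dg_in M i) ** cg (dg_comp (dg_pr M i) h0).
  pose F i := dg_comp (dg_in M i) (dg_comp (dg_pr M i) h0).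
  have [G [HG EG]] : exists G : dghom T (dsum M), (forall x, G x = \sum_(i <- s) F i x)
      /\ cg G = \sum_(i <- s) cg (F i).
    elim: (s) => [|i r [G [HG EG]]].
      by exists (dg0 _ _); split=> [x|]; rewrite big_nil // cg0.
    exists (dgD (F i) G); split=> [x|]; first by rewrite big_cons /= HG.
    by rewrite big_cons cgD EG.
  under eq_bigr => i _ do rewrite -cgM.
  rewrite -EG; apply: cg_eq1 => x; rewrite HG.
  exact: (dsum_decomp Us (Hs x)).
rewrite qcomp_sumr; apply: eq_bigr => i _.
by rewrite qcompA Hs0 !qcompA.
Qed.

Lemma retract_compact (X X' : D) (i : qhom X X') (p : qhom X' X) :
  p ** i = q1 X -> is_compact P X' -> is_compact P X.
Proof.
move=> pi H; apply: compact_of_surj => I Y S inj HS h.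
have [surj _] := H I Y S inj HS.
have [n [e [f [inj_e E]]]] := surj (qrep (h ** p)); move/clsE: E => E.
rewrite qrepK cls_big in E.
(* The family has to be indexed by all of [I], hence the transport along [e j = l]; as [e] is
   injective, at most one term of the sum is nonzero. *)
pose g (l : {classic I}) : qhom X (Y l) :=
  \sum_(j < n) match pselect (e j = l) with
    | left El => eq_rect (e j) (fun l => qhom X (Y l)) (cls (f j) ** i) l El
    | right _ => 0 end.
exists [seq (e j : {classic I}) | j <- enum 'I_n], g; split.
  by rewrite map_inj_uniq ?enum_uniq.
rewrite -[h]q1comp -pi qcompA E qcomp_suml big_map big_enum /=.
apply: eq_bigr => j _; rewrite clsM -qcompA; congr (_ ** _).
rewrite /g (bigD1 j) //= [X in _ + X]big1 ?addr0.
  by case: pselect => // Ej; rewrite (Prop_irrelevance Ej erefl).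
move=> l ne; case: pselect => // Ej.
by have El := inj_e _ _ Ej; rewrite El eqxx in ne.
Qed.

Lemma iso_compact (X X' : D) (x : qhom X X') :
  qiso x -> is_compact P X' -> is_compact P X.
Proof. by move=> [y [E _]]; exact: retract_compact E. Qed.

Section FiniteSubsum.
Variables (I : small) (M : I -> dgMod A).
Hypothesis HM : forall i, is_fg_twisted (M i).

(** Built by adding one summand at a time with [bsum], under which finitely generated twisted
    modules are closed; [j ** p] is the projector onto the subsum. *)
Lemma finite_subsum (s : seq {classic I}) : uniq s ->
  exists (U : dgMod A) (j : qhom (U : D) (dsum M : D)) (p : qhom (dsum M : D) (U : D)),
    [/\ is_fg_twisted U, p ** j = q1 (U : D) &
        j ** p = \sum_(i <- s) cg (dg_in M i) ** cg (dg_pr M i)].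
Proof.
elim: s => [_|i s IH /= /andP[ni /IH[U [j [p [HU Epj Ejp]]]]]].
  exists (zero_dg A), 0, 0; split; first exact: fg_free_dg.
    by rewrite qcomp0l zero_dg_zero.
  by rewrite qcomp0l big_nil.
have [i1 [i2 [p1 [p2 [E1 E2 E3 E4 E5]]]]] := bsum_biproduct (M i) U.
have pj : cg (dg_pr M i) ** j = 0.
  rewrite -[j]q1comp -Epj (qcompA j) Ejp qcompA qcomp_sumr big1_seq ?qcomp0l //.
  move=> l /= ls; rewrite qcompA cg_pr_in_other ?qcomp0l // => El.
  by rewrite -El ls in ni.
have pin : p ** cg (dg_in M i) = 0.
  rewrite -[p]qcomp1 -Epj -(qcompA p j p) Ejp -qcompA qcomp_suml big1_seq ?qcomp0r //.
  move=> l /= ls; rewrite -qcompA cg_pr_in_other ?qcomp0r // => El.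
  by rewrite El ls in ni.
exists (bsum (M i) U), (cg (dg_in M i) ** p1 + j ** p2),
  (i1 ** cg (dg_pr M i) + i2 ** p); split.
- exact: fg_bsum.
- rewrite qcompDl !qcompDr !qcompA.
  rewrite -(qcompA i1 _ (cg (dg_in M i))) cg_pr_in_same q1comp.
  rewrite -(qcompA i1 _ j) pj qcomp0r qcomp0l addr0.
  rewrite -(qcompA i2 p (cg _)) pin qcomp0r qcomp0l add0r.
  by rewrite -(qcompA i2 p j) Epj q1comp.
- rewrite big_cons -Ejp qcompDl !qcompDr !qcompA.
  rewrite -(qcompA _ p1 i1) E1 q1comp -(qcompA _ p1 i2) E3 qcomp0r qcomp0l addr0.
  by rewrite -(qcompA _ p2 i1) E4 qcomp0r qcomp0l add0r -(qcompA _ p2 i2) E2 q1comp.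
Qed.

(** Compactness writes [h] as a sum over finitely many indices, so the projector onto the
    corresponding subsum fixes [h]. *)
Lemma compact_factor_fg (X : dgMod A) (h : qhom (X : D) (dsum M : D)) :
  is_compact P (X : D) ->
  exists (U : dgMod A) (j : qhom (U : D) (dsum M : D)) (p : qhom (dsum M : D) (U : D))
      (h' : qhom (X : D) (U : D)),
    [/\ is_fg_twisted U, p ** j = q1 (U : D) & h = j ** h'].
Proof.
move=> HX; have KM i := kproj_fg (HM i).
have [surj _] := HX _ _ _ _ (dsum_coproduct KM).
have [n [e [f [inj_e E]]]] := surj (qrep h); move/clsE: E => E.
rewrite qrepK cls_big in E.
have Us : uniq [seq (e j : {classic I}) | j <- enum 'I_n].
  by rewrite map_inj_uniq ?enum_uniq.
have [U [j [p [HU Epj Ejp]]]] := finite_subsum Us.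
exists U, j, p, (p ** h); split=> //.
rewrite qcompA Ejp {2}E [in LHS]E qcomp_sumr; apply: eq_bigr => l _.
rewrite clsM qcompA; congr (_ ** _).
rewrite big_map big_enum /= qcomp_suml (bigD1 l) //= -qcompA cg_pr_in_same q1comp.
rewrite big1 ?addr0 // => l' ne; rewrite -qcompA cg_pr_in_other ?qcomp0r //.
by move=> /inj_e El; rewrite El eqxx in ne.
Qed.
End FiniteSubsum.

(** * A compact K-projective module is a homotopy retract of a twisted module *)

Section Descent.
Variable X : dgMod A.
Hypotheses (KX : kproj X) (CX : is_compact P (X : D)).

Lemma kproj_tower n : kproj (tower X n).
Proof.
elim: n => [|n IH]; first exact: KX.
by apply: kproj_cone => //; exact: kproj_all_source.
Qed.

Fixpoint tower_map n : qhom (X : D) (tower X n : D) :=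
  match n return qhom (X : D) (tower X n : D) with
  | 0 => q1 (X : D)
  | n.+1 => cg (tower_inj X n) ** tower_map n
  end.

(** As the telescope is zero, the inclusion of X into the sum of the tower lifts along [tower_diff]
    to some [g]. Comparing components, the n-th one of [g] must be [tower_map n], and by compactness
    almost all of them vanish. *)
Lemma tower_map_null : exists n, tower_map n = 0.
Proof.
(* The telescope is both acyclic and K-projective, so its identity is null homotopic. *)
have tel0 : q1 (tel X : D) = 0.
  rewrite -cg1; apply: cg_null.
  have KS : kproj (tower_sum X) by apply: kproj_dsum; exact: kproj_tower.
  have KT : kproj (tel X) by exact: kproj_cone.
  exact: (KT _ (@acyc_tel _ _ X) _ (chain_dg (dg_id (tel X)))).
have [g Hg] : exists g, cg (tower_diff X) ** g = cg (dg_in (tower X) 0%N).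
  apply: (et_Y (std_exact (tower_diff X))).
  by rewrite -[LHS]qcomp1 tel0 qcomp0l.
have Ed l : cg (tower_diff X) ** cg (dg_in (tower X) l) =
    cg (dg_in (tower X) l) - cg (dg_in (tower X) l.+1) ** cg (tower_inj X l).
  rewrite -!cgM -cgN -cgD; apply: cg_eq1 => x.
  by rewrite -[LHS]/(tower_diff X (din x)) tower_diffE tower_shift_in.
have Eg n : cg (dg_pr (tower X) n) ** g = tower_map n.
  elim: n => [|n IH].
    have E : cg (dg_pr (tower X) 0%N) ** cg (tower_diff X) = cg (dg_pr (tower X) 0%N).
      apply: (dsum_hom_ext kproj_tower) => l; rewrite -qcompA Ed qcompBr qcompA.
      by rewrite [X in _ - X ** _]cg_pr_in_other // qcomp0l subr0.
    by rewrite -E -qcompA Hg; exact: cg_pr_in_same.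
  have E : cg (dg_pr (tower X) n.+1) ** cg (tower_diff X) =
      cg (dg_pr (tower X) n.+1) - cg (tower_inj X n) ** cg (dg_pr (tower X) n).
    apply: (dsum_hom_ext kproj_tower) => l; rewrite -qcompA Ed qcompBr qcompBl.
    congr (_ - _); rewrite qcompA -[RHS]qcompA.
    case: (pselect (l = n)) => [->|ne]; first by rewrite !cg_pr_in_same qcomp1 q1comp.
    rewrite cg_pr_in_other ?qcomp0l; last by case.
    by rewrite cg_pr_in_other // qcomp0r.
  have := congr1 (fun z => z ** g) E; rewrite -qcompA Hg qcompBl -qcompA IH.
  by rewrite cg_pr_in_other // => /esym/eqP; rewrite subr_eq0 => /eqP ->.
have KM := kproj_tower.
have [surj _] := @CX _ _ _ _ (dsum_coproduct KM).
have [n [e [f [_ E]]]] := surj (qrep g); move/clsE: E => E.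
rewrite qrepK cls_big in E.
(* No index occurring in [g] exceeds [N], so the component at [N.+1] is zero. *)
pose N := (\max_(j < n) (e j : nat))%N.
exists N.+1; rewrite -(Eg N.+1) E qcomp_sumr big1 // => j _.
rewrite clsM qcompA cg_pr_in_other ?qcomp0l // => Ej.
by have := @leq_bigmax _ (fun l => e l : nat) j; rewrite -/N Ej ltnn.
Qed.

Definition factors n := exists (T : dgMod A) (a : qhom (T : D) (tower X n : D))
  (b : qhom (X : D) (T : D)), is_fg_twisted T /\ a ** b = tower_map n.

(** The boundary of T, its map to the shifted cells, meets only a finitely generated U by
    compactness of T. The cone F of the unshifted map to U then maps to the n-th stage, and X maps
    to F. The error, [tower_map n] minus the composite through F, dies in the next stage, so it
    comes from the cells; by compactness of X it factors through a finitely generated U2. Hence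
    [tower_map n] factors through the sum of F and U2. *)
Lemma factors_descend n : factors n.+1 -> factors n.
Proof.
move=> [T [a [b [HT Eab]]]].
(* T is rewritten as a shift, so that its boundary map runs between shifts and [qmap_surj] can
   unshift it. *)
pose T0 := shiftz (-1) T; have HT0 : is_fg_twisted T0 by exact: fg_shiftz.
have [ph [ps [phK psK]]] := shift_shiftz_iso T.
pose a' := a ** cg ph; pose b' : qhom (X : D) (shift T0 : D) := cg ps ** b.
have Eab' : a' ** b' = tower_map n.+1.
  rewrite /a' /b' -qcompA (qcompA (cg ph)) -cgM -Eab.
  by rewrite (cg_eq1 (g := dg_id T)) // cg1 qcomp1.
pose M0 := tower X n; pose u := all_eval M0.
have Tu : exact_tri (cg u) (cg (tower_inj X n)) (cg (cone_proj u)) by exact: std_exact.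
have [h Eh] := qmap_surj (cg (cone_proj u) ** a').
have HM (j : all_maps M0) : is_fg_twisted (fg_gen (tag j)) by exact: fg_gen_fg.
have [U [j [p [h' [HU Epj Ehj]]]]] := compact_factor_fg HM h (fg_compact HT0).
have [h0 Eh0] := cg_full h' (kproj_fg HT0).
pose F := cone h0; have HF : is_fg_twisted F by exact: fg_cone.
have TF := std_exact h0.
have [m Em] : exists m, cg (tower_inj X n) ** m = a' ** cg (cone_proj h0).
  apply: (et_Z Tu); rewrite qcompA -Eh Ehj Eh0 qmapM -qcompA (et_uw TF).
  by rewrite qcomp0r.
(* [b'] lifts to F since its boundary vanishes in U: the retraction [p] reduces this to the direct
   sum of cells, where it is the boundary of a map coming from the n-th stage. *)
have [b2 Eb2] : exists b2, cg (cone_proj h0) ** b2 = b'.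
  apply: (et_SX TF); rewrite -[LHS]qcomp1 -(qmap1 (U : D)) -Epj qmapM -qcompA.
  rewrite (qcompA (qmap j)) -qmapM -Eh0 -Ehj Eh -(qcompA _ a') Eab' /=.
  by rewrite (qcompA (cg _)) (et_wv Tu) qcomp0l qcomp0r.
have [g Eg] : exists g, cg u ** g = tower_map n - m ** b2.
  apply: (et_Y Tu); rewrite qcompBr (qcompA _ m) Em -(qcompA a') Eb2 Eab' /=.
  by rewrite subrr.
have [U2 [j2 [p2 [g2 [HU2 _ Eg2]]]]] := compact_factor_fg HM g CX.
have [i1 [i2 [q1' [q2 [E1 E2 E3 E4 E5]]]]] := bsum_biproduct F U2.
exists (bsum F U2), (m ** q1' + cg u ** j2 ** q2), (i1 ** b2 + i2 ** g2); split.
  exact: fg_bsum.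
rewrite qcompDl !qcompDr !qcompA.
rewrite -(qcompA _ q1' i1) E1 q1comp -(qcompA _ q1' i2) E3 qcomp0r qcomp0l addr0.
rewrite -(qcompA _ q2 i1) E4 qcomp0r qcomp0l add0r -(qcompA _ q2 i2) E2 q1comp.
by rewrite -(qcompA _ j2) -Eg2 Eg addrC subrK.
Qed.

Lemma compact_homotopy_retract :
  exists T : dgMod A, is_fg_twisted T /\ is_homotopy_retract X T.
Proof.
have [n En] := tower_map_null.
have Fn : factors n.
  exists (zero_dg A), 0, 0; split; first exact: fg_free_dg.
  by rewrite qcomp0l En.
have {n En Fn}[T [a [b [HT Eab]]]] : factors 0.
  by elim: n {En} Fn => // n IH /factors_descend.
have [a0 Ea] := cg_full a (kproj_fg HT); have [b0 Eb] := cg_full b KX.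
exists T; split=> //; exists b0, a0; apply/homotopic_hmt; apply: (cg_inj KX).
by rewrite cgM -Ea -Eb Eab cg1.
Qed.
End Descent.

End Compactness.

(** * Cofibrant modules are K-projective *)

Section Cofibrant.
Variables (k : fieldType) (A : dgAlg k).

(** Allows a contractible summand to be added to a resolution: [s] includes the old module and [r]
    projects the new summand away. *)
Lemma weqII_precomp (Q Q' M : dgMod A) (p : dghom Q M) (r : dghom Q' Q)
    (s : dghom Q Q') (p' : dghom Q' M) : weqII (X := Q) (Y := M) p ->
  hmt (dg_comp s r) (dg_id Q') -> hmt p' (dg_comp p r) -> (forall x, p' (s x) = p x) ->
  weqII (X := Q') (Y := M) p'.
Proof.
move=> Wp Hsr Hp' Eps; apply: weqII_of0 => T HT; split=> [z Hz|w].
  have Hrz : nullh (M := T) (N := Q) (dg_comp r z).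
    apply: (weqII_inj Wp HT).
    apply: nullh_ext (nullhB Hz (nullh_compr z Hp')) => t.
    by rewrite /= subKr.
  apply: nullh_ext (nullhB (nullh_compl s Hrz) (nullh_compr z Hsr)) => t.
  by rewrite /= subKr.
have [z Hz] := weqII_surj w Wp HT; exists (dg_comp s z).
by apply: nullh_ext Hz => t; rewrite /= Eps.
Qed.

(** The contractible module [C], a shifted cone of the identity of M, maps onto M; adding it makes
    the resolution a fibration as well as a weak equivalence. *)
Lemma surjective_resolution (M : dgMod A) : exists (Q : dgMod A) (p : dghom Q M),
  [/\ kproj Q, weqII (X := Q) (Y := M) p & forall y, exists x, p x = y].
Proof.
pose C := shiftz (-1) (cone (dg_id M)).
have HC : nullh (M := C) (N := C) id.
  have E := @nullh_shiftz _ _ (-1) (-1) 0 (cone (dg_id M)) (cone (dg_id M)) id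
    (esym (subrr _)).
  have E' := @nullh_shiftz _ _ 0 0 0 (cone (dg_id M)) (cone (dg_id M)) id
    (esym (subrr _)).
  by apply/E/E'/nullh_shiftz0L/nullh_shiftz0R; exact: nullh_cone_id.
have Hpi : chain (M := C) (N := M) (cone_proj (dg_id M)).
  apply/chain_shiftzL/chain_shiftzR/chain_shiftR; exact: chain_dg.
pose pi := dg_of Hpi; pose Q := bsum (res M) C.
have [i1 [i2 [p1 [p2 [E1 E2 E3 E4]]]]] := bsum_maps (res M) C.
pose p := dgD (dg_comp (res_map M) p1) (dg_comp pi p2).
exists Q, p; split.
- apply: kproj_cone; last exact: res_kproj.
  by apply: kproj_shiftz; exact: kproj_contractible.
- apply: (weqII_precomp (r := p1) (s := i1) (@res_weq _ _ M)).
  + apply: nullh_sym; apply: nullh_ext (nullh_compl i2 (nullh_compr p2 HC)) => x.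
    rewrite /= E1 E2 E3 E4; case: x => y z.
    by apply: injective_projections; rewrite /= ?subrr ?subr0.
  + apply: nullh_ext (nullh_compl pi (nullh_compr p2 HC)) => x.
    by rewrite /= [RHS]addrC addKr.
  + by move=> x; rewrite /= E3 E4 E1 /= addr0.
- move=> y; exists (0, (0, y)); rewrite /= E3 E4 /= linear0 add0r.
  by [].
Qed.

Lemma zero_dg_initial : @is_initial (dgModCat A) (zero_dg A).
Proof.
move=> Y; exists (dg0 (zero_dg A) Y) => g x.
by rewrite (zero_dg_eq x 0) /= (gm0 (gmap_dg g)).
Qed.

(** Lifting the identity along a surjective resolution makes M a strict retract of a K-projective
    module. *)
Lemma cofibrant_kproj (M : dgMod A) : is_cofibrantII M -> kproj M.
Proof.
move=> HM; have [Q [p [KQ Wp Sp]]] := surjective_resolution M.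
have LLP := HM _ (dg0 (zero_dg A) M) zero_dg_initial Q M p (conj Sp Wp).
have [|w [_ Ew]] := LLP (dg0 (zero_dg A) Q) (dg_id M).
  by move=> x /=; rewrite linear0.
move=> E HE f Hf.
have Hn := KQ E HE _ (chain_dg (dg_comp (dg_of Hf) p)).
by apply: nullh_ext (nullh_compr w Hn) => m /=; have /= -> := Ew m.
Qed.
End Cofibrant.

(** * Compact generation and the description of the compact objects *)

Section Conclusion.
Variables (k : fieldType) (A : dgAlg k).
Notation D := (DIIc A).
Notation P := (Dpreadd A).

Lemma acyc_zero_object (E : dgMod A) : acyc E -> q1 (E : D) = 0.
Proof.
move=> /weqII_to_zero/cg_iso[y [<- _]].
by rewrite -[cg _]qcomp1 zero_dg_zero qcomp0l qcomp0r.
Qed.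

(** The generators are K-projective, so the vanishing of morphisms from them in the localization
    gives null homotopies, and an object without such morphisms is acyclic. *)
Lemma D_compactly_generated : is_compactly_generated P (DIIc_shift A).
Proof.
split; first exact: D_coproducts.
exists (fg_index A), (fun i => fg_gen i : D); split=> [i|X HX _].
  by apply: fg_compact; exact: fg_gen_fg.
apply: zero_object_cls; apply: acyc_zero_object => T HT f Hf.
have [i [f0 [g0 [fK _]]]] := fg_gen_iso HT.
have H : nullh (M := fg_gen i) (N := X) (dg_comp (dg_of Hf) g0).
  apply: (cg_null_inv (kproj_fg (fg_gen_fg i))); rewrite -cls0.
  by apply/clsE; exact: (HX i 0%N).
by apply: nullh_ext (nullh_compr f0 H) => t; rewrite /= fK.
Qed.

Lemma homotopy_equivalent_qiso (M N : dgMod A) : homotopy_equivalent M N ->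
  exists x : qhom (M : D) (N : D), qiso x.
Proof.
move=> [f [g [/homotopic_hmt Hgf /homotopic_hmt Hfg]]]; exists (cg f), (cg g).
by rewrite -!cgM -!cg1; split; exact: cg_hmt.
Qed.

Lemma qiso_homotopy_equivalent (M N : dgMod A) (x : qhom (M : D) (N : D)) :
  kproj M -> kproj N -> qiso x -> homotopy_equivalent M N.
Proof.
move=> KM KN [y [E1 E2]]; have [f Ef] := cg_full x KM; have [g Eg] := cg_full y KN.
exists f, g; split; apply/homotopic_hmt.
  by apply: (cg_inj KM); rewrite cgM -Ef -Eg E1 cg1.
by apply: (cg_inj KN); rewrite cgM -Ef -Eg E2 cg1.
Qed.

Lemma fg_retract_compact (N : dgMod A) :
  is_fg_twisted_retract N -> is_compact P (gammaII A N).
Proof.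
move=> [N' [T [HT [i [p /homotopic_hmt Hpi]] /homotopy_equivalent_qiso[x Ix]]]].
apply: (iso_compact Ix); apply: (@retract_compact _ _ _ T (cg i) (cg p)).
  by rewrite -cgM -cg1; exact: cg_hmt.
exact: fg_compact.
Qed.

Lemma compact_res (M : dgMod A) : is_compact P (gammaII A M) ->
  exists T : dgMod A, is_fg_twisted T /\ is_homotopy_retract (res M) T.
Proof.
move=> HM; apply: compact_homotopy_retract; first exact: res_kproj.
exact: iso_compact (cg_iso (@res_weq _ _ M)) HM.
Qed.

(** The module realising the retract is the resolution of M, which is only isomorphic to M in the
    localization. *)
Lemma compact_iff_fg_retract (M : dgMod A) : is_compact P (gammaII A M) <->
  exists N : dgMod A, is_fg_twisted_retract N /\
    isomorphic (gammaII A M) (gammaII A N).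
Proof.
split=> [HM|[N [HN [f /qisoP If]]]].
  have [T [HT HR]] := compact_res HM; exists (res M); split.
    exists (res M), T; split=> //.
    exists (dg_id _), (dg_id _).
    by split; apply/homotopic_hmt; exact: hmt_eq1.
  have [y [E1 E2]] := cg_iso (@res_weq _ _ M).
  by exists (qrep y); apply/qisoP; rewrite qrepK; exists (cg (res_map M)).
exact: iso_compact If (fg_retract_compact HN).
Qed.

(** A cofibrant M is K-projective like its resolution, and an isomorphism between K-projective
    modules comes from a homotopy equivalence. *)
Lemma compact_cofibrant_iff (M : dgMod A) : is_cofibrantII M ->
  is_compact P (gammaII A M) <-> is_fg_twisted_retract M.
Proof.
move=> /cofibrant_kproj KM; split=> [HM|]; last exact: fg_retract_compact.
have [T [HT HR]] := compact_res HM; exists (res M), T; split=> //.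
have [y [E1 E2]] := cg_iso (@res_weq _ _ M).
apply: (qiso_homotopy_equivalent (x := y) KM (@res_kproj _ _ M)).
by exists (cg (res_map M)).
Qed.

End Conclusion.

Theorem mainTheorem3 (k : fieldType) (A : dgAlg k) (eps : augmentation A) :
  exists P : preadditive (DIIc A),
    is_triangulated P (@DIIc_dist k A) /\
    is_compactly_generated P (DIIc_shift A) /\
    (forall M : dgMod A,
       is_compact P (gammaII A M) <->
       exists N : dgMod A, is_fg_twisted_retract N /\
         isomorphic (gammaII A M) (gammaII A N)) /\
    (forall M : dgMod A, is_cofibrantII M ->
       (is_compact P (gammaII A M) <-> is_fg_twisted_retract M)).
Proof.
exists (Dpreadd A); split; first exact: D_triangulated.
split; first exact: D_compactly_generated.
split; first exact: compact_iff_fg_retract.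
exact: compact_cofibrant_iff.
Qed.
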